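(* Let $H:\mathbb{T}^d\times\mathbb{R}^d\to\mathbb{R}$ be of class $C^1$, with $p\mapsto H(x,p)$ strictly convex for every $x\in\mathbb{T}^d$, and $\lim_{|p|\to\infty}\inf_{x\in\mathbb{T}^d}H(x,p)=+\infty$. Let $f:\mathbb{T}^d\times[0,\infty)\to\mathbb{R}$ be continuous, with $r\mapsto f(x,r)$ strictly increasing for every $x\in\mathbb{T}^d$, and suppose there is $C>0$ with $|f(x,r)|\le C(1+r^{q-1})$ for all $(x,r)\in\mathbb{T}^d\times[0,\infty)$. Assume moreover that $$H(x,0)=\min_{p\in\mathbb{R}^d}H(x,p)\quad\text{for every }x\in\mathbb{T}^d.$$ Let $(m,\lambda)$ be an ergodic pair, and let $(u^\varepsilon,m^\varepsilon)_{\varepsilon>0}$ be a family of weak solutions to the discounted problem which satisfies the compactness and stability property. Then the whole family converges as $\varepsilon\to0$: $$\langle u^\varepsilon\rangle\rightharpoonup u_*\quad\text{weakly in }W^{1,s}(\mathbb{T}^d),$$ where $u_*$ is the unique element of $\mathcal{M}_J$ with $\int_{\mathbb{T}^d}u_*\,dx=0$.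
   Context: $\mathbb{T}^d$ is the $d$-dimensional flat torus, identified with $[0,1]^d$ (so $|\mathbb{T}^d|=1$). Fix $s>1$, $q>1$ with conjugate exponents $s',q'$, and assume the Sobolev embedding $W^{1,s}(\mathbb{T}^d)\hookrightarrow L^{q'}(\mathbb{T}^d)$. Write $\langle u\rangle:=u-\int_{\mathbb{T}^d}u\,dx$. Weak solutions of the ergodic problem: a triple $(u,m,\lambda)\in W^{1,s}(\mathbb{T}^d)\times L^q(\mathbb{T}^d)\times\mathbb{R}$ is a weak solution to the ergodic problem if (i) $m\ge0$ a.e., $\int_{\mathbb{T}^d}m\,dx=1$ and $mD_pH(x,Du)\in L^{s'}(\mathbb{T}^d;\mathbb{R}^d)$; (ii) $H(x,Du)\le f(x,m)+\lambda$ a.e. on $\mathbb{T}^d$; (iii) $H(x,Du)=f(x,m)+\lambda$ a.e. on $\{m>0\}$; (iv) $-\operatorname{div}(mD_pH(x,Du))=0$ in $\mathcal{D}'(\mathbb{T}^d)$. For fixed $(m,\lambda)$, $\mathcal{E}(m,\lambda)$ denotes the set of $u$ such that $(u,m,\lambda)$ is a weak solution. An ergodic pair is a pair $(m,\lambda)\in L^q(\mathbb{T}^d)\times\mathbb{R}$ with $\mathcal{E}(m,\lambda)\neq\emptyset$. Weak solutions of the discounted problem: for $\varepsilon>0$, $(u^\varepsilon,m^\varepsilon)\in W^{1,s}(\mathbb{T}^d)\times L^q(\mathbb{T}^d)$ is a weak solution to the discounted problem if $m^\varepsilon\ge0$ a.e., $\int m^\varepsilon\,dx=1$, $m^\varepsilon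 D_pH(x,Du^\varepsilon)\in L^{s'}(\mathbb{T}^d;\mathbb{R}^d)$, $\varepsilon u^\varepsilon+H(x,Du^\varepsilon)\le f(x,m^\varepsilon)$ a.e. on $\mathbb{T}^d$ with equality a.e. on $\{m^\varepsilon>0\}$, and $\varepsilon m^\varepsilon-\operatorname{div}(m^\varepsilon D_pH(x,Du^\varepsilon))=\varepsilon$ in $\mathcal{D}'(\mathbb{T}^d)$. Compactness and stability property of a family $(u^\varepsilon,m^\varepsilon)_{\varepsilon>0}$ of weak solutions to the discounted problem: for every sequence $\varepsilon_n\to0$ there exist a subsequence (not relabeled) and a triple $(\bar u,\bar m,\bar\lambda)\in W^{1,s}(\mathbb{T}^d)\times L^q(\mathbb{T}^d)\times\mathbb{R}$, which is a weak solution to the ergodic problem, such that $\langle u^{\varepsilon_n}\rangle\rightharpoonup\bar u$ weakly in $W^{1,s}(\mathbb{T}^d)$, $m^{\varepsilon_n}\rightharpoonup\bar m$ weakly in $L^q(\mathbb{T}^d)$, and $\varepsilon_n\int_{\mathbb{T}^d}u^{\varepsilon_n}\,dx\to-\bar\lambda$. Selection functional: for $u\in\mathcal{E}(m,\lambda)$, $J(u):=\int_{\mathbb{T}^d}\langle u\rangle\,m\,dx$, and $\mathcal{M}_J:=\operatorname*{argmin}_{u\in\mathcal{E}(m,\lambda)}J(u)$. *)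

(* Defs.v *)
From HB Require Import structures.
From mathcomp Require Import all_boot all_order all_algebra.
From mathcomp Require Import all_classical all_reals all_analysis.

Set Implicit Arguments.
Unset Strict Implicit.
Unset Printing Implicit Defensive.
Import Order.TTheory GRing.Theory Num.Theory.
Import numFieldNormedType.Exports.

Local Open Scope classical_set_scope.
Local Open Scope ring_scope.

(* Row vectors carry the sigma-algebra generated by the coordinates, exactly as
   the library does for [n.-tuple T]. *)
Definition measure_rV_display : measure_display -> measure_display.
Proof. exact. Qed.

Section measurable_rV.
Context {d} {T : sigmaRingType d}.
Variable n : nat.

Let coors : 'I_n -> 'rV[T]_n -> T := fun i x => x ord0 i.

Let rV_set0 : g_sigma_preimage coors set0.
Proof. exact: sigma_algebra0. Qed.

Let rV_setC A : g_sigma_preimage coors A -> g_sigma_preimage coors (~` A).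
Proof. exact: sigma_algebraC. Qed.

Let rV_bigcup (F : _^nat) : (forall i, g_sigma_preimage coors (F i)) ->
  g_sigma_preimage coors (\bigcup_i (F i)).
Proof. exact: sigma_algebra_bigcup. Qed.

HB.instance Definition _ := @isMeasurable.Build (measure_rV_display d)
  'rV[T]_n (g_sigma_preimage coors) rV_set0 rV_setC rV_bigcup.
End measurable_rV.

Lemma measurable_coord d (T : sigmaRingType d) n (i : 'I_n) :
  measurable_fun [set: 'rV[T]_n] (fun x : 'rV[T]_n => x ord0 i).
Proof.
move=> _ Y mY; rewrite setTI; apply: sub_sigma_algebra => /=.
rewrite -bigcup_seq/=; exists i => /=; first by rewrite mem_index_enum.
by exists Y => //; rewrite setTI.
Qed.

Lemma measurable_fun_rV d1 d2 (T1 : measurableType d1) (T2 : measurableType d2)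
    n (f : T1 -> 'rV[T2]_n) :
  (forall i, measurable_fun [set: T1] (fun x => f x ord0 i)) ->
  measurable_fun [set: T1] f.
Proof.
move=> mf _ A mA; rewrite setTI; move: A mA.
suff: @measurable _ 'rV[T2]_n `<=` [set A | measurable (f @^-1` A)] by [].
apply: smallest_sub.
  split => /=.
  - by rewrite preimage_set0.
  - by move=> A mA; rewrite setTD preimage_setC; exact: measurableC.
  - by move=> F mF; rewrite preimage_bigcup; exact: bigcup_measurable.
rewrite -bigcup_seq; apply: bigcup_sub => i _ _ [B mB <-] /=.
by rewrite setTI -[X in measurable X]setTI; exact: mf.
Qed.

Section torus_measure.
Context (R : realType).

Definition rV_cons n (z : measurableTypeR R * 'rV[R]_n) : 'rV[R]_n.+1 :=
  row_mx (const_mx z.1 : 'rV[R]_1) z.2.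

Lemma rV_cons0 n (z : measurableTypeR R * 'rV[R]_n) : rV_cons z ord0 ord0 = z.1.
Proof.
rewrite /rV_cons (_ : ord0 = lshift n (ord0 : 'I_1)); last exact/val_inj.
by rewrite [LHS]row_mxEl mxE.
Qed.

Lemma rV_consS n (z : measurableTypeR R * 'rV[R]_n) (i : 'I_n) :
  rV_cons z ord0 (lift ord0 i) = z.2 ord0 i.
Proof.
rewrite /rV_cons (_ : lift ord0 i = rshift 1 i); last exact/val_inj.
by rewrite [LHS]row_mxEr.
Qed.

Lemma measurable_rV_cons n :
  measurable_fun [set: measurableTypeR R * 'rV[R]_n] (@rV_cons n).
Proof.
apply: measurable_fun_rV => i; have [->|[j ->]] : i = ord0 \/ exists j, i = lift ord0 j.
  by case: (unliftP ord0 i) => [j|] ->; [right; exists j|left].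
- under eq_fun do rewrite rV_cons0.
  have mid : measurable_fun [set: measurableTypeR R] (fun x => x : R).
    by move=> _ Y mY; rewrite setTI.
  exact: (measurableT_comp mid measurable_fst).
- under eq_fun do rewrite rV_consS.
  exact: (measurableT_comp (measurable_coord j) measurable_snd).
Qed.

HB.instance Definition _ n :=
  isMeasurableFun.Build _ _ _ _ (@rV_cons n) (@measurable_rV_cons n).

(* Lebesgue measure on the fundamental domain [0, 1]^n of the flat torus,
   the n-fold product of Lebesgue measure on [0, 1]. *)
Fixpoint torus_measure n : probability 'rV[R]_n R :=
  if n is k.+1
  then distribution (uniform_prob (@ltr01 R) \x torus_measure k)%E (@rV_cons k)
  else dirac (0 : 'rV[R]_0).

Lemma uniform01_itv (a b : R) : 0 <= a -> a <= b -> b <= 1 ->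
  uniform_prob (@ltr01 R) `[a, b] = (b - a)%:E.
Proof.
move=> a0 ab b1; rewrite /uniform_prob integral_uniform_pdf setIidl; last first.
  move=> x /=; rewrite !in_itv/= => /andP[ax xb].
  by rewrite (le_trans a0 ax) (le_trans xb b1).
rewrite (eq_integral (cst 1%:E)); last first.
  move=> x; rewrite inE/= in_itv/= => /andP[ax xb].
  by rewrite /uniform_pdf (le_trans a0 ax) (le_trans xb b1)/= subr0 invr1.
rewrite integral_cst//= mul1e lebesgue_measure_itv/= lte_fin.
move: ab; rewrite le_eqVlt => /orP[/eqP ->|->]; last by rewrite EFinB.
by rewrite ltxx subrr.
Qed.

Lemma torus_measure_box n (a b : 'I_n -> R) :
  (forall i, 0 <= a i) -> (forall i, a i <= b i) -> (forall i, b i <= 1) ->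
  torus_measure n [set x | forall i, a i <= x ord0 i <= b i] =
  (\prod_(i < n) (b i - a i))%:E.
Proof.
elim: n a b => [|n IH] a b a0 ab b1.
  by rewrite big_ord0 /= diracE mem_set//= => -[].
pose B := [set x : 'rV[R]_n |
  forall i, a (lift ord0 i) <= x ord0 i <= b (lift ord0 i)].
have mB : measurable B.
  rewrite (_ : B = \bigcap_(i in [set: 'I_n])
      ((fun x : 'rV[R]_n => x ord0 i) @^-1`
        `[a (lift ord0 i), b (lift ord0 i)])); last first.
    by apply/seteqP; split=> x /= h i => [_|]; have := h i;
      rewrite /= in_itv//=; exact.
  apply: fin_bigcap_measurable => // i _.
  by rewrite -[X in measurable X]setTI; exact: measurable_coord.
have BE : @rV_cons n @^-1` [set x | forall i, a i <= x ord0 i <= b i] =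
    `[a ord0, b ord0] `*` B.
  apply/seteqP; split=> -[r x] /= => [h|[r01 h] i].
    split=> [|i]; last by have := h (lift ord0 i); rewrite rV_consS.
    by have := h ord0; rewrite rV_cons0 in_itv.
  case: (unliftP ord0 i) => [j|] ->; rewrite ?rV_consS//.
  by rewrite rV_cons0; move: r01; rewrite in_itv.
transitivity ((uniform_prob (@ltr01 R) \x torus_measure n)%E
    (`[a ord0, b ord0] `*` B)); first by rewrite -BE.
rewrite product_measure1E// big_ord_recl EFinM; congr (_ * _)%E.
  exact: uniform01_itv.
by apply: (IH (a \o lift ord0) (b \o lift ord0)) => i /=.
Qed.
End torus_measure.

Section smooth.
Context {R : realType} {V : normedModType R}.

Fixpoint class_C (k : nat) (g : V -> R) : Prop :=
  if k is k'.+1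
  then (forall x, differentiable g x) /\ (forall v, class_C k' ('D_v g))
  else continuous g.

Definition class_Coo (g : V -> R) : Prop := forall k, class_C k g.

Definition strictly_convex (g : V -> R) : Prop :=
  forall p p' (t : R), p != p' -> 0 < t < 1 ->
    g (t *: p + (1 - t) *: p') < t * g p + (1 - t) * g p'.

End smooth.

Section row_vectors.
Context {R : realType} {d : nat}.
Implicit Types g : 'rV[R]_d -> R.

Definition dotv (a b : 'rV[R]_d) : R := \sum_(i < d) a ord0 i * b ord0 i.

Definition grad g (x : 'rV[R]_d) : 'rV[R]_d := \row_i 'D_(delta_mx ord0 i) g x.

(* Functions on the torus are Z^d-periodic functions on R^d. *)
Definition torus_periodic (T : Type) (g : 'rV[R]_d -> T) : Prop :=
  forall (i : 'I_d) x, g (x + delta_mx ord0 i) = g x.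

End row_vectors.

Section function_spaces.
Context {R : realType} {d : nat}.
Local Notation V := 'rV[R]_d.
Local Notation mu := (torus_measure R d).
Implicit Types (u v w g : V -> R) (p : \bar R) (s : R).

(* Elements of L^p and W^{1,s} are represented by functions; equality in these
   spaces is equality mu-almost everywhere. *)
Definition torus_Lp p : set (V -> R) :=
  [set u | torus_periodic u /\ u \in Lfun mu p].

Definition torus_norm p u : \bar R := 'N[mu]_p[EFin \o u].

Definition mean u : R := \int[mu]_x u x.

Definition recenter u : V -> R := fun x => u x - mean u.

Definition test_function : set (V -> R) :=
  [set phi | torus_periodic phi /\ class_Coo phi].

Definition is_weak_partial (i : 'I_d) u v : Prop :=
  torus_Lp 1%E v /\
  forall phi, test_function phi ->
    \int[mu]_x (u x * grad phi x ord0 i) = - \int[mu]_x (v x * phi x).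

(* The weak partial derivative, unique up to a null set; 0 if there is none. *)
Definition weak_partial (i : 'I_d) u : V -> R :=
  xget (cst 0) [set v | is_weak_partial i u v].

Definition weak_grad u : V -> V := fun x => \row_i weak_partial i u x.

Definition sobolev s : set (V -> R) :=
  [set u | torus_Lp s%:E u /\
    forall i, exists2 v, is_weak_partial i u v & torus_Lp s%:E v].

Definition sobolev_norm s u : \bar R :=
  (torus_norm s%:E u + \sum_(i < d) torus_norm s%:E (weak_partial i u))%E.

Definition sobolev_embedding s p : Prop :=
  exists C : R, forall u, sobolev s u ->
    torus_Lp p u /\ (torus_norm p u <= C%:E * sobolev_norm s u)%E.

(* [X] is a linear space of functions, seminormed by [N] (a norm modulo
   almost everywhere equality). *)
Definition bounded_functional (X : set (V -> R)) (N : (V -> R) -> \bar R)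
    (l : (V -> R) -> R) : Prop :=
  (forall (a : R) u v, X u -> X v ->
     l (fun x => a * u x + v x) = a * l u + l v) /\
  exists C : R, forall u, X u -> (`|l u|%:E <= C%:E * N u)%E.

Definition weak_cvg (X : set (V -> R)) (N : (V -> R) -> \bar R)
    (I : Type) (F : set_system I) (u : I -> V -> R) (w : V -> R) : Prop :=
  forall l, bounded_functional X N l -> l (u i) @[i --> F] --> l w.

Definition weak_cvg_Lp p := weak_cvg (torus_Lp p) (torus_norm p).

Definition weak_cvg_sobolev s := weak_cvg (sobolev s) (sobolev_norm s).

(* The distribution [div F]. *)
Definition divergence (F : V -> V) (phi : V -> R) : R :=
  - \int[mu]_x dotv (F x) (grad phi x).

End function_spaces.

Section mean_field_game.
Context {R : realType} {d : nat}.
Local Notation V := 'rV[R]_d.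
Local Notation mu := (torus_measure R d).
Variables (s q : R) (H : V -> V -> R) (f : V -> R -> R).
Implicit Types (u m : V -> R) (lam eps : R).

(* m D_p H(x, Du) *)
Definition flux u m : V -> V := fun x => m x *: grad (H x) (weak_grad u x).

Definition admissible u m : Prop :=
  [/\ sobolev s u, torus_Lp q%:E m, {ae mu, forall x, 0 <= m x},
      \int[mu]_x m x = 1 &
      forall i, torus_Lp (hoelder_conjugate s%:E) (fun x => flux u m x ord0 i)].

Definition ergodic_solution u m lam : Prop :=
  [/\ admissible u m,
      {ae mu, forall x, H x (weak_grad u x) <= f x (m x) + lam},
      {ae mu, forall x, 0 < m x -> H x (weak_grad u x) = f x (m x) + lam} &
      forall phi, test_function phi -> - divergence (flux u m) phi = 0].

Definition ergodic_set m lam : set (V -> R) :=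
  [set u | ergodic_solution u m lam].

Definition ergodic_pair m lam : Prop :=
  torus_Lp q%:E m /\ ergodic_set m lam !=set0.

Definition discounted_solution eps u m : Prop :=
  [/\ admissible u m,
      {ae mu, forall x, eps * u x + H x (weak_grad u x) <= f x (m x)},
      {ae mu, forall x, 0 < m x ->
        eps * u x + H x (weak_grad u x) = f x (m x)} &
      forall phi, test_function phi ->
        eps * (\int[mu]_x (m x * phi x)) - divergence (flux u m) phi =
        eps * \int[mu]_x phi x].

Definition compact_stable (u m : R -> V -> R) : Prop :=
  forall e : R^nat, (forall n, 0 < e n) -> e @ \oo --> 0 ->
  exists (k : nat -> nat) (ub mb : V -> R) (lb : R),
    {homo k : i j / (i < j)%N} /\
    [/\ ergodic_solution ub mb lb,
        weak_cvg_sobolev s \oo (fun n => recenter (u (e (k n)))) ub,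
        weak_cvg_Lp q%:E \oo (fun n => m (e (k n))) mb &
        e (k n) * mean (u (e (k n))) @[n --> \oo] --> - lb].

Definition selection m u : R := \int[mu]_x (recenter u x * m x).

Definition argmin_selection m lam : set (V -> R) :=
  [set u | ergodic_set m lam u /\
    forall v, ergodic_set m lam v -> selection m u <= selection m v].

End mean_field_game.

(* Main.v *)
Require Import Defs.
From mathcomp Require Import all_boot all_order all_algebra.
From mathcomp Require Import all_classical all_reals all_analysis.
From mathcomp Require Import measurable_realfun ring lra.
Import Order.TTheory GRing.Theory Num.Theory.
Import numFieldNormedType.Exports.
Local Open Scope classical_set_scope.
Local Open Scope ring_scope.
Set Implicit Arguments.
Unset Strict Implicit.
Unset Printing Implicit Defensive.

(** Ergodic solutions are very rigid. If (u, m, lam) is one, testing the equation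
    -div(m D_p H(x, Du)) = 0 with u shows that m D_p H(x, Du) . Du integrates to 0;
    since H x is strictly convex with minimum at 0, this forces Du = 0 where m > 0
    ([weak_grad_flat]). Hence (m, lam) solves H(x, 0) = f(x, m) + lam where m > 0,
    which by monotonicity of f determines it ([ergodic_density_uniq]), and the
    solutions u are simply the Sobolev functions with H(x, Du) <= f(x, m) + lam
    ([ergodic_solutionP]). By convexity of H x this set contains u1 + G(u2 - u1)
    along with u1 and u2, for every smooth enough G with 0 <= G' <= 1
    ([ergodic_set_interpolate]).

    The functional J is linear, so that its minimisers need not be unique for
    abstract reasons. Let u1 and u2 be minimisers and z = u2 - u1. Comparing with
    the interpolations shows that the integral of G(z) (m - 1) is 0 for all
    admissible G ([argmin_excess0]); letting G concentrate at a point, each level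
    set of z has the same volume as m-mass ([argmin_level0]). On the open set where
    f(x, 0) + lam < H(x, 0), which is {m > 0} up to a null set, z has zero gradient
    and so takes countably many values ([countable_values]). Countably many level
    sets of z thus carry m, and then also the volume; since the gradient of z
    vanishes almost everywhere on a level set ([weak_partial_level_set]), z is
    constant ([argmin_diff_cst]).

    The discounted problem enters through one inequality, a duality estimate
    between a discounted solution (u^eps, m^eps) and an ergodic one (v, m, lam): by
    convexity of H and monotonicity of f, the integral of <u^eps> m is at most that
    of <v> m^eps ([discounted_excess]). Each side is linear in a weakly convergent
    sequence, so that every limit point of <u^eps> is a minimiser of J of mean 0
    ([vanishing_discount_subsequence]), and uniqueness of the minimiser gives
    convergence of the whole family ([vanishing_discount]).

    These arguments test equations with Sobolev functions and use a chain rule for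
    weak derivatives. Both are obtained by mollification with normalised powers of a
    trigonometric polynomial: such a kernel is a finite sum of products of test
    functions, so that convolutions are manifestly smooth, and it preserves
    periodicity. The analytic core is the convergence of mollifications in mean
    ([approximable_L1]) and in duality pairings ([mollify_pairing]), the chain rule
    ([chain_rule]) and the extension of weak equations to Sobolev test functions
    ([weak_eq_sobolev]). *)

(** * Borel sets and periodic functions *)

Section borel.
Context (R : realType).

Definition rat_box n (c : 'rV[rat]_n) (k : nat) : set 'rV[R]_n :=
  [set x | forall i, `|x ord0 i - ratr (c ord0 i)| < k.+1%:R^-1].

Lemma measurable_rat_box n (c : 'rV[rat]_n) k : measurable (rat_box c k).
Proof.
rewrite (_ : rat_box c k = \bigcap_(i in [set: 'I_n])
  ((fun x : 'rV[R]_n => x ord0 i) @^-1` [set t | `|t - ratr (c ord0 i)| < k.+1%:R^-1])).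
  apply: fin_bigcap_measurable => // i _.
  rewrite -[X in measurable X]setTI; apply: measurable_coord => //.
  rewrite (_ : [set t | _] = ball (ratr (c ord0 i) : R) k.+1%:R^-1).
    exact: measurable_ball.
  by apply/seteqP; split=> t /=; rewrite -ball_normE /= distrC.
by apply/seteqP; split=> x h i => [_|]; apply: h.
Qed.

Lemma rat_box_cover n k (x : 'rV[R]_n) : exists c, rat_box c k x.
Proof.
have k0 : 0 < k.+1%:R^-1 :> R by rewrite invr_gt0.
have hc i : exists r : rat, `|x ord0 i - ratr r| < k.+1%:R^-1.
  have /rat_in_itvoo[r] : x ord0 i - k.+1%:R^-1 < x ord0 i + k.+1%:R^-1.
    by rewrite ltrBlDr -addrA ltrDl addr_gt0.
  rewrite in_itv /= => /andP[a b]; exists r.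
  by rewrite ltr_distlC; apply/andP; split.
exists (\row_i sval (cid (hc i))) => i.
by rewrite mxE; exact: (svalP (cid (hc i))).
Qed.

Lemma rat_box_sub n k (c : 'rV[rat]_n) (x : 'rV[R]_n) (e : R) : 0 < e ->
  k.+1%:R^-1 < e / 2 -> rat_box c k x -> rat_box c k `<=` ball x e.
Proof.
move=> e0 ke cx y hy; split=> // i j; rewrite [i]ord1 -ball_normE /=.
have := hy j; have := cx j; set r := ratr _ => h1 h2.
rewrite (_ : x ord0 j - y ord0 j = (x ord0 j - r) + (r - y ord0 j)); last by ring.
rewrite (le_lt_trans (ler_normD _ _))// (_ : e = e / 2 + e / 2); last by field.
by apply: ltrD; [exact: lt_trans ke|rewrite distrC; exact: lt_trans ke].
Qed.

Lemma exists_invS_lt (e : R) : 0 < e -> exists k : nat, k.+1%:R^-1 < e.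
Proof. by move=> /ltr_add_invr[k]; rewrite add0r; exists k. Qed.

(** The sigma-algebras at hand are generated by coordinates; an open set belongs to
    them because it is the union of the products of small rational boxes that it
    contains, and there are countably many of these. *)
Lemma measurable_open_prod n k (O : set ('rV[R]_n * 'rV[R]_k)) :
  open O -> measurable O.
Proof.
move=> oO.
pose B (I : 'rV[rat]_n * 'rV[rat]_k * nat) : set ('rV[R]_n * 'rV[R]_k) :=
  rat_box I.1.1 I.2 `*` rat_box I.1.2 I.2.
rewrite (_ : O = \bigcup_I (if `[< B I `<=` O >] then B I else set0)).
  apply: countable_bigcupT_measurable; first exact: countableP.
  move=> I; case: ifP => // _; apply: measurableX; exact: measurable_rat_box.
apply/seteqP; split => [x Ox|x [I _]]; last by case: ifP => // /asboolP; apply.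
have /nbhs_ballP[e /= e0 eO] := open_nbhs_nbhs (conj oO Ox).
have [l hl] : exists l : nat, l.+1%:R^-1 < e / 2 by apply: exists_invS_lt; rewrite divr_gt0.
have [c1 h1] := rat_box_cover l x.1; have [c2 h2] := rat_box_cover l x.2.
exists (c1, c2, l) => //; case: ifPn => [_|/asboolP[]]; first by split.
by move=> [y z] [/= hy hz]; apply: eO; split; [exact: (rat_box_sub e0 hl h1)|exact: (rat_box_sub e0 hl h2)].
Qed.

(** This is what makes D_p H(x, Du) measurable: H is jointly regular, but Du is
    only a measurable function. *)
Lemma measurable_comp_continuous2 n k (g : 'rV[R]_n * 'rV[R]_k -> R)
    (w : 'rV[R]_n -> 'rV[R]_k) :
  continuous g -> (forall i, measurable_fun setT (fun x => w x ord0 i)) ->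
  measurable_fun setT (fun x => g (x, w x)).
Proof.
move=> cg mw; apply: (measurability _ (RGenOpens.measurableE R)).
move=> _ [_ [a [b ->] <-]]; rewrite setTI.
have mp : measurable_fun setT (fun x => (x, w x)).
  by apply: measurable_fun_pair => //; exact: measurable_fun_rV.
rewrite (_ : _ @^-1` _ = (fun x => (x, w x)) @^-1` (g @^-1` `]a, b[))//.
rewrite -[X in measurable X]setTI; apply: mp => //.
apply: measurable_open_prod; apply: open_comp; last exact: interval_open.
by move=> ? _; exact: cg.
Qed.

Lemma measurable_continuous_rV n (g : 'rV[R]_n -> R) :
  continuous g -> measurable_fun setT g.
Proof.
move=> cg; (* The second factor is the one-point space of rows of length 0. *)
apply: (@measurable_comp_continuous2 n 0 (fun z => g z.1) (fun=> 0)).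
  by move=> z; apply: continuous_comp; [exact: cvg_fst|exact: cg].
by move=> i; under eq_fun do rewrite mxE; exact: measurable_cst.
Qed.

Section periodic.
Context (d : nat).
Local Notation V := 'rV[R]_d.

Lemma periodic_shift T (g : V -> T) : torus_periodic g ->
  forall (z : 'I_d -> int) x, g (x + \row_i (z i)%:~R) = g x.
Proof.
move=> pg z x.
have pn i (n : nat) y : g (y + n%:R *: delta_mx ord0 i) = g y.
  elim: n y => [|n IH] y; first by rewrite scale0r addr0.
  by rewrite -natr1 scalerDl scale1r addrA pg.
have pz i (n : int) y : g (y + n%:~R *: delta_mx ord0 i) = g y.
  case: n => n; first exact: pn.
  by rewrite NegzE mulrNz scaleNr -[LHS](pn i n.+1) -pmulrn subrK.
have ps (r : seq 'I_d) y :
    g (y + \sum_(i <- r) (z i)%:~R *: delta_mx ord0 i) = g y.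
  elim: r y => [|i r IH] y; first by rewrite big_nil addr0.
  by rewrite big_cons addrA IH pz.
rewrite -[RHS](ps (index_enum 'I_d)); congr (g (_ + _)).
apply/rowP => i; rewrite mxE summxE (bigD1 i)//= big1 => [|j ji].
  by rewrite !mxE !eqxx mulr1 addr0.
by rewrite !mxE [i == j]eq_sym (negbTE ji) andbF mulr0.
Qed.

Lemma periodic_in_cube T (g : V -> T) : torus_periodic g ->
  forall x, exists2 y : V, (forall i, 0 <= y ord0 i <= 1) & g x = g y.
Proof.
move=> pg x; pose z (i : 'I_d) := - Num.floor (x ord0 i).
exists (x + \row_i (z i)%:~R); last by rewrite periodic_shift.
move=> i; rewrite !mxE /z mulrNz.
have /andP[] := floor_itv (x ord0 i); rewrite intrD => a b.
by apply/andP; split; lra.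
Qed.

(** A periodic function takes all its values on the unit cube, which is compact. *)
Lemma continuous_periodic_bounded (g : V -> R) : torus_periodic g ->
  continuous g -> exists2 M, 0 <= M & forall x, `|g x| <= M.
Proof.
move=> pg cg.
pose K : set V := [set x | forall i, x ord0 i \in `[0%R, 1%R]].
have cK : compact K.
  exact: (@rV_compact R d (fun=> [set` `[0%R, 1%R]]) (fun=> @segment_compact R 0 1)).
have : compact (g @` K) by apply: continuous_compact => //; exact/continuous_subspaceT.
move=> /compact_bounded[M [_ hM]].
exists (Num.max 0 (M + 1)); first by rewrite le_max lexx.
move=> x; have [y yK ->] := periodic_in_cube pg x.
rewrite le_max; apply/orP; right; apply: (hM (M + 1)); first by rewrite ltrDl.
by exists y => // i; rewrite in_itv.
Qed.

End periodic.
End borel.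

(** * Smooth functions and test functions *)

Section smoothness.
Context (R : realType) (V : normedModType R).
Implicit Types f g : V -> R.

Lemma class_CSW k g : class_C k.+1 g -> class_C k g.
Proof.
elim: k g => [|k IH] g [dg Dg].
  by move=> x; exact: differentiable_continuous.
by split=> // v; exact: IH.
Qed.

Lemma class_C_continuous k g : class_C k g -> continuous g.
Proof. by elim: k g => // k IH g /class_CSW; exact: IH. Qed.

Lemma class_C_cst k (c : R) : class_C k (cst c : V -> R).
Proof.
elim: k c => [|k IH] c; first exact: cst_continuous.
split => [x|v]; first exact: differentiable_cst.
rewrite (_ : 'D_v _ = cst 0); first exact: IH.
by apply/funext => x; rewrite derive_cst.
Qed.

Lemma class_CD k f g : class_C k f -> class_C k g -> class_C k (f \+ g).
Proof.
elim: k f g => [|k IH] f g; first by move=> cf cg x; apply: continuousD; [exact: cf|exact: cg].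
move=> [df Df] [dg Dg]; split => [x|v]; first exact: differentiableD.
rewrite (_ : 'D_v _ = 'D_v f \+ 'D_v g); first by apply: IH; [exact: Df|exact: Dg].
by apply/funext => x; rewrite deriveD//; exact: diff_derivable.
Qed.

Lemma class_CM k f g : class_C k f -> class_C k g -> class_C k (f \* g).
Proof.
elim: k f g => [|k IH] f g; first by move=> cf cg x; apply: continuousM; [exact: cf|exact: cg].
move=> /[dup] /class_CSW cf [df Df] /[dup] /class_CSW cg [dg Dg].
split => [x|v]; first exact: differentiableM.
rewrite (_ : 'D_v _ = (f \* 'D_v g) \+ (g \* 'D_v f)).
  by apply: class_CD; apply: IH => //; do ?[exact: Dg|exact: Df].
by apply/funext => x; rewrite deriveM//; exact: diff_derivable.
Qed.

Lemma differentiable_comp_real (G : R -> R) g x :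
  differentiable g x -> derivable G (g x) 1 -> differentiable (G \o g) x.
Proof. by move=> dg dG; apply: differentiable_comp => //; exact/derivable1_diffP. Qed.

Lemma derive_comp_real (G : R -> R) g x v :
  differentiable g x -> derivable G (g x) 1 ->
  'D_v (G \o g) x = 'D_1 G (g x) * 'D_v g x.
Proof.
move=> dg dG; have dGg := differentiable_comp_real dg dG.
rewrite deriveE// [in RHS](deriveE _ dg).
have dG' : differentiable G (g x) by exact/derivable1_diffP.
rewrite diff_comp//.
by rewrite /= deriv1E// derive1E mulrC.
Qed.

End smoothness.

Section test_functions.
Context (R : realType) (d : nat).
Local Notation V := 'rV[R]_d.
Implicit Types (f g : V -> R) (i : 'I_d).

Lemma gradE g x i : grad g x ord0 i = 'D_(delta_mx ord0 i) g x.
Proof. by rewrite mxE. Qed.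

Lemma test_cst (c : R) : test_function (cst c : V -> R).
Proof. by split => // k; exact: class_C_cst. Qed.

Lemma test_D f g : test_function f -> test_function g -> test_function (f \+ g).
Proof.
move=> [pf cf] [pg cg]; split => [i x|k] /=; first by rewrite pf pg.
exact: class_CD.
Qed.

Lemma test_M f g : test_function f -> test_function g -> test_function (f \* g).
Proof.
move=> [pf cf] [pg cg]; split => [i x|k] /=; first by rewrite pf pg.
exact: class_CM.
Qed.

Lemma test_differentiable g x : test_function g -> differentiable g x.
Proof. by move=> [_ /(_ 1%N)[+ _]]. Qed.

Lemma test_continuous g : test_function g -> continuous g.
Proof. by move=> [_ /(_ 0%N)]. Qed.

Lemma periodic_derive g v : torus_periodic g -> torus_periodic ('D_v g).
Proof.
move=> pg i x; rewrite /derive.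
rewrite (_ : (fun h => _) = fun h => h^-1 *: ((g \o shift x) (h *: v) - g x))//.
by apply/funext => h /=; rewrite addrA !pg.
Qed.

Lemma test_derive g v : test_function g -> test_function ('D_v g).
Proof.
by move=> [pg cg]; split; [exact: periodic_derive|move=> k; exact: (cg k.+1).2].
Qed.

Lemma derive_coord i v (x : V) : 'D_v (fun y : V => y ord0 i) x = v ord0 i.
Proof.
have : 'D_v id x = v by rewrite derive_id.
rewrite derive_mx; last exact: derivable_id.
by move=> /matrixP /(_ ord0 i); rewrite mxE.
Qed.

(** Sine and cosine are proved smooth together, since each is up to a factor the
    derivative of the other. *)
Lemma test_trig i :
  test_function (fun x : V => cos (2 * pi * x ord0 i)) /\
  test_function (fun x : V => sin (2 * pi * x ord0 i)).
Proof.
pose l (x : V) : R := 2 * pi * x ord0 i.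
have dc x : differentiable (fun y : V => y ord0 i) x by exact: differentiable_coord.
have dl x : differentiable l x.
  by apply: differentiableM => //; exact: differentiable_cst.
have Dl v x : 'D_v l x = l v.
  rewrite /l deriveM; [|exact: diff_derivable|exact: diff_derivable].
  by rewrite derive_cst scaler0 addr0 derive_coord.
have pl (x : V) j : l (x + delta_mx ord0 j) = if i == j then l x + pi *+ 2 else l x.
  rewrite /l !mxE eqxx/=; case: eqP => _; last by rewrite addr0.
  by rewrite mulrDr (_ : true%:R = 1)// mulr1 !mulr_natl.
have Dcos v : 'D_v (fun x : V => cos (l x)) = cst (- l v) \* (fun x : V => sin (l x)).
  apply/funext => x; rewrite (derive_comp_real (G := cos))//= derive_val Dl.
  by rewrite mulrC mulrN mulNr.
have Dsin v : 'D_v (fun x : V => sin (l x)) = cst (l v) \* (fun x : V => cos (l x)).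
  apply/funext => x; rewrite (derive_comp_real (G := sin))//= derive_val Dl.
  by rewrite mulrC.
have dcos x : differentiable (fun x : V => cos (l x)) x.
  exact: (@differentiable_comp_real _ _ cos).
have dsin x : differentiable (fun x : V => sin (l x)) x.
  exact: (@differentiable_comp_real _ _ sin).
suff h k : class_C k (fun x : V => cos (l x)) /\ class_C k (fun x : V => sin (l x)).
  split; (split => [j x|k]; last by case: (h k)); rewrite -/(l _) -/(l x) pl.
  - by case: eqP => // _; rewrite cosD2pi.
  - by case: eqP => // _; rewrite sinD2pi.
elim: k => [|k [IHc IHs]].
  by split => x; exact: differentiable_continuous.
by split; split => // v; rewrite ?Dcos ?Dsin; apply: class_CM => //; exact: class_C_cst.
Qed.

End test_functions.

(** * The integral of a derivative over the torus *)

Section line.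
Context (R : realType) (V : normedModType R).

Lemma growth_line (g : V -> R) x v (t : R) :
  (fun h : R => h^-1 *: (((fun r : R => g (x + r *: v)) \o shift t) (h *: (1 : R))
     - g (x + t *: v))) =
  (fun h : R => h^-1 *: ((g \o shift (x + t *: v)) (h *: v) - g (x + t *: v))).
Proof.
apply/funext => h /=; congr (_ *: (g _ - _)).
by rewrite scalerDl addrCA /GRing.scale/= mulr1.
Qed.

Lemma is_derive_line (g : V -> R) x v (t : R) : differentiable g (x + t *: v) ->
  is_derive t (1 : R) (fun r : R => g (x + r *: v)) ('D_v g (x + t *: v)).
Proof.
move=> dg; apply: DeriveDef; last by rewrite /derive growth_line.
by rewrite /derivable growth_line; exact: (diff_derivable (v := v) dg).
Qed.

End line.

Section parts.
Context (R : realType).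
Local Notation U := (uniform_prob (@ltr01 R)).

Lemma uniform_int_derive (F F' : R -> R) M :
  (forall t, is_derive t (1 : R) F (F' t)) -> continuous F' ->
  (forall t, `|F' t| <= M) -> F 0 = F 1 ->
  (\int[U]_t (F' t)%:E = 0)%E.
Proof.
move=> dF cF' F'M F01.
have mF' : measurable_fun setT F' by exact: continuous_measurable_fun.
have iF' : U.-integrable setT (EFin \o F').
  apply: measurable_bounded_integrable => //.
    by rewrite (le_lt_trans (probability_le1 _ _))// ltry.
  by exists M; split; [exact: num_real|move=> r Mr x _; exact: le_trans (ltW Mr)].
have iM : U.-integrable setT (EFin \o cst M).
  exact: finite_measure_integrable_cst.
(* The shift by M makes the integrand nonnegative, as the fundamental theorem
   of calculus requires under the uniform law. *)
pose G t := F t + M * t.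
have dG t : is_derive t (1 : R) G (F' t + M).
  rewrite /G; apply: is_derive_eq; by rewrite scaler1 addrC -[X in _ + X]addr0; congr (_ + _).
have : (\int[U]_t (F' t + M)%:E = M%:E)%E.
  rewrite integral_uniform; last 2 first.
  - by apply/measurable_EFinP; exact: measurable_funD.
  - by move=> t; rewrite lee_fin -lerBlDr sub0r; have := F'M t; rewrite ler_norml => /andP[].
  rewrite subr0 invr1 mul1e (continuous_FTC2 (F := G)) //.
  - by rewrite /G F01 mulr1 mulr0 addr0 -EFinB addrAC subrr add0r.
  - apply: continuous_subspaceT => t; apply: cvgD; [exact: cF'|exact: cvg_cst].
  - have cG t : {for t, continuous G}.
      by apply: differentiable_continuous; apply/derivable1_diffP; exact: ex_derive.
    split; first by move=> t _; exact: ex_derive.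
      by apply: cvg_at_right_filter; exact: cG.
    by apply: cvg_at_left_filter; exact: cG.
  - by move=> t _; rewrite derive1E derive_val.
under eq_integral do rewrite EFinD.
rewrite integralD//= integral_cst// [X in (M%:E * X)%E](@probability_setT _ _ R U) mule1.
case: (\int[U]_x _)%E => [r|//|//] /=.
by rewrite -EFinD => -[] /(congr1 (fun x => x - M)); rewrite addrK subrr => ->.
Qed.

Definition upd d (y : 'rV[R]_d) i t : 'rV[R]_d :=
  \row_j if j == i then t else y ord0 j.

Lemma upd_line d (y : 'rV[R]_d) i t : upd y i t = upd y i 0 + t *: delta_mx ord0 i.
Proof.
apply/rowP => j; rewrite !mxE eqxx/=.
by case: eqP => _; rewrite ?mulr1 ?mulr0 ?add0r ?addr0.
Qed.

(** Fubini, by induction on the dimension: the measure splits off the first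
    coordinate, and this either is the coordinate i itself or leaves the
    hypothesis true for the remaining ones. *)
Lemma torus_int_slice0 d (i : 'I_d) (g : 'rV[R]_d -> R) (M : R) :
  measurable_fun setT g -> (forall x, `|g x| <= M) ->
  (forall y, \int[U]_t (g (upd y i t))%:E = 0)%E ->
  (\int[torus_measure R d]_x (g x)%:E = 0)%E.
Proof.
elim: d i g => [[]//|d IH] i g mg gM g0.
have mgc : measurable_fun setT (g \o @rV_cons R d).
  by apply: measurableT_comp => //; exact: measurable_rV_cons.
have igc : (U \x torus_measure R d)%E.-integrable setT (EFin \o (g \o @rV_cons R d)).
  apply: measurable_bounded_integrable => //.
    by rewrite (le_lt_trans (probability_le1 _ _))// ltry.
  exists M; split; [exact: num_real|move=> r Mr x _ /=].
  by apply: le_trans (ltW Mr); exact: gM.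
transitivity (\int[(U \x torus_measure R d)%E]_z (g (rV_cons z))%:E)%E.
  by apply: integral_distribution => //; exact/measurable_EFinP.
case: (unliftP ord0 i) g0 => [j|] -> g0.
- rewrite -(integral12_prod_meas1 igc) /fubini_F integral0_eq// => t _.
  apply: (IH j (fun y => g (rV_cons (t, y)))) => //.
    exact: (measurableT_comp mgc (measurable_pair1 t)).
  move=> y; rewrite -[RHS](g0 (rV_cons (t, y))); apply: eq_integral => r _.
  congr (g _)%:E; apply/rowP => k; rewrite [RHS]mxE.
  case: (unliftP ord0 k) => [l|] ->.
    by rewrite !rV_consS mxE (inj_eq lift_inj).
  by rewrite !rV_cons0.
- rewrite -(integral21_prod_meas1 igc) /fubini_G integral0_eq// => y _.
  rewrite -[RHS](g0 (rV_cons (0, y))); apply: eq_integral => r _.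
  congr (g _)%:E; apply/rowP => k; rewrite [RHS]mxE.
  case: (unliftP ord0 k) => [l|] ->.
    by rewrite !rV_consS.
  by rewrite !rV_cons0 eqxx.
Qed.

(** Along each line in the direction i, the derivative integrates to a difference
    of two values of g that periodicity makes equal. *)
Lemma torus_int_derive d (i : 'I_d) (g : 'rV[R]_d -> R) :
  torus_periodic g -> (forall x, differentiable g x) ->
  continuous ('D_(delta_mx ord0 i) g) ->
  \int[torus_measure R d]_x 'D_(delta_mx ord0 i) g x = 0.
Proof.
move=> pg dg cg; set e := delta_mx ord0 i.
have [M M0 hM] := continuous_periodic_bounded (@periodic_derive _ _ _ e pg) cg.
rewrite /Rintegral (@torus_int_slice0 _ i _ M)//; first exact: measurable_continuous_rV.
move=> y; pose l t := upd y i 0 + t *: e.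
rewrite -[RHS](@uniform_int_derive (g \o l) (fun t => 'D_e g (l t)) M) => //.
- by apply: eq_integral => t _; rewrite upd_line.
- by move=> t; exact: (is_derive_line (dg (l t))).
- have cl : continuous l.
    by move=> t; rewrite /l; apply: cvgD; [exact: cvg_cst|exact: scalel_continuous].
  by move=> t; exact: (continuous_comp (cl t) (cg (l t))).
- by rewrite /= /l scale0r addr0 scale1r pg.
Qed.

End parts.

(** * Integrable functions on a probability space *)

Section integration.
Context d (T : measurableType d) (R : realType) (mu : probability T R).
Implicit Types f g h : T -> R.

Definition summable_fun f := mu.-integrable setT (EFin \o f).
Local Notation L1 := summable_fun.

Lemma L1_measurable f : L1 f -> measurable_fun setT f.
Proof. by move=> /measurable_int /measurable_EFinP. Qed.

Lemma L1_le f g : measurable_fun setT f -> L1 g -> (forall x, `|f x| <= g x) -> L1 f.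
Proof.
move=> mf ig fg; apply: (le_integrable _ _ _ ig) => //; first exact/measurable_EFinP.
by move=> x _ /=; rewrite lee_fin (le_trans (fg x))// ler_norm.
Qed.

Lemma L1_cst (c : R) : L1 (cst c).
Proof. exact: finite_measure_integrable_cst. Qed.

Lemma L1_bounded f (M : R) : measurable_fun setT f -> (forall x, `|f x| <= M) -> L1 f.
Proof. by move=> mf fM; apply: (L1_le (g := cst M)) => //; exact: L1_cst. Qed.

Lemma L1D f g : L1 f -> L1 g -> L1 (fun x => f x + g x).
Proof. exact: integrableD. Qed.

Lemma L1B f g : L1 f -> L1 g -> L1 (fun x => f x - g x).
Proof. exact: integrableB. Qed.

Lemma L1Z (c : R) f : L1 f -> L1 (fun x => c * f x).
Proof. exact: integrableZl. Qed.

Lemma L1_norm f : L1 f -> L1 (fun x => `|f x|).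
Proof. exact: integrable_norm. Qed.

Lemma L1M f g (M : R) : L1 f -> measurable_fun setT g -> (forall x, `|g x| <= M) ->
  L1 (fun x => f x * g x).
Proof.
move=> lf mg gM; apply: (L1_le (g := fun x => M * `|f x|)).
- by apply: measurable_funM => //; exact: L1_measurable.
- exact/L1Z/L1_norm.
- by move=> x; rewrite normrM mulrC ler_wpM2r.
Qed.

Lemma Rint_ae_eq f g : measurable_fun setT f -> measurable_fun setT g ->
  {ae mu, forall x, f x = g x} -> \int[mu]_x f x = \int[mu]_x g x.
Proof.
move=> mf mg fg; congr fine; apply: ae_eq_integral => //; try exact/measurable_EFinP.
by apply: filterS fg => x -> .
Qed.

(** The minimum of f and g equals f almost everywhere and is below g everywhere. *)
Lemma Rint_ae_le f g : L1 f -> L1 g -> {ae mu, forall x, f x <= g x} ->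
  \int[mu]_x f x <= \int[mu]_x g x.
Proof.
move=> lf lg fg; have mf := L1_measurable lf; have mg := L1_measurable lg.
rewrite (@Rint_ae_eq f (fun x => Num.min (f x) (g x)))//.
- apply: le_Rintegral => //; last by move=> x _; rewrite ge_min lexx orbT.
  apply: (L1_le (g := fun x => `|f x| + `|g x|)).
  + exact: measurable_minr.
  + by apply: L1D; exact: L1_norm.
  + move=> x; rewrite /Num.min; case: ifP => _; by rewrite ?lerDl ?lerDr.
- exact: measurable_minr.
- by apply: filterS fg => x fg; rewrite min_l.
Qed.

Lemma Rint_eq0_ae f : L1 f -> \int[mu]_x `|f x| = 0 -> {ae mu, forall x, f x = 0}.
Proof.
move=> lf f0; have mf := L1_measurable lf.
have : ae_eq mu setT (EFin \o f) (cst 0%E).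
  apply/(ae_eq_integral_abs mu measurableT); first exact/measurable_EFinP.
  have /fineK <- : (\int[mu]_x `|(f x)%:E|)%E \is a fin_num.
    by apply: integrable_fin_num => //; exact: L1_norm.
  by congr (_%:E).
by apply: filterS => x /(_ I) [].
Qed.

Lemma Rint_ge0_eq0_ae f : L1 f -> {ae mu, forall x, 0 <= f x} ->
  \int[mu]_x f x = 0 -> {ae mu, forall x, f x = 0}.
Proof.
move=> lf f0 h; apply: Rint_eq0_ae => //.
rewrite -h; apply: Rint_ae_eq; [exact/L1_measurable/L1_norm|exact: L1_measurable|].
by apply: filterS f0 => x f0; rewrite ger0_norm.
Qed.

Lemma Rint_dct (f_ : nat -> T -> R) f g : (forall n, measurable_fun setT (f_ n)) ->
  measurable_fun setT f -> L1 g -> (forall n x, `|f_ n x| <= g x) ->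
  {ae mu, forall x, f_ ^~ x @ \oo --> f x} ->
  (\int[mu]_x f_ n x) @[n --> \oo] --> \int[mu]_x f x.
Proof.
move=> mf_ mf lg fg cv.
have [h1 _ h2] := @dominated_convergence _ _ _ mu setT measurableT
  (fun n => EFin \o f_ n) (EFin \o f) (EFin \o g)
  (fun n => (measurable_EFinP _ _).2 (mf_ n)) ((measurable_EFinP _ _).2 mf)
  ltac:(apply: filterS cv => x cv _; apply: cvg_EFin => //; exact: nearW)
  lg ltac:(by apply: aeW => x n _; rewrite /= lee_fin).
by apply: fine_cvg; rewrite fineK //; exact: integrable_fin_num.
Qed.

Lemma Rint_cst1 (c : R) : \int[mu]_x c = c.
Proof. by rewrite Rintegral_cst// [X in fine X](@probability_setT _ _ _ mu) mulr1. Qed.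

Lemma norm_Rint f : L1 f -> `|\int[mu]_x f x| <= \int[mu]_x `|f x|.
Proof. by move=> lf; exact: le_normr_Rintegral. Qed.

End integration.

(** * Convolution with separable kernels *)

Section separable.
Context (R : realType) (d : nat).
Local Notation V := 'rV[R]_d.
Local Notation mu := (torus_measure R d).
Local Notation L1 := (summable_fun mu).
Implicit Types (v w g a b : V -> R) (k l : V -> V -> R).

Lemma test_measurable g : test_function g -> measurable_fun setT g.
Proof. by move=> /test_continuous; exact: measurable_continuous_rV. Qed.

Lemma test_bounded g : test_function g -> exists2 M, 0 <= M & forall x, `|g x| <= M.
Proof.
by move=> tg; apply: continuous_periodic_bounded (test_continuous tg); case: tg.
Qed.

Lemma test_L1 g : test_function g -> L1 g.
Proof.
move=> tg; have [M _ gM] := test_bounded tg.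
exact: L1_bounded (test_measurable tg) gM.
Qed.

Lemma L1_test v g : L1 v -> test_function g -> L1 (fun x => v x * g x).
Proof.
move=> lv tg; have [M _ gM] := test_bounded tg.
exact: L1M lv (test_measurable tg) gM.
Qed.

Lemma test_Z (c : R) g : test_function g -> test_function (fun x => c * g x).
Proof. by move=> tg; exact: (test_M (test_cst d c) tg). Qed.

(** Finite sums of products of test functions in x and in y. Convolution with such
    a kernel is a finite combination of test functions, so that its smoothness,
    its derivatives and the exchange of integrals follow by induction on the
    kernel, without differentiation under the integral sign. *)
Inductive separable : (V -> V -> R) -> Prop :=
| separable_mul a b : test_function a -> test_function b ->
    separable (fun x y => a x * b y)
| separable_add k l : separable k -> separable l ->
    separable (fun x y => k x y + l x y).

Lemma separable_flip k : separable k -> separable (fun x y => k y x).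
Proof.
elim=> [a b ta tb|{}k l _ sk _ sl]; last exact: separable_add.
rewrite (_ : (fun _ _ => _) = fun x y => b x * a y); first exact: separable_mul.
by apply/funext => x; apply/funext => y; rewrite mulrC.
Qed.

Lemma separableM k l : separable k -> separable l ->
  separable (fun x y => k x y * l x y).
Proof.
elim=> [a b ta tb|k1 k2 _ sk1 _ sk2] sl.
  elim: sl => [a' b' ta' tb'|l1 l2 _ sl1 _ sl2].
    rewrite (_ : (fun _ _ => _) = fun x y => (a \* a') x * (b \* b') y).
      by apply: separable_mul; exact: test_M.
    by apply/funext => x; apply/funext => y /=; ring.
  rewrite (_ : (fun _ _ => _) =
    fun x y => a x * b y * l1 x y + a x * b y * l2 x y); first exact: separable_add.
  by apply/funext => x; apply/funext => y /=; ring.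
rewrite (_ : (fun _ _ => _) = fun x y => k1 x y * l x y + k2 x y * l x y).
  by apply: separable_add; [exact: sk1|exact: sk2].
by apply/funext => x; apply/funext => y /=; ring.
Qed.

Lemma separable_testl k y : separable k -> test_function (k ^~ y).
Proof.
elim=> [a b ta tb|{}k l _ tk _ tl]; last exact: (test_D tk tl).
rewrite (_ : (fun _ => _) = fun x => b y * a x); first exact: test_Z.
by apply/funext => x; rewrite mulrC.
Qed.

Lemma separable_testr k x : separable k -> test_function (k x).
Proof. by move=> /separable_flip /(separable_testl x). Qed.

Definition conv k v x : R := \int[mu]_y (v y * k x y).

Lemma convD k l v x : separable k -> separable l -> L1 v ->
  conv (fun x y => k x y + l x y) v x = conv k v x + conv l v x.
Proof.
move=> sk sl lv.
rewrite /conv -(RintegralD measurableT (L1_test lv (separable_testr x sk))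
  (L1_test lv (separable_testr x sl))).
by apply: eq_Rintegral => y _; rewrite mulrDr.
Qed.

Lemma conv_mul a b v x : test_function b -> L1 v ->
  conv (fun x y => a x * b y) v x = (\int[mu]_y (v y * b y)) * a x.
Proof.
move=> tb lv; rewrite -(RintegralZr _ measurableT (L1_test lv tb)).
by apply: eq_Rintegral => y _; ring.
Qed.

Lemma conv_test k v : separable k -> L1 v -> test_function (conv k v).
Proof.
move=> sk lv; elim: sk => [a b ta tb|{}k l sk tk sl tl].
  rewrite (_ : conv _ v = fun x => (\int[mu]_y (v y * b y)) * a x).
    exact: test_Z.
  by apply/funext => x; exact: conv_mul.
rewrite (_ : conv _ v = conv k v \+ conv l v); first exact: test_D.
by apply/funext => x; exact: convD.
Qed.

Lemma convL k v w x (c : R) : separable k -> L1 v -> L1 w ->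
  conv k (fun y => c * v y + w y) x = c * conv k v x + conv k w x.
Proof.
move=> sk lv lw; have tk := separable_testr x sk.
rewrite /conv -(RintegralZl c measurableT (L1_test lv tk)).
rewrite -(RintegralD measurableT (L1Z c (L1_test lv tk)) (L1_test lw tk)).
by apply: eq_Rintegral => y _; ring.
Qed.

Lemma deriveZ_test (c : R) g e x : test_function g ->
  'D_e (fun x => c * g x) x = c * 'D_e g x.
Proof.
move=> tg; have dg := diff_derivable (v := e) (test_differentiable x tg).
exact: (deriveZ c dg).
Qed.

Lemma conv_derive k v e x : separable k -> L1 v ->
  'D_e (conv k v) x = \int[mu]_y (v y * 'D_e (k ^~ y) x).
Proof.
move=> sk lv.
(* The induction has to carry the integrability of the right-hand side along. *)
suff [] : 'D_e (conv k v) x = \int[mu]_y (v y * 'D_e (k ^~ y) x) /\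
  test_function (fun y => 'D_e (k ^~ y) x) by [].
elim: sk => [a b ta tb|{}k l sk [IHk tk] sl [IHl tl]].
  have D y : 'D_e (fun x => a x * b y) x = 'D_e a x * b y.
    rewrite (_ : (fun _ => _) = fun x => b y * a x); last first.
      by apply/funext => z; rewrite mulrC.
    by rewrite (deriveZ_test _ e x ta) mulrC.
  split; last first.
    rewrite (_ : (fun _ => _) = fun y => 'D_e a x * b y); first exact: test_Z.
    exact/funext.
  rewrite (_ : conv _ v = fun x => (\int[mu]_y (v y * b y)) * a x); last first.
    by apply/funext => z; exact: conv_mul.
  rewrite (deriveZ_test _ e x ta).
  have lvb : L1 (fun y => v y * b y) by exact: L1_test.
  rewrite -(RintegralZr _ measurableT lvb).
  apply: eq_Rintegral => y _; rewrite D.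
  ring.
have D y : 'D_e (fun x => k x y + l x y) x = 'D_e (k ^~ y) x + 'D_e (l ^~ y) x.
  rewrite -deriveD//.
  - by apply: diff_derivable; exact/test_differentiable/separable_testl.
  - by apply: diff_derivable; exact/test_differentiable/separable_testl.
split; last first.
  rewrite (_ : (fun _ => _) = (fun y => 'D_e (k ^~ y) x) \+ (fun y => 'D_e (l ^~ y) x)).
    exact: test_D.
  exact/funext.
rewrite (_ : conv _ v = conv k v \+ conv l v); last first.
  by apply/funext => z; exact: convD.
rewrite deriveD; last 2 first.
- by apply: diff_derivable; exact/test_differentiable/conv_test.
- by apply: diff_derivable; exact/test_differentiable/conv_test.
have lk := L1_test lv tk; have ll := L1_test lv tl.
rewrite IHk IHl -(RintegralD measurableT lk ll).
by apply: eq_Rintegral => y _; rewrite D mulrDr.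
Qed.

Lemma conv_fubini k v w : separable k -> L1 v -> L1 w ->
  \int[mu]_x (w x * conv k v x) =
  \int[mu]_y (v y * conv (fun y x => k x y) w y).
Proof.
move=> sk lv lw; elim: sk => [a b ta tb|{}k l sk IHk sl IHl].
  have lwa := L1_test lw ta; have lvb := L1_test lv tb.
  transitivity (\int[mu]_x (w x * a x) * \int[mu]_y (v y * b y)).
    rewrite -(RintegralZr _ measurableT lwa); apply: eq_Rintegral => x _.
    rewrite /conv -[RHS]mulrA -(RintegralZl _ measurableT lvb); congr (_ * _).
    by apply: eq_Rintegral => y _; ring.
  rewrite mulrC -(RintegralZr _ measurableT lvb); apply: eq_Rintegral => x _.
  rewrite /conv -[LHS]mulrA -(RintegralZl _ measurableT lwa); congr (_ * _).
  by apply: eq_Rintegral => y _; ring.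
have fk := separable_flip sk; have fl := separable_flip sl.
transitivity (\int[mu]_x (w x * conv k v x) + \int[mu]_x (w x * conv l v x)).
  rewrite -(RintegralD measurableT (L1_test lw (conv_test sk lv))
    (L1_test lw (conv_test sl lv))).
  by apply: eq_Rintegral => x _; rewrite (convD _ sk sl lv) mulrDr.
rewrite IHk IHl -(RintegralD measurableT (L1_test lv (conv_test fk lw))
  (L1_test lv (conv_test fl lw))).
by apply: eq_Rintegral => y _; rewrite (convD _ fk fl lw) mulrDr.
Qed.

Lemma derive_sum_coord g e x : differentiable g x ->
  'D_e g x = \sum_i e ord0 i * 'D_(delta_mx ord0 i) g x.
Proof.
move=> dg; rewrite deriveE// {1}(row_sum_delta e) linear_sum; apply: eq_bigr => i _.
by rewrite linearZ/= deriveE.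
Qed.

Lemma derive0_cst g : (forall x, differentiable g x) ->
  (forall i x, 'D_(delta_mx ord0 i) g x = 0) -> forall x y, g x = g y.
Proof.
move=> dg Dg x y; pose f (t : R) := g (x + t *: (y - x)).
have df t : is_derive t (1 : R) f 0.
  have := is_derive_line (v := y - x) (dg (x + t *: (y - x))).
  by rewrite derive_sum_coord// big1// => i _; rewrite Dg mulr0.
have := is_derive_0_is_cst 0 1 df.
by rewrite /f scale0r addr0 scale1r addrC subrK.
Qed.

End separable.

Section difference_kernel.
Context (R : realType) (d : nat).
Local Notation V := 'rV[R]_d.
Local Notation mu := (torus_measure R d).
Local Notation L1 := (summable_fun mu).
Variable kap : V -> R.
Hypothesis skap : separable (fun x y => kap (x - y)).
Local Notation K := (fun x y => kap (x - y)).

Lemma test_kernel : test_function kap.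
Proof.
rewrite (_ : kap = fun x => kap (x - 0)); first exact: (separable_testl 0 skap).
by apply/funext => x; rewrite subr0.
Qed.

Lemma derive_kernell e x y : 'D_e (K ^~ y) x = 'D_e kap (x - y).
Proof.
rewrite /derive (_ : (fun h => _) =
  fun h => h^-1 *: ((kap \o shift (x - y)) (h *: e) - kap (x - y)))//.
by apply/funext => h /=; rewrite addrA.
Qed.

Lemma derive_kernelr e x y : 'D_e (K x) y = - 'D_e kap (x - y).
Proof.
transitivity ('D_(- e) kap (x - y)).
  rewrite /derive (_ : (fun h => _) =
    fun h => h^-1 *: ((kap \o shift (x - y)) (h *: - e) - kap (x - y)))//.
  apply/funext => h /=; congr (_ *: (kap _ - _)).
  by rewrite scalerN opprD addrCA.
have dk := test_differentiable (x - y) test_kernel.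
by rewrite !deriveE// linearN.
Qed.

(** The kernel depends on the difference x - y only, so its derivative in x is the
    opposite of its derivative in y. *)
Lemma conv_kernel_derive e v x : L1 v ->
  'D_e (conv K v) x = - \int[mu]_y (v y * 'D_e (K x) y).
Proof.
move=> lv; rewrite (conv_derive _ _ skap lv).
have tk : test_function ('D_e (K x)) by apply: test_derive; exact: (separable_testr x skap).
transitivity (\int[mu]_y (-1 * (v y * 'D_e (K x) y))).
  by apply: eq_Rintegral => y _; rewrite derive_kernelr derive_kernell; ring.
by rewrite (RintegralZl _ measurableT (L1_test lv tk)) mulN1r.
Qed.

(** For fixed x the kernel is a test function of y, against which the definition
    of the weak derivative of v can be read. *)
Lemma conv_weak_partial i v w x : L1 v -> is_weak_partial i v w ->
  'D_(delta_mx ord0 i) (conv K v) x = conv K w x.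
Proof.
move=> lv [_ /(_ _ (separable_testr x skap))]; rewrite /conv => h.
rewrite (conv_kernel_derive _ _ lv) -[RHS]opprK -h; congr (- _).
by apply: eq_Rintegral => y _; rewrite gradE.
Qed.

Hypothesis kapN : forall x, kap (- x) = kap x.

(** As a function of x, the left-hand side is the convolution of the constant 1;
    its gradient is the integral of a derivative over the torus, hence 0. *)
Lemma int_kernelr x : \int[mu]_y K x y = \int[mu]_y kap y.
Proof.
have l1 : L1 (cst 1) by exact: L1_cst.
have E z : conv K (cst 1) z = \int[mu]_y K z y.
  by apply: eq_Rintegral => y _; rewrite mul1r.
transitivity (conv K (cst 1) x) => //.
transitivity (conv K (cst 1) 0); last first.
  by rewrite E; apply: eq_Rintegral => y _; rewrite sub0r kapN.
apply: derive0_cst => [t|i t].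
  exact: (test_differentiable t (conv_test skap l1)).
rewrite (conv_kernel_derive _ _ l1) -[RHS]oppr0; congr (- _).
have tk := separable_testr t skap.
rewrite -[RHS](torus_int_derive (i := i) tk.1 (fun y => test_differentiable y tk)
  (test_continuous (test_derive (delta_mx ord0 i) tk))).
by apply: eq_Rintegral => y _; rewrite mul1r.
Qed.

Lemma conv_kernel_sym v w : L1 v -> L1 w ->
  \int[mu]_x (w x * conv K v x) = \int[mu]_y (v y * conv K w y).
Proof.
move=> lv lw; rewrite (conv_fubini skap lv lw); apply: eq_Rintegral => y _.
congr (_ * _); apply: eq_Rintegral => x _; congr (_ * _).
by rewrite -kapN opprB.
Qed.

End difference_kernel.

(** * A trigonometric approximate identity *)

Section kernel.
Context (R : realType) (d : nat).
Local Notation V := 'rV[R]_d.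
Local Notation mu := (torus_measure R d).
Local Notation L1 := (summable_fun mu).
Implicit Types (x y : V).

Definition bump1 (t : R) : R := (1 + cos (2 * pi * t)) / 2.

(** A nonnegative trigonometric polynomial that attains its maximum 1 on the
    integer lattice only, so that its normalised powers concentrate there. By the
    addition formula for the cosine, bump (x - y) is separable. *)
Definition bump x : R := \prod_(i < d) bump1 (x ord0 i).

Lemma bump1_ge0 t : 0 <= bump1 t.
Proof. by rewrite /bump1 divr_ge0// -lerBlDl sub0r cos_geN1. Qed.

Lemma bump1_le1 t : bump1 t <= 1.
Proof. by rewrite /bump1 ler_pdivrMr// mul1r; have := cos_le1 (2 * pi * t); lra. Qed.

Lemma bump_ge0 x : 0 <= bump x.
Proof. by apply: prodr_ge0 => i _; exact: bump1_ge0. Qed.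

Lemma bumpN x : bump (- x) = bump x.
Proof. by apply: eq_bigr => i _; rewrite /bump1 mxE mulrN cosN. Qed.

Lemma bump0 : bump 0 = 1.
Proof. by rewrite /bump big1// => i _; rewrite /bump1 mxE mulr0 cos0; lra. Qed.

Lemma separable_cst (c : R) : separable (fun _ _ : V => c).
Proof.
rewrite (_ : (fun _ _ => _) = fun x y => cst c x * cst 1 y).
  by apply: separable_mul; exact: test_cst.
by apply/funext => x; apply/funext => y; rewrite mulr1.
Qed.

Lemma separable_bump : separable (fun x y => bump (x - y)).
Proof.
rewrite /bump; elim: (index_enum _) => [|i r IH].
  under eq_fun do under eq_fun do rewrite big_nil.
  exact: separable_cst.
under eq_fun do under eq_fun do rewrite big_cons.
apply: separableM => //.
have [tc ts] := test_trig R i.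
pose C (x : V) := cos (2 * pi * x ord0 i); pose S (x : V) := sin (2 * pi * x ord0 i).
rewrite (_ : (fun _ _ => _) =
  fun x y => 2^-1 + (2^-1 * C x * C y + 2^-1 * S x * S y)).
  apply: separable_add; first exact: separable_cst.
  by apply: separable_add; apply: separable_mul => //; exact: test_Z.
apply/funext => x; apply/funext => y; rewrite /bump1 !mxE mulrBr cosB -/(C x) -/(C y).
by rewrite -/(S x) -/(S y); ring.
Qed.

Lemma separable_bumpX n : separable (fun x y => bump (x - y) ^+ n).
Proof.
elim: n => [|n IH].
  by under eq_fun do under eq_fun do rewrite expr0; exact: separable_cst.
by under eq_fun do under eq_fun do rewrite exprS; exact: separableM separable_bump IH.
Qed.

Lemma test_bumpX n : test_function (fun x => bump x ^+ n).
Proof.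
exact: (@test_kernel _ _ (fun x => bump x ^+ n) (separable_bumpX n)).
Qed.

Definition bump_mass n : R := \int[mu]_x (bump x ^+ n).

Definition mollifier n x : R := bump x ^+ n / bump_mass n.

Lemma bump1_far (t del : R) : 0 < del -> del <= `|t| <= 1 - del -> bump1 t <= bump1 del.
Proof.
move=> d0 /andP[dt td].
have -> : bump1 t = bump1 `|t|.
  by rewrite /bump1; case: (ler0P t) => // _; rewrite mulrN cosN.
move: `|t| dt td => {}t dt td.
have pi0 := pi_gt0 R.
have mono (a b : R) : 0 <= a -> a <= b -> b <= 2^-1 -> bump1 b <= bump1 a.
  move=> a0 ab b2; rewrite /bump1 ler_pM2r// lerD2l.
  have h (c : R) : 0 <= c -> c <= 2^-1 -> 2 * pi * c \in `[0, pi].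
    move=> c0 c2; rewrite in_itv/=; apply/andP; split.
      by rewrite !mulr_ge0// ltW.
    rewrite [leRHS](_ : pi = 2 * pi * 2^-1 :> R); last by field.
    by rewrite ler_wpM2l// mulr_ge0// ltW.
  rewrite leNgt ltr_cos; last 2 first.
  - by apply: h => //; exact: le_trans ab.
  - by apply: h => //; exact: le_trans b2.
  by rewrite -leNgt ler_wpM2l// mulr_ge0// ltW.
have [t2|t2] := leP t 2^-1; first by apply: mono => //; exact: ltW.
have -> : bump1 t = bump1 (1 - t).
  rewrite /bump1 mulrBr mulr1 cosB.
  have -> : 2 * pi = pi *+ 2 :> R by rewrite mulr_natl.
  by rewrite cos2pi sin2pi mul0r addr0 mul1r.
by apply: mono; lra.
Qed.

Lemma bump_far x i (del : R) : 0 < del -> del <= `|x ord0 i| <= 1 - del ->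
  bump x <= bump1 del.
Proof.
move=> d0 h; rewrite /bump (bigD1 i)//= -[leRHS]mulr1.
apply: ler_pM => //; first exact: bump1_ge0.
- by apply: prodr_ge0 => j _; exact: bump1_ge0.
- exact: bump1_far.
- by apply: prodr_ile1 => j _; rewrite bump1_ge0 bump1_le1.
Qed.

Lemma bump1_lt1 (del : R) : 0 < del -> del <= 2^-1 -> bump1 del < 1.
Proof.
move=> d0 d2; rewrite /bump1 ltr_pdivrMr// mul1r.
have pi0 := pi_gt0 R.
have h0 : 0 \in `[0, pi : R] by rewrite in_itv/= lexx ltW.
have h1 : 2 * pi * del \in `[0, pi].
  rewrite in_itv/=; apply/andP; split; first by rewrite !mulr_ge0// ltW.
  rewrite [leRHS](_ : pi = 2 * pi * 2^-1 :> R); last by field.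
  by rewrite ler_wpM2l// mulr_ge0// ltW.
have := ltr_cos h0 h1; rewrite cos0 mulr_gt0 ?mulr_gt0// => h.
by rewrite [ltRHS](_ : 2 = 1 + 1)// ltrD2l h.
Qed.

Definition box (a b : 'I_d -> R) : set V := [set x | forall i, a i <= x ord0 i <= b i].

Lemma measurable_box a b : measurable (box a b).
Proof.
rewrite (_ : box a b = \bigcap_(i in [set: 'I_d])
  ((fun x : V => x ord0 i) @^-1` `[a i, b i])).
  apply: fin_bigcap_measurable => // i _.
  by rewrite -[X in measurable X]setTI; exact: measurable_coord.
by apply/seteqP; split=> x h i => [_|]; have := h i; rewrite /= in_itv//=; exact.
Qed.

(** The bump exceeds rho on a small cube at the origin, whose volume is c. *)
Lemma bump_mass_lb (rho : R) : 0 <= rho -> rho < 1 ->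
  exists2 c : R, 0 < c & forall n, c * rho ^+ n <= bump_mass n.
Proof.
move=> r0 r1.
have cb : continuous bump.
  by have := test_continuous (test_bumpX 1); under eq_fun do rewrite expr1.
have : \forall x \near (0 : V), rho < bump x.
  by have := cb 0; rewrite /continuous_at bump0 => /cvgr_gt; exact.
move=> /nbhs_ballP[e /= e0 he].
pose eta := Num.min (e / 2) 1.
have eta0 : 0 < eta by rewrite lt_min ltr01 divr_gt0.
have eta1 : eta <= 1 by rewrite ge_min lexx orbT.
pose B := box (fun=> 0) (fun=> eta).
have mB : measurable B by exact: measurable_box.
have muB : mu B = (eta ^+ d)%:E.
  rewrite /B torus_measure_box//; last by move=> _; exact: ltW.
  by rewrite subr0 prodr_const card_ord.
have lb x : B x -> rho < bump x.
  move=> Bx; apply: he; split => // j i; rewrite [j]ord1 -ball_normE /= mxE sub0r normrN.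
  have /andP[x0 xe] := Bx i; rewrite ger0_norm// (le_lt_trans xe)//.
  by rewrite gt_min ltr_pdivrMr// mulr_natr mulr2n ltrDl e0.
exists (eta ^+ d) => [|n]; first exact: exprn_gt0.
have iB : L1 (\1_B).
  by apply: (@L1_bounded _ _ _ _ _ 1) => // x; rewrite indicE; case: (_ \in _);
    rewrite ?normr1 ?normr0.
have -> : eta ^+ d * rho ^+ n = \int[mu]_x (rho ^+ n * \1_B x).
  rewrite RintegralZl// mulrC; congr (_ * _).
  by rewrite /Rintegral integral_indic//= setIT muB.
apply: le_Rintegral => //.
- exact: L1Z.
- exact/test_L1/test_bumpX.
move=> x _; rewrite indicE; have [Bx|Bx] := boolP (x \in B).
  by rewrite mulr1; apply: lerXn2r; rewrite ?nnegrE ?bump_ge0// ltW// lb// -inE.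
by rewrite mulr0 exprn_ge0// bump_ge0.
Qed.

Lemma bump_mass_gt0 n : 0 < bump_mass n.
Proof.
have [||c c0 /(_ n)] := @bump_mass_lb 2^-1; [by lra|by lra|].
by apply: lt_le_trans; rewrite mulr_gt0// exprn_gt0.
Qed.

Lemma mollifier_ge0 n x : 0 <= mollifier n x.
Proof. by rewrite divr_ge0 ?exprn_ge0 ?bump_ge0// ltW// bump_mass_gt0. Qed.

Lemma mollifierN n x : mollifier n (- x) = mollifier n x.
Proof. by rewrite /mollifier bumpN. Qed.

Lemma separable_mollifier n : separable (fun x y => mollifier n (x - y)).
Proof.
by apply: separableM; [exact: separable_bumpX|exact: separable_cst].
Qed.

Lemma int_mollifier n : \int[mu]_x mollifier n x = 1.
Proof.
rewrite /mollifier RintegralZr//; last exact/test_L1/test_bumpX.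
by rewrite mulfV// gt_eqF// bump_mass_gt0.
Qed.

(** Away from the lattice the bump is at most some rho < 1, while its powers keep
    a mass of order rho' ^ n, with rho' chosen between rho and 1. *)
Lemma mollifier_far (del : R) : 0 < del -> del <= 2^-1 ->
  exists2 tau : nat -> R, tau @ \oo --> (0 : R) &
    forall n x i, del <= `|x ord0 i| <= 1 - del -> mollifier n x <= tau n.
Proof.
move=> d0 d2; set rho := bump1 del.
have r0 : 0 <= rho by exact: bump1_ge0.
have r1 : rho < 1 by exact: bump1_lt1.
pose rho' := (1 + rho) / 2.
have r'0 : 0 < rho' by rewrite /rho'; lra.
have rr' : rho < rho' by rewrite /rho'; lra.
have [||c c0 hc] := @bump_mass_lb rho'; [exact: ltW|by rewrite /rho'; lra|].
exists (fun n => c^-1 * (rho / rho') ^+ n).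
  rewrite -[X in _ --> X](mulr0 c^-1); apply: cvgMl_tmp.
  have q0 : 0 <= rho / rho' by rewrite divr_ge0// ltW.
  by apply: cvg_expr; rewrite ger0_norm// ltr_pdivrMr// mul1r.
move=> n x i h; rewrite /mollifier ler_pdivrMr ?bump_mass_gt0//.
apply: (@le_trans _ _ (rho ^+ n)).
  by apply: lerXn2r; rewrite ?nnegrE ?bump_ge0//; exact: bump_far h.
rewrite (_ : rho ^+ n = c^-1 * (rho / rho') ^+ n * (c * rho' ^+ n)).
  apply: ler_wpM2l (hc n); apply: mulr_ge0; first by rewrite invr_ge0 ltW.
  by apply: exprn_ge0; apply: divr_ge0 => //; exact: ltW.
have rn0 : rho' ^+ n != 0 by rewrite expf_neq0// gt_eqF.
have c_neq0 : c != 0 by rewrite gt_eqF.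
rewrite [(rho / rho') ^+ n]expr_div_n; move: (rho ^+ n) (rho' ^+ n) rn0 => A B B0.
by field; rewrite B0.
Qed.

End kernel.

(** * Mollification *)

Section mollify.
Context (R : realType) (d : nat).
Local Notation V := 'rV[R]_d.
Local Notation mu := (torus_measure R d).
Local Notation L1 := (summable_fun mu).
Implicit Types (x y : V) (v w : V -> R) (n : nat).

(** Mollification by an approximate identity that is symmetric, separable and of
    integral 1. *)
Definition mollify n v : V -> R := conv (fun x y => mollifier n (x - y)) v.

Lemma mollify_test n v : L1 v -> test_function (mollify n v).
Proof. by move=> lv; apply: conv_test => //; exact: separable_mollifier. Qed.

Lemma mollify_L1 n v : L1 v -> L1 (mollify n v).
Proof. by move=> lv; apply: test_L1; exact: mollify_test. Qed.

Lemma mollify_kernel_L1 n v x : L1 v -> L1 (fun y => v y * mollifier n (x - y)).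
Proof.
by move=> lv; apply: L1_test => //; exact: (separable_testr x (separable_mollifier R d n)).
Qed.

Lemma mollifyL n v w x (c : R) : L1 v -> L1 w ->
  mollify n (fun y => c * v y + w y) x = c * mollify n v x + mollify n w x.
Proof. by move=> lv lw; exact: (convL x c (separable_mollifier R d n) lv lw). Qed.

Lemma mollifyB n v w x : L1 v -> L1 w ->
  mollify n (fun y => v y - w y) x = mollify n v x - mollify n w x.
Proof.
move=> lv lw; rewrite -mulN1r addrC -(mollifyL n x (-1) lw lv).
by congr mollify; apply/funext => y; rewrite mulN1r addrC.
Qed.

Lemma mollify_sym n v w : L1 v -> L1 w ->
  \int[mu]_x (w x * mollify n v x) = \int[mu]_y (v y * mollify n w y).
Proof.
exact: (conv_kernel_sym (separable_mollifier R d n) (@mollifierN R d n)).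
Qed.

Lemma mollify_cst1 n x : mollify n (cst 1) x = 1.
Proof.
rewrite -[RHS](@int_mollifier R d n).
rewrite -(int_kernelr (separable_mollifier R d n) (@mollifierN R d n) x).
by apply: eq_Rintegral => y _; rewrite mul1r.
Qed.

Lemma int_mollify n v : L1 v -> \int[mu]_x mollify n v x = \int[mu]_x v x.
Proof.
move=> lv; have l1 : L1 (cst 1) by exact: L1_cst.
have := mollify_sym n lv l1.
under eq_Rintegral do rewrite mul1r; move=> ->.
by apply: eq_Rintegral => y _; rewrite mollify_cst1 mulr1.
Qed.

Lemma mollify_le n v w x : L1 v -> L1 w -> (forall y, v y <= w y) ->
  mollify n v x <= mollify n w x.
Proof.
move=> lv lw vw; apply: (le_Rintegral measurableT).
- exact: mollify_kernel_L1.
- exact: mollify_kernel_L1.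
- by move=> y _; apply: ler_wpM2r => //; exact: mollifier_ge0.
Qed.

Lemma mollify_norm n v x : L1 v -> `|mollify n v x| <= mollify n (fun y => `|v y|) x.
Proof.
move=> lv; apply: le_trans (norm_Rint (mollify_kernel_L1 n x lv)) _.
rewrite le_eqVlt; apply/orP; left; apply/eqP; apply: eq_Rintegral => y _.
by rewrite normrM [`|mollifier _ _|]ger0_norm// mollifier_ge0.
Qed.

Lemma mollify_contraction n v : L1 v ->
  \int[mu]_x `|mollify n v x| <= \int[mu]_x `|v x|.
Proof.
move=> lv; rewrite -(int_mollify n (L1_norm lv)).
apply: (le_Rintegral measurableT) => [||x _].
- exact/L1_norm/mollify_L1.
- exact/mollify_L1/L1_norm.
- exact: mollify_norm.
Qed.

Lemma mollify_weak_partial n i v w x : L1 v -> is_weak_partial i v w ->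
  'D_(delta_mx ord0 i) (mollify n v) x = mollify n w x.
Proof. exact: (conv_weak_partial (separable_mollifier R d n)). Qed.

(** The measure lives on the closed unit cube, whose faces have volume 0. *)
Lemma ae_in_cube : {ae mu, forall x, forall i, 0 < x ord0 i < 1}.
Proof.
have c1 : {ae mu, forall x, forall i, 0 <= x ord0 i <= 1}.
  exists (~` (box (fun=> 0) (fun=> 1))); split => //.
  - by apply: measurableC; exact: measurable_box.
  - rewrite probability_setC; last exact: measurable_box.
    rewrite [X in (_ - X)%E]torus_measure_box// big1 ?subee// => i _.
    by rewrite subr0.
have face (c : R) i : 0 <= c <= 1 ->
    {ae mu, forall x, (forall j, 0 <= x ord0 j <= 1) -> x ord0 i != c}.
  move=> /andP[c0 c1'].
  exists (box (fun j => if j == i then c else 0) (fun j => if j == i then c else 1)).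
  split; first exact: measurable_box.
    rewrite [LHS]torus_measure_box//; try by move=> j; case: ifP.
    by rewrite (bigD1 i)//= eqxx subrr mul0r.
  move=> x /= h; have {h}[h1 /negP/negPn/eqP h2] : (forall j, 0 <= x ord0 j <= 1) /\ ~ (x ord0 i != c).
    by apply: contrapT => h3; apply: h => h4; apply: contrapT => h5; apply: h3.
  by move=> j; case: eqP => [->|_]; [rewrite h2 lexx|exact: h1].
have f0 : {ae mu, forall x, forall i, (forall j, 0 <= x ord0 j <= 1) -> x ord0 i != 0}.
  by apply: filter_forall => i; apply: face; rewrite lexx ler01.
have f1 : {ae mu, forall x, forall i, (forall j, 0 <= x ord0 j <= 1) -> x ord0 i != 1}.
  by apply: filter_forall => i; apply: face; rewrite lexx ler01.
apply: filterS3 c1 f0 f1 => x h h0 h1 i; have /andP[a b] := h i.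
by rewrite !lt_neqAle a b eq_sym h0 // h1.
Qed.

Lemma measurable_open (O : set V) : open O -> measurable O.
Proof.
move=> oO; have oO2 : open (O `*` [set: 'rV[R]_0]).
  rewrite openE => -[x z] [/= Ox _]; exists (O, setT) => //=; split => //.
    by move/open_nbhs_nbhs : (conj oO Ox).
  exact: filterT.
have mp : measurable_fun setT (fun x : V => (x, 0 : 'rV[R]_0)).
  exact: measurable_fun_pair.
have := mp measurableT _ (measurable_open_prod oO2); rewrite setTI.
by congr measurable; apply/seteqP; split => x /=; [case|].
Qed.

Lemma L1_indic (A : set V) : measurable A -> L1 \1_A.
Proof.
move=> mA; apply: (@L1_bounded _ _ _ _ _ 1) => // x.
by rewrite indicE; case: (_ \in _); rewrite ?normr1 ?normr0.
Qed.

(** Seen from a point at distance del, modulo the lattice, from the set where v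
    lives, the kernel is uniformly small. *)
Lemma mollify_far_mass (A : set V) (B : set V) (del : R) : measurable A ->
  0 < del -> del <= 2^-1 ->
  (forall x y, B x -> A y -> (forall i, 0 < y ord0 i < 1) ->
    exists i, del <= `|x ord0 i - y ord0 i| <= 1 - del) ->
  exists2 tau : nat -> R, tau @ \oo --> (0 : R) &
    forall n x v, B x -> L1 v -> (forall y, 0 <= v y) -> (forall y, ~ A y -> v y = 0) ->
      mollify n v x <= tau n * \int[mu]_y v y.
Proof.
move=> mA d0 d2 far; have [tau tau0 htau] := @mollifier_far R d del d0 d2.
exists tau => // n x v Bx lv v0 vA.
rewrite mulrC -RintegralZr//; apply: Rint_ae_le.
- exact: mollify_kernel_L1.
- by under eq_fun do rewrite mulrC; exact: L1Z.
apply: filterS ae_in_cube => y yc.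
have [Ay|/vA ->] := pselect (A y); last by rewrite !mul0r.
apply: ler_wpM2l => //; have [i hi] := far x y Bx Ay yc.
by apply: (htau n _ i); rewrite !mxE.
Qed.

(** Distances count modulo the lattice: the margin del around x separates y from
    the translates of x as well. *)
Lemma far_point x y (del : R) : 0 < del ->
  (forall i, del <= x ord0 i <= 1 - del) -> (forall i, 0 < y ord0 i < 1) ->
  ~ ball x del y -> exists i, del <= `|x ord0 i - y ord0 i| <= 1 - del.
Proof.
move=> d0 hx hy nb.
have [i hi] : exists i, del <= `|x ord0 i - y ord0 i|.
  apply: contrapT => h; apply: nb; split => // j i; rewrite [j]ord1 -ball_normE /=.
  by rewrite ltNge; apply/negP => h'; apply: h; exists i.
exists i; rewrite hi/= ler_norml; have /andP[a b] := hx i; have /andP[e g] := hy i.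
by apply/andP; split; lra.
Qed.

Lemma mollify_ge0 n v x : (forall y, 0 <= v y) -> 0 <= mollify n v x.
Proof.
by move=> v0; apply: Rintegral_ge0 => y _; rewrite mulr_ge0// mollifier_ge0.
Qed.

Lemma indic_ge0 (A : set V) x : 0 <= \1_A x :> R.
Proof. by rewrite indicE. Qed.

Lemma indic_le1 (A : set V) x : \1_A x <= 1 :> R.
Proof. by rewrite indicE; case: (_ \in _). Qed.

Lemma int_indic_le1 (A : set V) : measurable A -> \int[mu]_x \1_A x <= 1.
Proof.
move=> mA; rewrite -[leRHS](Rint_cst1 mu); apply: (le_Rintegral measurableT).
- exact: L1_indic.
- exact: L1_cst.
- by move=> x _; exact: indic_le1.
Qed.

Definition approximable v :=
  L1 v /\ (\int[mu]_x `|mollify n v x - v x|) @[n --> \oo] --> (0 : R).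

Lemma mollify_err_L1 n v : L1 v -> L1 (fun x => `|mollify n v x - v x|).
Proof. by move=> lv; apply: L1_norm; apply: L1B => //; exact: mollify_L1. Qed.

(** The complement of O is far from x, so that mollifying its indicator contributes
    at most a tail. *)
Lemma mollify_open (O : set V) x : open O -> O x -> (forall i, 0 < x ord0 i < 1) ->
  mollify n \1_O x @[n --> \oo] --> (1 : R).
Proof.
move=> oO Ox xc; have mO := measurable_open oO.
have lO := L1_indic mO; have lC := L1_indic (measurableC mO).
have /nbhs_ballP[e /= e0 he] := open_nbhs_nbhs (conj oO Ox).
have [del [d0 d2 de hd]] : exists del : R, [/\ 0 < del, del <= 2^-1, del <= e &
    forall i, del <= x ord0 i <= 1 - del].
  have h1 : \forall del \near (0 : R)^'+, forall i, del <= x ord0 i <= 1 - del.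
    apply: filter_forall => i; have /andP[x0 x1] := xc i.
    have x1' : 0 < 1 - x ord0 i by rewrite subr_gt0.
    apply: filterS2 (nbhs_right_le x0) (nbhs_right_le x1') => del a b.
    by rewrite a lerBrDl -lerBrDr.
  have h2 : (0 : R) < 2^-1 by rewrite invr_gt0.
  have : \forall del \near (0 : R)^'+, [/\ 0 < del, del <= 2^-1, del <= e &
      forall i, del <= x ord0 i <= 1 - del].
    near=> del; split => //.
    - by near: del; exact: nbhs_right_le.
    - by near: del; exact: nbhs_right_le.
    - by near: del.
  by move=> /filter_ex.
have far z y : [set x] z -> (~` O) y -> (forall i, 0 < y ord0 i < 1) ->
    exists i, del <= `|z ord0 i - y ord0 i| <= 1 - del.
  move=> -> Oy yc; apply: far_point => // xy; apply: Oy; apply: he.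
  exact: le_ball xy.
have [tau tau0 htau] := mollify_far_mass (measurableC mO) d0 d2 far.
have E n : mollify n \1_O x = 1 - mollify n \1_(~` O) x.
  rewrite -(mollify_cst1 n x) -mollifyB//; last exact: L1_cst.
  congr mollify; apply/funext => y; rewrite !indicE in_setC.
  by case: (y \in O); rewrite ?subr0 ?subrr.
suff : (fun n => 1 - mollify n \1_(~` O) x) @ \oo --> (1 - 0 : R).
  by rewrite subr0 (_ : (fun n => 1 - _) = fun n => mollify n \1_O x)//; apply/funext.
apply: cvgB; first exact: cvg_cst.
apply: (@squeeze_cvgr _ _ _ _ (fun=> 0) (fun n => `|tau n|)).
- apply: nearW => n; rewrite mollify_ge0/=; last by move=> y; exact: indic_ge0.
  apply: le_trans (htau n x _ erefl lC _ _) _.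
  + by move=> y; exact: indic_ge0.
  + by move=> y h; rewrite indicE memNset.
  rewrite -[leRHS]mulr1; apply: le_trans (_ : `|tau n| * \int[mu]_x \1_(~` O) x <= _).
    apply: ler_wpM2r; last exact: ler_norm.
    by apply: Rintegral_ge0 => y _; exact: indic_ge0.
  by apply: ler_wpM2l => //; apply: int_indic_le1; exact: measurableC.
- exact: cvg_cst.
- by rewrite -(normr0 R); exact: cvg_norm.
Unshelve. all: by end_near. Qed.

(** The mollification T of the indicator has values in [0, 1] and keeps the
    integral, so that the error in L^1 is twice the integral of 1 - T over O; there
    T tends to 1 pointwise. *)
Lemma approximable_open (O : set V) : open O -> approximable \1_O.
Proof.
move=> oO; have mO := measurable_open oO; have lO := L1_indic mO.
split => //.
have lT n : L1 (fun x => \1_O x * mollify n \1_O x).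
  by apply: L1_test => //; exact: mollify_test.
have T01 n x : 0 <= mollify n \1_O x <= 1.
  rewrite mollify_ge0/=; last by move=> y; exact: indic_ge0.
  rewrite -[leRHS](mollify_cst1 n x); apply: mollify_le => //; first exact: L1_cst.
  by move=> y; exact: indic_le1.
have E n : \int[mu]_x `|mollify n \1_O x - \1_O x| =
    2 * (\int[mu]_x \1_O x - \int[mu]_x (\1_O x * mollify n \1_O x)).
  transitivity (\int[mu]_x (\1_O x + mollify n \1_O x
      - 2 * (\1_O x * mollify n \1_O x))).
    apply: eq_Rintegral => x _; have /andP[a b] := T01 n x.
    have [Ox|Ox] := boolP (x \in O); rewrite !indicE ?Ox ?(negbTE Ox) /=.
      by rewrite ler0_norm ?subr_le0//; ring.
    by rewrite subr0 ger0_norm//; ring.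
  rewrite (RintegralB measurableT (L1D lO (mollify_L1 n lO)) (L1Z 2 (lT n))).
  rewrite (RintegralD measurableT lO (mollify_L1 n lO)) int_mollify//.
  by rewrite (RintegralZl 2 measurableT (lT n)); ring.
rewrite (_ : (fun n => _) = fun n => 2 * (\int[mu]_x \1_O x -
    \int[mu]_x (\1_O x * mollify n \1_O x))); last exact/funext.
rewrite -[X in _ --> X](mulr0 2); apply: cvgMl_tmp.
rewrite -[X in _ --> X](subrr (\int[mu]_x \1_O x)); apply: cvgB; first exact: cvg_cst.
apply: (@Rint_dct _ _ _ _ _ _ (cst 1)).
- by move=> n; exact: L1_measurable (lT n).
- exact: L1_measurable lO.
- exact: L1_cst.
- move=> n x /=; have /andP[a b] := T01 n x.
  rewrite ger0_norm ?mulr_ge0// ?indic_ge0//.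
  by rewrite -[leRHS]mulr1; apply: ler_pM.
- apply: filterS ae_in_cube => x xc.
  have [Ox|Ox] := pselect (O x).
    rewrite indicE mem_set// -[X in _ --> X](mulr1 1).
    by apply: cvgMl_tmp; exact: mollify_open.
  rewrite indicE memNset//=; rewrite (_ : (fun n => _) = fun=> 0); last by apply/funext => n; rewrite mul0r.
  exact: cvg_cst.
Qed.

Lemma approximableL v w (c : R) : approximable v -> approximable w ->
  approximable (fun x => c * v x + w x).
Proof.
move=> [lv hv] [lw hw]; split; first by apply: L1D => //; exact: L1Z.
apply: (@squeeze_cvgr _ _ _ _ (fun=> 0) (fun n =>
  `|c| * \int[mu]_x `|mollify n v x - v x| + \int[mu]_x `|mollify n w x - w x|)).
- apply: nearW => n; rewrite Rintegral_ge0//=.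
  have e1 := mollify_err_L1 n lv; have e2 := mollify_err_L1 n lw.
  rewrite -(RintegralZl _ measurableT e1) -(RintegralD measurableT (L1Z _ e1) e2).
  apply: (le_Rintegral measurableT).
  + by apply: mollify_err_L1; apply: L1D => //; exact: L1Z.
  + by apply: L1D => //; exact: L1Z.
  + move=> x _; rewrite mollifyL// -normrM.
    rewrite (_ : _ - _ = c * (mollify n v x - v x) + (mollify n w x - w x)).
      exact: ler_normD.
    ring.
- exact: cvg_cst.
- rewrite -[X in _ --> X](addr0 0); apply: cvgD => //.
  by rewrite -[X in _ --> X](mulr0 `|c|); exact: cvgMl_tmp.
Qed.

(** Mollification contracts L^1, so that the errors for v and for w differ by at
    most twice the distance between v and w. *)
Lemma approximable_closed v : L1 v ->
  (forall e : R, 0 < e -> exists2 w, approximable w & \int[mu]_x `|v x - w x| <= e) ->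
  approximable v.
Proof.
move=> lv h; split => //; apply/cvgr0Pnorm_le => e e0.
have e3 : 0 < e / 3 by rewrite divr_gt0.
have [w [lw aw] vw] := h _ e3.
move/cvgr0Pnorm_le : aw => /(_ _ e3); apply: filterS => n hn.
have lvw := L1B lv lw.
have ew := mollify_err_L1 n lw.
have lT := mollify_L1 n lvw.
rewrite ger0_norm; last exact: Rintegral_ge0.
have : \int[mu]_x `|mollify n v x - v x| <=
    \int[mu]_x (`|mollify n (fun y => v y - w y) x| +
      (`|mollify n w x - w x| + `|v x - w x|)).
  apply: (le_Rintegral measurableT).
  - exact: mollify_err_L1.
  - by apply: L1D; [exact: L1_norm|apply: L1D => //; exact: L1_norm].
  - move=> x _; rewrite mollifyB//; set a := mollify n v x; set b := mollify n w x.
    rewrite (_ : a - v x = (a - b) + ((b - w x) - (v x - w x))); last by ring.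
    apply: (le_trans (ler_normD _ _)); rewrite lerD2l.
    exact: ler_normB.
move=> /le_trans; apply.
rewrite (RintegralD measurableT (L1_norm lT) (L1D ew (L1_norm lvw))).
rewrite (RintegralD measurableT ew (L1_norm lvw)).
have := mollify_contraction n lvw.
move: hn; rewrite ger0_norm; last exact: Rintegral_ge0.
lra.
Unshelve. all: by end_near. Qed.

End mollify.

(** * Mollification converges in mean *)

Section density.
Context (R : realType) (d : nat).
Local Notation V := 'rV[R]_d.
Local Notation mu := (torus_measure R d).
Local Notation L1 := (summable_fun mu).
Implicit Types (x y : V) (v w : V -> R) (n : nat).

Lemma measurable_rV_openE : @measurable _ V = <<s [set O : set V | open O] >>.
Proof.
apply/seteqP; split; last first.
  apply: smallest_sub; first exact: sigma_algebra_measurable.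
  by move=> O; exact: measurable_open.
have mid : measurable_fun setT
    (fun x : g_sigma_algebraType [set O : set V | open O] => x : V).
  apply: measurable_fun_rV => i; apply: (measurability _ (RGenOpens.measurableE R)).
  move=> _ [_ [a [b ->] <-]]; rewrite setTI; apply: sub_sigma_algebra.
  rewrite /mkset; apply: open_comp; last exact: interval_open.
  by move=> x _; exact: coord_continuous.
by move=> A mA; have := mid measurableT A mA; rewrite setTI.
Qed.

(** Open sets are stable under intersection and generate the sigma-algebra, and
    approximability passes to complements and to countable disjoint unions. *)
Lemma approximable_set (A : set V) : measurable A -> approximable (\1_A : V -> R).
Proof.
have a1 : approximable (\1_[set: V] : V -> R) by apply: approximable_open; exact: openT.
move=> mA; apply: (@dynkin_induction _ V _ (fun A : set V => approximable (\1_A : V -> R))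
  measurable_rV_openE).
- by move=> A' B; exact: openI.
- exact: a1.
- by move=> O; exact: approximable_open.
- move=> S mS aS.
  rewrite (_ : \1_(~` S) = fun x => -1 * \1_S x + \1_[set: V] x).
    exact: approximableL.
  apply/funext => x; rewrite !indicE in_setC (mem_set (I : setT x)).
  by case: (_ \in _); rewrite /= ?mulr1 ?mulr0 ?add0r ?addNr.
- move=> F mF tF aF; have mU := bigcup_measurable (fun k _ => mF k).
  have lU := L1_indic (mU setT).
  apply: approximable_closed => // e e0.
  pose g n x : R := \sum_(k < n) \1_(F k) x.
  have ag n : approximable (g n).
    rewrite /g; elim: n => [|n IH].
      rewrite (_ : (fun _ => _) = fun x => -1 * \1_[set: V] x + \1_[set: V] x).
        exact: approximableL.
      by apply/funext => x; rewrite big_ord0 mulN1r addNr.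
    rewrite (_ : (fun _ => _) = fun x => 1 * \1_(F n) x + \sum_(k < n) \1_(F k) x).
      exact: approximableL.
    by apply/funext => x; rewrite big_ord_recr /= addrC mul1r.
  have gE n x : g n x = 0 \/ (g n x = 1 /\ (\bigcup_k F k) x).
    have [[k Fk]|nF] := pselect (exists k : 'I_n, F k x); last first.
      left; rewrite /g big1// => k _; rewrite indicE memNset// => Fk.
      by apply: nF; exists k.
    right; split; last by exists k.
    rewrite /g (bigD1 k)//= big1 ?addr0; first by rewrite indicE mem_set.
    move=> j jk; rewrite indicE memNset// => Fj.
    move/trivIsetP : tF => /(_ j k I I) h.
    have : (F j `&` F k) x by [].
    by rewrite h//.
  have cv : (\int[mu]_x `|\1_(\bigcup_k F k) x - g n x|) @[n --> \oo] --> (0 : R).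
    rewrite -[X in _ --> X](Rint_cst1 mu 0).
    apply: (@Rint_dct _ _ _ _ _ _ (cst 1)).
    - by move=> n; apply: L1_measurable; apply/L1_norm/(L1B lU); case: (ag n).
    - exact: measurable_cst.
    - exact: L1_cst.
    - move=> n x; rewrite normr_id.
      by case: (gE n x) => [->|[-> Ux]]; rewrite ?subr0 indicE ?(mem_set Ux) ?subrr ?normr0//;
        case: (_ \in _); rewrite /= ?normr1 ?normr0.
    - apply: aeW => x; have [[k _ Fk]|nU] := pselect ((\bigcup_k F k) x); last first.
        rewrite (_ : (fun n => _) = fun=> 0); first exact: cvg_cst.
        apply/funext => n; rewrite indicE memNset//.
        by case: (gE n x) => [->|[_ //]]; rewrite subr0 normr0.
      apply: cvg_near_cst; exists k.+1 => // n /= kn.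
      rewrite indicE mem_set; last by exists k.
      case: (gE n x) => [g0|[-> _]]; last by rewrite subrr normr0.
      suff : 1 <= g n x by rewrite g0 ler10.
      rewrite /g (bigD1 (Ordinal kn))//= indicE mem_set//= lerDl.
      by apply: sumr_ge0 => j _; exact: indic_ge0.
  move/cvgr0Pnorm_le : cv => /(_ _ e0)[N _ /(_ N (leqnn _)) /= h].
  by exists (g N) => //; move: h; rewrite ger0_norm//; exact: Rintegral_ge0.
- by rewrite -measurable_rV_openE.
Qed.

Import HBSimple.

Lemma approximable_sfun (g : {sfun V >-> R}) : approximable g.
Proof.
have a0 : approximable (fun _ : V => 0 : R).
  rewrite (_ : (fun _ => _) = fun x => -1 * \1_[set: V] x + \1_[set: V] x).
    by apply: approximableL; apply: approximable_set.
  by apply/funext => x; rewrite mulN1r addNr.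
rewrite (_ : (g : V -> R) = fun x =>
    \sum_(r <- finmap.enum_fset (fset_set (range g))) r * \1_(g @^-1` [set r]) x).
  elim: (finmap.enum_fset _) => [|r s IH].
    by under eq_fun do rewrite big_nil.
  under eq_fun do rewrite big_cons.
  by apply: approximableL => //; exact: approximable_set.
by apply/funext => x; rewrite -fsbig_finite// -fimfunE.
Qed.

(** Simple functions are dense in L^1. *)
Lemma approximable_L1 v : L1 v -> approximable v.
Proof.
move=> lv; apply: approximable_closed => // e e0.
have [g [lg _ cg]] := approximation_sfun_integrable measurableT lv.
have lvg n := L1_norm (L1B lv (lg n)).
have cg' : (\int[mu]_x `|v x - g n x|) @[n --> \oo] --> (0 : R) by exact: fine_cvg.
move/cvgr0Pnorm_le : cg' => /(_ _ e0)[N _ /(_ N (leqnn _)) /= h].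
exists (g N); first exact: approximable_sfun.
by move: h; rewrite ger0_norm//; exact: Rintegral_ge0.
Qed.

End density.

(** * Mollification inside a duality pairing *)

Section pairing.
Context (R : realType) (d : nat).
Local Notation V := 'rV[R]_d.
Local Notation mu := (torus_measure R d).
Local Notation L1 := (summable_fun mu).
Implicit Types (x y : V) (v w F : V -> R) (n : nat).

Lemma measurable_abs_powR F (p : R) : measurable_fun setT F ->
  measurable_fun setT (fun x => `|F x| `^ p).
Proof.
move=> mF; apply: (measurableT_comp (measurable_powR p)).
exact: measurableT_comp.
Qed.

(** Young's inequality after rescaling a by t and b by its inverse, so that the
    weight of b becomes arbitrarily small. *)
Lemma young_eps (p p' e : R) : 0 < p -> 0 < p' -> p^-1 + p'^-1 = 1 -> 0 < e ->
  exists2 c : R, 0 < c & forall a b, 0 <= a -> 0 <= b ->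
    a * b <= c * a `^ p' + e * b `^ p.
Proof.
move=> p0 p'0 pp' e0.
have ep0 : 0 < e * p by exact: mulr_gt0.
pose t := (e * p) `^ (- p^-1).
have t0 : 0 < t by exact: powR_gt0.
exists (t `^ p' / p') => [|a b a0 b0]; first by rewrite divr_gt0// powR_gt0.
have -> : a * b = (t * a) * (t^-1 * b) by rewrite mulrACA mulfV ?mul1r// gt_eqF.
have ta0 : 0 <= t * a by rewrite mulr_ge0// ltW.
have tb0 : 0 <= t^-1 * b by rewrite mulr_ge0// invr_ge0 ltW.
apply: le_trans (conjugate_powR ta0 tb0 p'0 p0 _) _; first by rewrite addrC.
rewrite powRM//; last exact: ltW.
rewrite powRM ?invr_ge0//; last exact: ltW.
rewrite (_ : t^-1 `^ p = e * p); last first.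
  by rewrite /t powRN invrK -powRrM mulVf ?gt_eqF// powRr1// ltW.
rewrite le_eqVlt; apply/orP; left; apply/eqP.
move: (t `^ p') (a `^ p') (b `^ p) => X Y Z; field.
by rewrite !gt_eqF.
Qed.

Lemma norm_truncB (K t : R) : 0 <= K ->
  `|t - Num.max (- K) (Num.min t K)| <= `|t|.
Proof.
move=> K0; have [h1|h1] := leP t K; have [h2|h2] := leP (- K) _.
all: rewrite ?subrr ?normr0//.
all: rewrite ler_norml; have [t0|t0] := ler0P t; apply/andP; split; lra.
Qed.

Lemma truncB0 (K t : R) : `|t| <= K -> t - Num.max (- K) (Num.min t K) = 0.
Proof.
by rewrite ler_norml => /andP[a b]; rewrite min_l// max_r// subrr.
Qed.

Definition trunc F k x : R := Num.max (- k%:R) (Num.min (F x) k%:R).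

Lemma norm_trunc F k x : `|trunc F k x| <= k%:R.
Proof.
rewrite /trunc ler_norml le_max lexx/= ge_max ge_min lexx orbT andbT.
by rewrite -subr_ge0 opprK addr_ge0.
Qed.

Lemma measurable_trunc F k : measurable_fun setT F -> measurable_fun setT (trunc F k).
Proof. by move=> mF; apply: measurable_maxr => //; exact: measurable_minr. Qed.

Lemma truncB_cvg (p : R) F : 0 < p -> measurable_fun setT F ->
  L1 (fun x => `|F x| `^ p) ->
  (\int[mu]_x (`|F x - trunc F k x| `^ p)) @[k --> \oo] --> (0 : R).
Proof.
move=> p0 mF lFp.
rewrite -[X in _ --> X](Rint_cst1 mu 0); apply: (Rint_dct _ _ lFp).
- move=> k; apply: measurable_abs_powR.
  by apply: measurable_funB => //; exact: measurable_trunc.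
- exact: measurable_cst.
- move=> k x; rewrite ger0_norm ?powR_ge0//; apply: ge0_ler_powR; rewrite ?nnegrE//.
    exact: ltW.
  exact: norm_truncB.
- apply: aeW => x; apply: cvg_near_cst.
  exists (Num.truncn `|F x|).+1 => // k /= hk.
  rewrite /trunc truncB0 ?normr0 ?powR0 ?gt_eqF//.
  apply: le_trans (ltW (truncnS_gt _)) _.
  by rewrite ler_nat.
Qed.

Lemma L1_powR1 v : L1 v -> L1 (fun x => `|v x| `^ 1).
Proof. by move=> lv; under eq_fun do rewrite powRr1//; exact: L1_norm. Qed.

Lemma truncB_cvg1 v : L1 v ->
  (\int[mu]_x `|v x - trunc v k x|) @[k --> \oo] --> (0 : R).
Proof.
move=> lv; have := truncB_cvg ltr01 (L1_measurable lv) (L1_powR1 lv).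
by under eq_fun do under eq_Rintegral do rewrite powRr1//.
Qed.

Lemma mollifyZ n v x (c : R) : L1 v ->
  mollify n (fun y => c * v y) x = c * mollify n v x.
Proof.
move=> lv; rewrite -(RintegralZl c measurableT (mollify_kernel_L1 n x lv)).
by apply: eq_Rintegral => y _; rewrite mulrA.
Qed.

(** Truncate F. Against the bounded part, convergence in mean of the mollifications
    is enough. The remainder G is small in L^p', and Young's inequality, applied
    under the integral that defines the mollification of |v|, bounds its pairing
    with the mollifications uniformly in n. *)
Lemma mollify_pairing (p p' : R) F v : 0 < p -> 0 < p' -> p^-1 + p'^-1 = 1 ->
  L1 F -> L1 v -> L1 (fun x => `|F x| `^ p') -> L1 (fun x => `|v x| `^ p) ->
  (\int[mu]_x (F x * mollify n v x)) @[n --> \oo] --> \int[mu]_x (F x * v x).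
Proof.
move=> p0 p'0 pp' lF lv lFp lvp.
have mF := L1_measurable lF; have mv := L1_measurable lv.
have lFv : L1 (fun x => F x * v x).
  have [c c0 hc] := young_eps p0 p'0 pp' ltr01.
  apply: (L1_le _ (L1D (L1Z c lFp) (L1Z 1 lvp))); first exact: measurable_funM.
  by move=> x; rewrite normrM; exact: hc.
apply/cvgrPdist_le => e e0.
pose I := \int[mu]_x `|v x| `^ p.
have I0 : 0 <= I by apply: Rintegral_ge0 => x _; exact: powR_ge0.
have I1 : 0 < I + 1 by rewrite ltr_pwDr.
have e5 : 0 < e / 5 / (I + 1) by rewrite !divr_gt0.
have [c c0 hc] := young_eps p0 p'0 pp' e5.
pose Fk := trunc F; pose G k x := F x - Fk k x.
have Fkb k x : `|Fk k x| <= k%:R by exact: norm_trunc.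
have mG k : measurable_fun setT (G k).
  by apply: measurable_funB => //; exact: measurable_trunc.
have GF k x : `|G k x| <= `|F x| by exact: norm_truncB.
have lG k : L1 (G k) by apply: (L1_le (mG k) (L1_norm lF)).
have lGp k : L1 (fun x => `|G k x| `^ p').
  apply: (L1_le _ lFp) => [|x]; first exact: measurable_abs_powR.
  rewrite ger0_norm ?powR_ge0//; apply: ge0_ler_powR; rewrite ?nnegrE//; exact: ltW.
have cG : (\int[mu]_x (`|G k x| `^ p')) @[k --> \oo] --> (0 : R) by exact: truncB_cvg.
pose e1 := e / 5 / c.
have e10 : 0 < e1 by rewrite !divr_gt0.
move/cvgr0Pnorm_le : cG => /(_ _ e10)[k _ /(_ k (leqnn _)) /=].
rewrite ger0_norm; last by apply: Rintegral_ge0 => x _; exact: powR_ge0.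
move=> hk.
have [_ av] := approximable_L1 lv.
have ek : 0 < e / 5 / (k%:R + 1) by rewrite !divr_gt0// ltr_pwDr.
move/cvgr0Pnorm_le : av => /(_ _ ek); apply: filterS => n.
rewrite ger0_norm; last exact: Rintegral_ge0.
move=> hn.
have lT := mollify_L1 n lv.
have lTa := mollify_L1 n (L1_norm lv).
have lFT : L1 (fun x => F x * mollify n v x) by apply: L1_test => //; exact: mollify_test.
have lGT : L1 (fun x => `|G k x| * mollify n (fun y => `|v y|) x).
  by apply: L1_test; [exact: L1_norm|exact/mollify_test/L1_norm].
have lGv : L1 (fun x => `|G k x| * `|v x|).
  apply: (L1_le _ (L1D (L1Z c (lGp k)) (L1Z (e / 5 / (I + 1)) lvp))).
    by apply: measurable_funM; exact: measurableT_comp.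
  by move=> x; rewrite ger0_norm ?mulr_ge0//; exact: hc.
have lE : L1 (fun x => k%:R * `|mollify n v x - v x|) by exact/L1Z/mollify_err_L1.
rewrite distrC -(RintegralB measurableT lFT lFv).
apply: (le_trans (norm_Rint (L1B lFT lFv))).
apply: (@le_trans _ _ (\int[mu]_x (k%:R * `|mollify n v x - v x| +
    (`|G k x| * mollify n (fun y => `|v y|) x + `|G k x| * `|v x|)))).
  apply: (le_Rintegral measurableT).
  - exact/L1_norm/(L1B lFT lFv).
  - exact: (L1D lE (L1D lGT lGv)).
  - move=> x _.
    rewrite (_ : _ - _ = Fk k x * (mollify n v x - v x) +
      (G k x * mollify n v x - G k x * v x)); last by rewrite /G; ring.
    apply: (le_trans (ler_normD _ _)); apply: lerD.
      by rewrite normrM; apply: ler_wpM2r.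
    apply: (le_trans (ler_normB _ _)); rewrite !normrM lerD2r.
    by apply: ler_wpM2l => //; exact: mollify_norm.
have young_bound w : L1 w -> \int[mu]_x w x = I ->
    (forall x, 0 <= w x) -> forall g, L1 (fun x => `|G k x| * g x) ->
    (forall x, `|G k x| * g x <= c * `|G k x| `^ p' + e / 5 / (I + 1) * w x) ->
    \int[mu]_x (`|G k x| * g x) <= e / 5 + e / 5.
  move=> lw Iw w0 g lg hg.
  apply: le_trans (le_Rintegral measurableT lg
    (L1D (L1Z c (lGp k)) (L1Z (e / 5 / (I + 1)) lw)) (fun x _ => hg x)) _.
  rewrite (RintegralD measurableT (L1Z c (lGp k)) (L1Z (e / 5 / (I + 1)) lw)).
  rewrite (RintegralZl c measurableT (lGp k)) (RintegralZl _ measurableT lw) Iw.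
  apply: lerD.
    by rewrite mulrC -ler_pdivlMr.
  rewrite -[leRHS]mulr1 -[leLHS]mulrA; apply: ler_wpM2l; first by rewrite divr_ge0// ltW.
  by rewrite mulrC ler_pdivrMr// mul1r lerDl.
rewrite (RintegralD measurableT lE (L1D lGT lGv)).
rewrite (RintegralD measurableT lGT lGv).
rewrite (RintegralZl _ measurableT (mollify_err_L1 n lv)).
have b1 : k%:R * \int[mu]_x `|mollify n v x - v x| <= e / 5.
  have k0 : 0 <= k%:R :> R by [].
  apply: le_trans (ler_wpM2l k0 hn) _.
  rewrite mulrA ler_pdivrMr ?ltr_pwDr// mulrC; apply: ler_wpM2l.
    by rewrite divr_ge0// ltW.
  by rewrite lerDl.
have b2 : \int[mu]_x (`|G k x| * `|v x|) <= e / 5 + e / 5.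
  by apply: (young_bound (fun x => `|v x| `^ p)) => // x; rewrite ?powR_ge0//; exact: hc.
have b3 : \int[mu]_x (`|G k x| * mollify n (fun y => `|v y|) x) <= e / 5 + e / 5.
  apply: (young_bound (mollify n (fun x => `|v x| `^ p))) => //.
  - exact: mollify_L1.
  - exact: int_mollify.
  - by move=> x; apply: mollify_ge0 => y; exact: powR_ge0.
  - move=> x; set g := `|G k x|.
    have l1 : L1 (cst 1) by exact: L1_cst.
    have l0 : L1 (cst 0) by exact: L1_cst.
    have lc : L1 (fun y => g * `|v y| + cst 0 y) by apply: L1D => //; exact/L1Z/L1_norm.
    have ld : L1 (fun y => c * g `^ p' * cst 1 y + e / 5 / (I + 1) * `|v y| `^ p).
      by apply: L1D; exact: L1Z.
    have := @mollify_le _ _ n _ _ x lc ld.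
    rewrite (mollifyL _ _ _ (L1_norm lv) l0) (mollifyL _ _ _ l1 (L1Z _ lvp)).
    rewrite mollify_cst1 mulr1.
    have -> : mollify n (cst 0) x = 0.
      rewrite /mollify /conv; under eq_Rintegral do rewrite mul0r.
      exact: Rint_cst1.
    have -> : mollify n (fun y => e / 5 / (I + 1) * `|v y| `^ p) x =
        e / 5 / (I + 1) * mollify n (fun y => `|v y| `^ p) x.
      rewrite -[RHS](mollifyZ n x (e / 5 / (I + 1)) lvp).
      by [].
    by rewrite addr0; apply => y; rewrite addr0; exact: (hc _ _ (normr_ge0 _) (normr_ge0 _)).
lra.
Unshelve. all: by end_near. Qed.

End pairing.

(** * Weak derivatives and the chain rule *)

Section sobolev_calculus.
Context (R : realType) (d : nat).
Local Notation V := 'rV[R]_d.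
Local Notation mu := (torus_measure R d).
Local Notation L1 := (summable_fun mu).
Implicit Types (x y : V) (u v w z : V -> R) (n : nat) (i : 'I_d).

Lemma torus_Lp1_L1 v : torus_Lp 1%E v -> L1 v.
Proof. by move=> [_ /Lfun1_integrable]. Qed.

Lemma mollify_ae_eq n v w x : L1 v -> L1 w -> {ae mu, forall y, v y = w y} ->
  mollify n v x = mollify n w x.
Proof.
move=> lv lw vw; apply: Rint_ae_eq.
- exact: L1_measurable (mollify_kernel_L1 n x lv).
- exact: L1_measurable (mollify_kernel_L1 n x lw).
- by apply: filterS vw => y ->.
Qed.

Lemma cvg_cst0_eq0 (a : R) : (fun _ : nat => a) @ \oo --> (0 : R) -> a = 0.
Proof. by move=> h; exact: (cvg_unique (@norm_hausdorff _ R) (cvg_cst a) h). Qed.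

Lemma L1_mollify_cst_ae v (c : R) : L1 v -> (forall n x, mollify n v x = c) ->
  {ae mu, forall x, v x = c}.
Proof.
move=> lv vc; have [_ av] := approximable_L1 lv.
have lc : L1 (fun x => v x - c) by apply: L1B => //; exact: L1_cst.
suff : {ae mu, forall x, v x - c = 0}.
  by apply: filterS => x /eqP; rewrite subr_eq0 => /eqP.
apply: Rint_eq0_ae => //; apply: cvg_cst0_eq0; move: av.
rewrite (_ : (fun n => \int[mu]_x `|mollify n v x - v x|) =
  fun=> \int[mu]_x `|v x - c|)//.
by apply/funext => n; apply: eq_Rintegral => x _; rewrite vc distrC.
Qed.

(** The mollifier is a test function of y, so all mollifications of v vanish. *)
Lemma test_orthogonal_ae0 v : L1 v ->
  (forall phi, test_function phi -> \int[mu]_x (v x * phi x) = 0) ->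
  {ae mu, forall x, v x = 0}.
Proof.
move=> lv h; apply: L1_mollify_cst_ae => // n x.
exact: (h _ (separable_testr x (separable_mollifier R d n))).
Qed.

Lemma is_weak_partial_unique i u v w : is_weak_partial i u v ->
  is_weak_partial i u w -> {ae mu, forall x, v x = w x}.
Proof.
move=> [/torus_Lp1_L1 lv hv] [/torus_Lp1_L1 lw hw].
suff : {ae mu, forall x, v x - w x = 0}.
  by apply: filterS => x /eqP; rewrite subr_eq0 => /eqP.
apply: test_orthogonal_ae0; first exact: L1B.
move=> phi tphi; under eq_Rintegral do rewrite mulrBl.
rewrite (RintegralB measurableT (L1_test lv tphi) (L1_test lw tphi)).
apply/eqP; rewrite subr_eq0; apply/eqP; apply: oppr_inj.
by rewrite -hv// -hw.
Qed.

(** The mollifications of z have zero gradient, hence are constant, and mollification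
    keeps the integral. *)
Lemma weak_partial0_cst z (w : 'I_d -> V -> R) : L1 z ->
  (forall i, is_weak_partial i z (w i)) ->
  (forall i, {ae mu, forall x, w i x = 0}) -> {ae mu, forall x, z x = mean z}.
Proof.
move=> lz zw w0; apply: L1_mollify_cst_ae => // n x.
have cT a b : mollify n z a = mollify n z b.
  apply: derive0_cst => [y|i y]; first exact/test_differentiable/mollify_test.
  rewrite (mollify_weak_partial n y lz (zw i)).
  have l0 : L1 (cst 0) by exact: L1_cst.
  rewrite (mollify_ae_eq n y (torus_Lp1_L1 (zw i).1) l0 (w0 i)).
  rewrite /mollify /conv; under eq_Rintegral do rewrite mul0r.
  exact: Rint_cst1.
rewrite /mean -(int_mollify n lz) -[LHS](Rint_cst1 mu).
by apply: eq_Rintegral => y _; exact: cT.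
Qed.

Lemma lipschitz_derive (G G' : R -> R) (L : R) :
  (forall t, is_derive t (1 : R) G (G' t)) -> (forall t, `|G' t| <= L) ->
  forall a b, `|G a - G b| <= L * `|a - b|.
Proof.
move=> dG G'L.
have h a b : a <= b -> `|G b - G a| <= L * `|b - a|.
  move=> ab; have cG : {within `[a, b], continuous G}.
    apply: continuous_subspaceT => t; apply: differentiable_continuous.
    by apply/derivable1_diffP; case: (dG t).
  have [c _ ->] := MVT_segment ab (fun t _ => dG t) cG.
  by rewrite normrM; apply: ler_wpM2r.
move=> a b; have [ab|ba] := leP a b; last by apply: h; exact: ltW.
by rewrite distrC (distrC a); exact: h.
Qed.

(** Truncating w reduces the claim to a bounded w, for which convergence in mean of
    the other factor suffices. *)
Lemma bounded_cvg_int (g_ : nat -> V -> R) (h_ : nat -> V -> R) w (C K : R) :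
  L1 w -> 0 <= K -> (forall n, measurable_fun setT (g_ n)) ->
  (forall n, L1 (h_ n)) ->
  (forall n x, 0 <= g_ n x <= C) -> (forall n x, g_ n x <= K * `|h_ n x|) ->
  (\int[mu]_x `|h_ n x|) @[n --> \oo] --> (0 : R) ->
  (\int[mu]_x (g_ n x * `|w x|)) @[n --> \oo] --> (0 : R).
Proof.
move=> lw K0 mg lh gC gK ch.
have mw := L1_measurable lw.
have C0 : 0 <= C by have /andP[a b] := gC 0%N 0; exact: le_trans b.
have lgw n : L1 (fun x => g_ n x * `|w x|).
  apply: (L1_le _ (L1Z C (L1_norm lw))).
    by apply: measurable_funM => //; exact: measurableT_comp.
  move=> x; have /andP[a b] := gC n x.
  by rewrite normrM normr_id ger0_norm//; apply: ler_wpM2r.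
apply/cvgr0Pnorm_le => e e0.
have e2 : 0 < e / 2 / (C + 1) by rewrite !divr_gt0// ltr_pwDr.
move/cvgr0Pnorm_le : (truncB_cvg1 lw) => /(_ _ e2)[k _ /(_ k (leqnn _)) /=].
rewrite ger0_norm; last exact: Rintegral_ge0.
move=> hk.
have e3 : 0 < e / 2 / (K * k%:R + 1) by rewrite !divr_gt0// ltr_pwDr// mulr_ge0.
move/cvgr0Pnorm_le : ch => /(_ _ e3); apply: filterS => n.
rewrite ger0_norm; last exact: Rintegral_ge0.
move=> hn; rewrite ger0_norm; last first.
  by apply: Rintegral_ge0 => x _; have /andP[a _] := gC n x; rewrite mulr_ge0.
have ltr : L1 (trunc w k) by exact: L1_bounded (measurable_trunc k mw) (norm_trunc w k).
have l1 := L1Z (K * k%:R) (L1_norm (lh n)); have l2 := L1Z C (L1_norm (L1B lw ltr)).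
apply: le_trans (_ : \int[mu]_x (K * k%:R * `|h_ n x| + C * `|w x - trunc w k x|) <= _).
  apply: (le_Rintegral measurableT (lgw n) (L1D l1 l2)) => x _.
  have /andP[a b] := gC n x.
  have t1 : `|w x| <= `|trunc w k x| + `|w x - trunc w k x|.
    by rewrite -[w x in X in X <= _](subrK (trunc w k x)) addrC; exact: ler_normD.
  apply: le_trans (ler_wpM2l a t1) _; rewrite mulrDr; apply: lerD.
    rewrite mulrAC; apply: ler_pM => //; exact: norm_trunc.
  exact: ler_wpM2r.
rewrite (RintegralD measurableT l1 l2).
rewrite (RintegralZl _ measurableT (L1_norm (lh n))).
rewrite (RintegralZl _ measurableT (L1_norm (L1B lw ltr))).
rewrite [leRHS](splitr e); apply: lerD.
  have Kk : 0 <= K * k%:R by rewrite mulr_ge0.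
  apply: le_trans (ler_wpM2l Kk hn) _.
  rewrite mulrA ler_pdivrMr ?ltr_pwDr// mulrC; apply: ler_wpM2l.
    by rewrite divr_ge0// ltW.
  by rewrite lerDl.
apply: le_trans (ler_wpM2l C0 hk) _.
rewrite mulrA ler_pdivrMr ?ltr_pwDr// mulrC; apply: ler_wpM2l.
  by rewrite divr_ge0// ltW.
by rewrite lerDl.
Qed.

Lemma cvg_int_diff (a_ : nat -> V -> R) (a : V -> R) (b_ : nat -> R) :
  (forall n, L1 (a_ n)) -> L1 a -> (forall n, \int[mu]_x `|a_ n x - a x| <= b_ n) ->
  b_ @ \oo --> (0 : R) -> (\int[mu]_x a_ n x) @[n --> \oo] --> \int[mu]_x a x.
Proof.
move=> la_ la hb cb; apply/cvgrPdist_le => e e0.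
move/cvgr0Pnorm_le : cb => /(_ _ e0); apply: filterS => n hn.
rewrite /= distrC -(RintegralB measurableT (la_ n) la).
apply: le_trans (norm_Rint (L1B (la_ n) la)) _.
by apply: le_trans (hb n) _; apply: le_trans hn; exact: ler_norm.
Qed.

(** For the mollifications of z the identity is the vanishing integral of the
    derivative of G(z) phi. Both sides pass to the limit, because G and G' are
    Lipschitz and G' is bounded. *)
Lemma chain_rule i z w (G G' : R -> R) (L K : R) :
  L1 z -> is_weak_partial i z w -> torus_periodic z ->
  (forall t, is_derive t (1 : R) G (G' t)) ->
  (forall t, `|G' t| <= L) -> (forall a b, `|G' a - G' b| <= K * `|a - b|) ->
  is_weak_partial i (G \o z) (fun x => G' (z x) * w x).
Proof.
move=> lz zw pz dG G'L G'K.
have lw := torus_Lp1_L1 zw.1; have mz := L1_measurable lz.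
have K0 : 0 <= K.
  by have := G'K 1 0; rewrite subr0 normr1 mulr1; exact: le_trans.
have L0 : 0 <= L by exact: le_trans (G'L 0).
have GL := lipschitz_derive dG G'L.
have cG : continuous G.
  move=> t; apply: differentiable_continuous; apply/derivable1_diffP.
  by case: (dG t).
have cG' : continuous G'.
  move=> t; apply/cvgrPdist_le => e e0.
  have ek : 0 < e / (K + 1) by rewrite divr_gt0// ltr_pwDr.
  apply/nbhs_ballP; exists (e / (K + 1)) => //= r tr.
  apply: le_trans (G'K _ _) _; apply: le_trans (ler_wpM2l K0 (ltW tr)) _.
  by rewrite mulrA ler_pdivrMr ?ltr_pwDr// mulrDr mulr1 [K * e]mulrC lerDl ltW.
have mG : measurable_fun setT G by exact: continuous_measurable_fun.
have mG' : measurable_fun setT G' by exact: continuous_measurable_fun.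
have lGw v w' : measurable_fun setT v -> L1 w' -> L1 (fun x => G' (v x) * w' x).
  move=> mv lw'; apply: (L1_le _ (L1Z L (L1_norm lw'))).
    by apply: measurable_funM; [exact: measurableT_comp|exact: L1_measurable lw'].
  by move=> x; rewrite normrM; apply: ler_wpM2r.
have lGz v : L1 v -> L1 (G \o v).
  move=> lv; apply: (L1_le _ (L1D (L1Z L (L1_norm lv)) (L1_cst mu `|G 0|))).
    by apply: measurableT_comp => //; exact: L1_measurable lv.
  move=> x /=; have := GL (v x) 0; rewrite subr0 => h.
  rewrite -[G (v x)](subrK (G 0)); apply: le_trans (ler_normD _ _) _.
  by rewrite lerD2r.
split.
  split; last by apply/Lfun1_integrable; exact: lGw.
  by move=> j x; rewrite pz; case: zw.1 => -> .
move=> phi tphi; pose e : V := delta_mx ord0 i.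
pose zn n := mollify n z; pose wn n := mollify n w.
have lzn n : L1 (zn n) by exact: mollify_L1.
have lwn n : L1 (wn n) by exact: mollify_L1.
have tphi' : test_function (fun x => grad phi x ord0 i).
  by rewrite (_ : (fun _ => _) = 'D_e phi); [exact: test_derive|apply/funext => x; rewrite gradE].
have [M M0 phiM] := test_bounded tphi; have [M' M'0 phiM'] := test_bounded tphi'.
have ibp n : \int[mu]_x (G (zn n x) * grad phi x ord0 i) =
    - \int[mu]_x (G' (zn n x) * wn n x * phi x).
  have tz : test_function (zn n) by exact: mollify_test.
  have dGz x : differentiable (G \o zn n) x.
    apply: differentiable_comp_real; first exact: test_differentiable.
    by case: (dG (zn n x)).
  have DG x : 'D_e ((G \o zn n) \* phi) x =
      G (zn n x) * grad phi x ord0 i + G' (zn n x) * wn n x * phi x.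
    have d1 := diff_derivable (v := e) (dGz x).
    have d2 := diff_derivable (v := e) (test_differentiable x tphi).
    have dG1 : derivable G (zn n x) 1 by case: (dG (zn n x)).
    have D1 : 'D_1 G (zn n x) = G' (zn n x) by case: (dG (zn n x)).
    have := deriveM d1 d2.
    rewrite (derive_comp_real e (test_differentiable x tz) dG1) D1.
    rewrite (mollify_weak_partial n x lz zw) -gradE => ->.
    by rewrite gradE /=; congr (_ + _); rewrite [LHS]mulrC.
  have h : \int[mu]_x 'D_e ((G \o zn n) \* phi) x = 0.
    apply: torus_int_derive.
    - by move=> j x /=; rewrite tz.1 tphi.1.
    - by move=> x; apply: differentiableM => //; exact: test_differentiable.
    - rewrite (_ : 'D_(delta_mx ord0 i) _ = fun x =>
        G (zn n x) * grad phi x ord0 i + G' (zn n x) * wn n x * phi x); last exact/funext.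
      have czn := test_continuous tz.
      have cwn : continuous (wn n) by exact/test_continuous/mollify_test.
      move=> x; have c1 := continuous_comp (czn x) (cG (zn n x)).
      have c2 := continuous_comp (czn x) (cG' (zn n x)).
      exact: (cvgD (cvgM c1 (test_continuous tphi' (x:=x)))
        (cvgM (cvgM c2 (cwn x)) (test_continuous tphi (x:=x)))).
  apply/eqP; rewrite -subr_eq0 opprK; apply/eqP.
  rewrite -(RintegralD measurableT); last 2 first.
  - exact: L1_test (lGz _ (lzn n)) tphi'.
  - exact: L1_test (lGw _ _ (L1_measurable (lzn n)) (lwn n)) tphi.
  by rewrite -[RHS]h; apply: eq_Rintegral => x _; rewrite DG.
have lGphi v : L1 v -> L1 (fun x => G (v x) * grad phi x ord0 i).
  by move=> lv; exact: L1_test (lGz _ lv) tphi'.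
have lGwphi v w' : L1 v -> L1 w' -> L1 (fun x => G' (v x) * w' x * phi x).
  by move=> lv lw'; exact: L1_test (lGw _ _ (L1_measurable lv) lw') tphi.
have [_ az] := approximable_L1 lz; have [_ aw] := approximable_L1 lw.
have c1 : (\int[mu]_x (G (zn n x) * grad phi x ord0 i)) @[n --> \oo] -->
    \int[mu]_x (G (z x) * grad phi x ord0 i).
  apply: (cvg_int_diff (b_ := fun n => L * M' * \int[mu]_x `|zn n x - z x|)).
  - by move=> n; exact: lGphi.
  - exact: lGphi.
  - move=> n; rewrite -(RintegralZl _ measurableT (mollify_err_L1 n lz)).
    apply: (le_Rintegral measurableT).
    + by apply/L1_norm/L1B; exact: lGphi.
    + exact/L1Z/mollify_err_L1.
    + move=> x _; rewrite -mulrBl normrM mulrAC; apply: ler_pM => //.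
  - by rewrite -[X in _ --> X](mulr0 (L * M')); exact: cvgMl_tmp.
have c2 : (\int[mu]_x (G' (zn n x) * wn n x * phi x)) @[n --> \oo] -->
    \int[mu]_x (G' (z x) * w x * phi x).
  have mzn n := L1_measurable (lzn n).
  pose g n x := `|G' (zn n x) - G' (z x)|.
  have mg n : measurable_fun setT (g n).
    by apply: measurableT_comp => //; apply: measurable_funB; exact: measurableT_comp.
  have gC n x : 0 <= g n x <= L + L.
    rewrite /g normr_ge0/=; apply: le_trans (ler_normB _ _) _.
    exact: lerD.
  have lgw n : L1 (fun x => g n x * `|w x|).
    apply: (L1_le _ (L1Z (L + L) (L1_norm lw))).
      apply: measurable_funM => //; apply: measurableT_comp => //.
      exact: L1_measurable lw.
    move=> x; have /andP[a b] := gC n x.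
    by rewrite normrM normr_id ger0_norm//; apply: ler_wpM2r.
  apply: (cvg_int_diff (b_ := fun n => M * L * (\int[mu]_x `|wn n x - w x|) +
      M * (\int[mu]_x (g n x * `|w x|)))).
  - by move=> n; exact: lGwphi.
  - exact: lGwphi.
  - move=> n; have e1 := mollify_err_L1 n lw.
    rewrite -(RintegralZl _ measurableT e1) -(RintegralZl _ measurableT (lgw n)).
    rewrite -(RintegralD measurableT (L1Z _ e1) (L1Z _ (lgw n))).
    apply: (le_Rintegral measurableT).
    + by apply/L1_norm/L1B; exact: lGwphi.
    + by apply: L1D; exact: L1Z.
    + move=> x _; rewrite -mulrBl normrM mulrC -!mulrA -mulrDr.
      apply: ler_pM => //.
      rewrite (_ : _ - _ = G' (zn n x) * (wn n x - w x) +
        (G' (zn n x) - G' (z x)) * w x); last by ring.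
      apply: (le_trans (ler_normD _ _)); rewrite !normrM lerD2r.
      exact: ler_wpM2r.
  - rewrite -[X in _ --> X](addr0 0); apply: cvgD.
      by rewrite -[X in _ --> X](mulr0 (M * L)); exact: cvgMl_tmp.
    rewrite -[X in _ --> X](mulr0 M); apply: cvgMl_tmp.
    apply: (bounded_cvg_int (C := L + L) (K := K) (h_ := fun n x => zn n x - z x)) => //.
      by move=> n; exact: L1B.
    by move=> n x; exact: G'K.
have c2' := cvgN c2.
apply: (cvg_unique (@norm_hausdorff _ R) c1); move: c2'.
rewrite (_ : - (fun n => \int[mu]_x (G' (zn n x) * wn n x * phi x)) =
  fun n => \int[mu]_x (G (zn n x) * grad phi x ord0 i)); first exact.
by apply/funext => n; rewrite ibp.
Qed.

End sobolev_calculus.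

(** * Functions whose weak gradient vanishes on an open set *)

Section local_constancy.
Context (R : realType) (d : nat).
Local Notation V := 'rV[R]_d.
Local Notation mu := (torus_measure R d).
Local Notation L1 := (summable_fun mu).
Implicit Types (x y : V) (z : V -> R) (n : nat) (i : 'I_d).

Lemma ball_coord x (e : R) y i : ball x e y -> `|x ord0 i - y ord0 i| < e.
Proof. by move=> [_ /(_ ord0 i)]; rewrite -ball_normE. Qed.

Lemma L1_indicM (A : set V) v : measurable A -> L1 v -> L1 (fun x => v x * \1_A x).
Proof.
move=> mA lv; apply: (@L1M _ _ _ _ _ _ 1) => // x.
by rewrite ger0_norm ?indic_ge0// indic_le1.
Qed.

(** Functions close to constants on B are close to their mean over B, the only
    candidate for the constant. *)
Lemma ae_cst_on (B : set V) z (c_ : nat -> R) : measurable B -> L1 z ->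
  (\int[mu]_x (`|z x - c_ n| * \1_B x)) @[n --> \oo] --> (0 : R) ->
  exists c, {ae mu, forall x, B x -> z x = c}.
Proof.
move=> mB lz hc.
have lB : L1 \1_B by exact: L1_indic.
pose m := \int[mu]_x (\1_B x : R).
have m0 : 0 <= m by apply: Rintegral_ge0 => x _; exact: indic_ge0.
have lzB : L1 (fun x => z x * \1_B x) by exact: L1_indicM.
have ldc (c : R) : L1 (fun x => (z x - c) * \1_B x).
  by apply: L1_indicM => //; apply: L1B => //; exact: L1_cst.
have ldcn (c : R) : L1 (fun x => `|z x - c| * \1_B x).
  by apply: L1_indicM => //; apply: L1_norm; apply: L1B => //; exact: L1_cst.
have conclude (c : R) : (\int[mu]_x (`|z x - c| * \1_B x)) = 0 ->
    {ae mu, forall x, B x -> z x = c}.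
  move=> h; have := @Rint_ge0_eq0_ae _ _ _ mu _ (ldcn c) _ h.
  have ge0 : {ae mu, forall x, 0 <= `|z x - c| * \1_B x}.
    by apply: aeW => x; rewrite mulr_ge0// indic_ge0.
  move=> /(_ ge0); apply: filterS => x + Bx.
  by rewrite indicE mem_set// mulr1 => /normr0_eq0 /eqP; rewrite subr_eq0 => /eqP.
pose c := (\int[mu]_x (z x * \1_B x)) / m.
exists c; apply: conclude; apply: cvg_cst0_eq0.
apply: (@squeeze_cvgr _ _ _ _ (fun=> 0)
  (fun n => 2 * \int[mu]_x (`|z x - c_ n| * \1_B x))).
- apply: nearW => n; apply/andP; split.
    by apply: Rintegral_ge0 => x _; rewrite mulr_ge0// indic_ge0.
  have cm : `|c_ n - c| * m <= \int[mu]_x (`|z x - c_ n| * \1_B x).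
    have [m00|mn0] := eqVneq m 0.
      rewrite m00 mulr0; apply: Rintegral_ge0 => x _.
      by rewrite mulr_ge0// indic_ge0.
    rewrite -[m in X in X <= _]ger0_norm// -normrM mulrBl.
    have -> : c * m = \int[mu]_x (z x * \1_B x) by rewrite /c divfK.
    rewrite -normrN opprB -(RintegralZl (c_ n) measurableT lB).
    rewrite -(RintegralB measurableT lzB (L1Z (c_ n) lB)).
    apply: le_trans (norm_Rint (L1B lzB (L1Z (c_ n) lB))) _.
    rewrite le_eqVlt; apply/orP; left; apply/eqP; apply: eq_Rintegral => x _.
    by rewrite -mulrBl normrM [`|\1_B x|]ger0_norm// indic_ge0.
  apply: (@le_trans _ _ (\int[mu]_x (`|z x - c_ n| * \1_B x + `|c_ n - c| * \1_B x))).
    apply: (le_Rintegral measurableT (ldcn c) (L1D (ldcn (c_ n)) (L1Z _ lB))) => x _.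
    rewrite -mulrDl; apply: ler_wpM2r; first exact: indic_ge0.
    by rewrite -[z x in X in X <= _](subrK (c_ n)) -addrA; exact: ler_normD.
  rewrite (RintegralD measurableT (ldcn (c_ n)) (L1Z _ lB)).
  by rewrite (RintegralZl _ measurableT lB) mulr_natl mulr2n lerD2l.
- exact: cvg_cst.
- by rewrite -[X in _ --> X](mulr0 2); exact: cvgMl_tmp.
Qed.

(** On the smaller ball, mollifying the weak gradient only collects mass from
    outside the larger ball, hence gives something uniformly small. So the
    oscillation of the mollifications of z tends to 0 there. *)
Lemma locally_cst x0 (e : R) z (w : 'I_d -> V -> R) : L1 z ->
  (forall i, is_weak_partial i z (w i)) -> 0 < e ->
  (forall i, e <= x0 ord0 i <= 1 - e) ->
  {ae mu, forall x, ball x0 e x -> forall i, w i x = 0} ->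
  exists c, {ae mu, forall x, ball x0 (e / 2) x -> z x = c}.
Proof.
move=> lz zw e0 x0e w0.
have e20 : 0 < e / 2 by rewrite divr_gt0.
pose del := Num.min (e / 2) 2^-1.
have d0 : 0 < del by rewrite lt_min e20 /= invr_gt0.
have d2 : del <= 2^-1 by rewrite ge_min lexx orbT.
have de : del <= e / 2 by rewrite ge_min lexx.
pose B : set V := ball x0 (e / 2); pose A : set V := ~` ball x0 e.
have mball (r : R) : 0 < r -> measurable (ball x0 r).
  by move=> r0; apply: measurable_open; exact: ball_open.
have mA : measurable A by apply: measurableC; exact: mball.
have mB : measurable B by exact: mball.
have far x y : B x -> A y -> (forall i, 0 < y ord0 i < 1) ->
    exists i, del <= `|x ord0 i - y ord0 i| <= 1 - del.
  move=> Bx Ay yc; apply: far_point => // [i|xy].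
    have := ball_coord i Bx; have /andP[a b] := x0e i.
    rewrite ltr_norml => /andP[h1 h2].
    by apply/andP; split; lra.
  apply: Ay; rewrite /= (splitr e); apply: ball_triangle Bx _.
  exact: le_ball xy.
have [tau tau0 htau] := mollify_far_mass mA d0 d2 far.
have lw i : L1 (w i) by case: (zw i) => /torus_Lp1_L1.
pose W i : R := \int[mu]_x (`|w i x| * \1_A x).
have Tw n x i : B x -> `|mollify n (w i) x| <= tau n * W i.
  move=> Bx; apply: le_trans (mollify_norm n x (lw i)) _.
  have lv : L1 (fun x => `|w i x| * \1_A x) by apply: L1_indicM => //; exact: L1_norm.
  rewrite (mollify_ae_eq n x (L1_norm (lw i)) lv); last first.
    apply: filterS w0 => y hy; rewrite indicE.
    have [yA|/negP] := boolP (y \in A); first by rewrite mulr1.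
    rewrite in_setC => /negP/negPn; rewrite inE => yb.
    by rewrite hy// normr0 mul0r.
  apply: (htau n x _ Bx lv) => y; first by apply: mulr_ge0 => //; exact: indic_ge0.
  by move=> nA; rewrite indicE memNset// mulr0.
pose eta n := tau n * \sum_i e * W i.
have ceta : eta @ \oo --> (0 : R).
  by rewrite -[X in _ --> X](mul0r (\sum_i e * W i)); exact: cvgMr_tmp.
have osc n x : B x -> `|mollify n z x - mollify n z x0| <= eta n.
  move=> Bx; pose f (t : R) := mollify n z (x0 + t *: (x - x0)).
  have tz : test_function (mollify n z) by exact: mollify_test.
  have df t : is_derive t (1 : R) f ('D_(x - x0) (mollify n z) (x0 + t *: (x - x0))).
    exact: is_derive_line (test_differentiable _ tz).
  have cf : {within `[0, 1], continuous f}.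
    apply: continuous_subspaceT => t; apply: differentiable_continuous.
    by apply/derivable1_diffP; case: (df t).
  have [t] := MVT_segment ler01 (fun t _ => df t) cf.
  rewrite in_itv/= => /andP[t0 t1].
  have -> : f 1 = mollify n z x by rewrite /f scale1r addrC subrK.
  have -> : f 0 = mollify n z x0 by rewrite /f scale0r addr0.
  rewrite subr0 mulr1 => ->.
  have Bt : B (x0 + t *: (x - x0)).
    split => // j i; rewrite [j]ord1 -ball_normE /= !mxE.
    have := ball_coord i Bx; rewrite distrC => h.
    rewrite opprD addrA subrr add0r normrN normrM ger0_norm//.
    by apply: le_lt_trans h; rewrite ler_piMl.
  rewrite derive_sum_coord; last exact: test_differentiable.
  apply: le_trans (ler_norm_sum _ _ _) _; rewrite /eta mulr_sumr.
  apply: ler_sum => i _; rewrite mulrCA.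
  rewrite (mollify_weak_partial n _ lz (zw i)) normrM; apply: ler_pM => //.
    rewrite !mxE distrC; apply: le_trans (ltW (ball_coord i Bx)) _.
    by rewrite ler_pdivrMr// mulr_natr mulr2n lerDl ltW.
  exact: Tw.
apply: (@ae_cst_on B z (fun n => mollify n z x0)) => //.
have lB : L1 \1_B by exact: L1_indic.
have [_ az] := approximable_L1 lz.
apply: (@squeeze_cvgr _ _ _ _ (fun=> 0)
  (fun n => \int[mu]_x `|mollify n z x - z x| + `|eta n|)).
- apply: nearW => n; apply/andP; split.
    by apply: Rintegral_ge0 => x _; rewrite mulr_ge0// indic_ge0.
  have em := mollify_err_L1 n lz; have le_ := L1Z `|eta n| lB.
  apply: (@le_trans _ _ (\int[mu]_x (`|mollify n z x - z x| + `|eta n| * \1_B x))).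
    apply: (le_Rintegral measurableT _ (L1D em le_)) => [|x _].
      apply: L1_indicM => //; apply: L1_norm; apply: L1B => //; exact: L1_cst.
    rewrite indicE; have [Bx|_] := boolP (x \in B); last by rewrite !mulr0 addr0.
    rewrite !mulr1 (_ : z x - _ = - (mollify n z x - z x) +
      (mollify n z x - mollify n z x0)); last by ring.
    apply: (le_trans (ler_normD _ _)); rewrite normrN lerD2l.
    by apply: le_trans (osc n x _) (ler_norm _); rewrite -inE.
  rewrite (RintegralD measurableT em le_) lerD2l (RintegralZl _ measurableT lB).
  by rewrite -[leRHS]mulr1; apply: ler_wpM2l => //; exact: int_indic_le1.
- exact: cvg_cst.
- rewrite -[X in _ --> X](addr0 0); apply: cvgD => //.
  by rewrite -(normr0 R); exact: cvg_norm.
Qed.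

(** U is the union, up to a null set, of countably many balls with rational data on
    each of which z is constant. *)
Lemma countable_values (U : set V) z (w : 'I_d -> V -> R) : open U -> L1 z ->
  (forall i, is_weak_partial i z (w i)) ->
  {ae mu, forall x, U x -> forall i, w i x = 0} ->
  exists c : nat -> R, {ae mu, forall x, U x -> exists n, z x = c n}.
Proof.
move=> oU lz zw w0.
pose ctr (J : 'rV[rat]_d * nat) : V := \row_i ratr (J.1 ord0 i).
pose rad (J : 'rV[rat]_d * nat) : R := J.2.+1%:R^-1.
(* Balls that stay within the unit cube, since the torus measure is carried by it. *)
pose good J := ball (ctr J) (rad J * 2) `<=` U /\
  forall i, rad J * 2 <= ctr J ord0 i <= 1 - rad J * 2.
have rad0 J : 0 < rad J by rewrite invr_gt0.
have rad2 J : rad J * 2 / 2 = rad J by rewrite mulfK.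
have cst J : exists c, good J -> {ae mu, forall x, ball (ctr J) (rad J) x -> z x = c}.
  have [[bU hI]|nI] := pselect (good J); last by exists 0.
  have r20 : 0 < rad J * 2 by rewrite mulr_gt0.
  have [|c hc] := locally_cst lz zw r20 hI.
    by apply: filterS w0 => x h /bU; exact: h.
  by exists c => _; move: hc; rewrite rad2.
pose cI J := sval (cid (cst J)).
have hcI J : good J -> {ae mu, forall x, ball (ctr J) (rad J) x -> z x = cI J}.
  exact: (svalP (cid (cst J))).
pose c n : R := if (unpickle n : option ('rV[rat]_d * nat)%type) is Some J then cI J else 0.
exists c.
have all_n : {ae mu, forall x, forall n : nat,
    if (unpickle n : option ('rV[rat]_d * nat)%type) is Some J then good J -> ball (ctr J) (rad J) x -> z x = cI J else True}.
  apply: ae_foralln => n; case: (unpickle n) => [J|]; last exact: aeW.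
  have [gI|nI] := pselect (good J); last exact: aeW.
  by apply: filterS (hcI J gI) => x h _.
apply: filterS2 all_n (ae_in_cube R d) => x hx xc Ux.
have /nbhs_ballP[e /= e0 he] := open_nbhs_nbhs (conj oU Ux).
have [k [k0 ke kx]] : exists k : nat, [/\ 0 < k.+1%:R^-1 :> R,
    k.+1%:R^-1 * 3 <= e & forall i, k.+1%:R^-1 * 3 <= x ord0 i <= 1 - k.+1%:R^-1 * 3].
  have h1 : \forall r \near (0 : R)^'+, forall i, r <= x ord0 i <= 1 - r.
    apply: filter_forall => i; have /andP[x0 x1] := xc i.
    have x1' : 0 < 1 - x ord0 i by rewrite subr_gt0.
    apply: filterS2 (nbhs_right_le x0) (nbhs_right_le x1') => r a b.
    by rewrite a lerBrDl -lerBrDr.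
  have : \forall r \near (0 : R)^'+, [/\ 0 < r, r <= e &
      forall i, r <= x ord0 i <= 1 - r].
    near=> r; split => //.
    - by near: r; exact: nbhs_right_le.
    - by near: r.
  move=> /filter_ex[r [r0 re rx]].
  have [k hk] : exists k : nat, k.+1%:R^-1 < r / 3 by apply: exists_invS_lt; rewrite divr_gt0.
  have kr : k.+1%:R^-1 * 3 <= r by rewrite -ler_pdivlMr// ltW.
  exists k; split; [by rewrite invr_gt0|exact: le_trans re|move=> i].
  by have /andP[a b] := rx i; rewrite (le_trans kr a) (le_trans b)// lerD2l lerN2.
have [q hq] := rat_box_cover k x; pose J := (q, k).
have bx : ball (ctr J) (rad J) x.
  by split => // j i; rewrite [j]ord1 -ball_normE /= mxE distrC; exact: hq.
have gI : good J.
  split=> [y hy|i].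
    apply: he; apply: (le_ball ke); rewrite (_ : _ * 3 = rad J + rad J * 2); last first.
      by rewrite /rad /=; ring.
    by apply: ball_triangle hy; apply: ball_sym.
  have := ball_coord i bx; have /andP[a b] := kx i.
  rewrite ltr_norml -/(rad J) => /andP[h1 h2].
  by move: a b; rewrite -[k.+1%:R^-1]/(rad J) => a b; apply/andP; split; lra.
exists (pickle J); rewrite /c pickleK.
by have := hx (pickle J); rewrite pickleK; apply.
Unshelve. all: by end_near. Qed.

End local_constancy.

(** * Lebesgue spaces on the torus *)

Section lebesgue_spaces.
Context (R : realType) (d : nat).
Local Notation V := 'rV[R]_d.
Local Notation mu := (torus_measure R d).
Local Notation L1 := (summable_fun mu).
Implicit Types (x y : V) (u v w F : V -> R) (n : nat) (i : 'I_d) (p : R).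

Definition conjR p : R := p / (p - 1).

Lemma conjugateE p : 1 < p -> hoelder_conjugate p%:E = (conjR p)%:E.
Proof.
move=> p1; have p0 : p != 0 by rewrite gt_eqF// (lt_trans ltr01).
have p10 : p - 1 != 0 by rewrite gt_eqF// subr_gt0.
by rewrite /hoelder_conjugate/= eqe (negbTE p0) -EFinB inver (negbTE p10) -EFinM.
Qed.

Lemma conjR_gt1 p : 1 < p -> 1 < conjR p.
Proof.
by move=> p1; rewrite /conjR ltr_pdivlMr ?subr_gt0// mul1r ltrBlDr ltrDl.
Qed.

Lemma conjR_inv p : 1 < p -> p^-1 + (conjR p)^-1 = 1.
Proof.
move=> p1; have p0 : p != 0 by rewrite gt_eqF// (lt_trans ltr01).
by rewrite /conjR invf_div; field.
Qed.

Lemma LfunP_powR p v : 1 <= p ->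
  v \in Lfun mu p%:E <-> (measurable_fun setT v /\ L1 (fun x => `|v x| `^ p)).
Proof.
move=> p1; split=> [vp|[mv lv]].
  split; last exact: (Lfun_integrable p1 vp).
  by move: vp; rewrite inE => /andP[]; rewrite inE.
rewrite inE; apply/andP; split; rewrite inE//= /finite_norm unlock /Lnorm.
apply: poweR_lty; move/integrableP : lv => [_].
apply: le_lt_trans; rewrite le_eqVlt; apply/orP; left; apply/eqP.
by apply: eq_integral => x _; rewrite [RHS]gee0_abs ?lee_fin ?powR_ge0.
Qed.

Lemma torus_Lp_measurable (p : \bar R) v : torus_Lp p v -> measurable_fun setT v.
Proof. by move=> [_]; rewrite inE => /andP[]; rewrite inE. Qed.

Lemma torus_Lp_powR p v : 1 <= p -> torus_Lp p%:E v -> L1 (fun x => `|v x| `^ p).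
Proof. by move=> p1 [_ /(LfunP_powR _ p1)[]]. Qed.

Lemma torus_Lp_L1 p v : 1 <= p -> torus_Lp p%:E v -> L1 v.
Proof.
move=> p1 [_ vp]; apply/Lfun1_integrable.
apply: (@Lfun_subset _ _ _ mu 1%E p%:E _ _ _ _ _ vp) => //; rewrite ?lee_fin//.
exact: fin_num_measure.
Qed.

Lemma torus_LpL p v w (a b : R) : 1 <= p -> torus_Lp p%:E v -> torus_Lp p%:E w ->
  torus_Lp p%:E (fun x => a * v x + b * w x).
Proof.
move=> p1 [pv lv] [pw lw]; split => [i x|]; first by rewrite pv pw.
have p1' : (1 <= p%:E)%E by rewrite lee_fin.
rewrite -[X in X \in _]/((a \*o v) \+ (b \*o w)).
have lv' := Lfun_scale a p1 lv; have lw' := Lfun_scale b p1 lw.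
have -> : (a \*o v) \+ (b \*o w) = (a \o* v) \+ (b \o* w).
  by apply/funext => x /=; congr (_ + _); exact: mulrC.
exact: (Lfun_addr_closed mu p1').2 _ _ lv' lw'.
Qed.

Lemma torus_Lp_cst p (c : R) : torus_Lp p%:E (cst c : V -> R).
Proof. by split => //; exact: Lfun_cst. Qed.

Lemma torus_Lp_ae p v w : 1 <= p -> torus_Lp p%:E v -> torus_periodic w ->
  measurable_fun setT w -> {ae mu, forall x, w x = v x} -> torus_Lp p%:E w.
Proof.
move=> p1 [pv lv] pw mw wv; split => //; apply/LfunP_powR => //; split => //.
have [mv lvp] := (LfunP_powR v p1).1 lv.
have mabs (g : V -> R) : measurable_fun setT g -> measurable_fun setT (EFin \o (fun x => `|g x| `^ p)).
  by move=> mg; apply/measurable_EFinP; exact: measurable_abs_powR.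
apply/integrableP; split; first exact: mabs.
move/integrableP : lvp => [_]; apply: le_lt_trans.
apply: ae_ge0_le_integral => //.
- exact: (measurableT_comp (@abse_measurable R setT) (mabs w mw)).
- exact: (measurableT_comp (@abse_measurable R setT) (mabs v mv)).
- by apply: filterS wv => x /= -> _.
Qed.

Lemma torus_Lp_dominated p v w : 1 <= p -> torus_Lp p%:E v -> torus_periodic w ->
  measurable_fun setT w -> (forall x, `|w x| <= `|v x|) -> torus_Lp p%:E w.
Proof.
move=> p1 [pv lv] pw mw wv; split => //; apply/LfunP_powR => //; split => //.
have [mv lvp] := (LfunP_powR v p1).1 lv.
apply: (L1_le _ lvp); first exact: measurable_abs_powR.
move=> x; rewrite ger0_norm ?powR_ge0//; apply: ge0_ler_powR; rewrite ?nnegrE//.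
exact: le_trans p1.
Qed.

Lemma torus_Lp_pairing p v w : 1 < p -> torus_Lp p%:E v -> torus_Lp (conjR p)%:E w ->
  L1 (fun x => v x * w x).
Proof.
move=> p1 vp wp; have q1 := conjR_gt1 p1.
have p0 : 0 < p by exact: lt_trans p1.
have q0 : 0 < conjR p by exact: lt_trans q1.
have qp : (conjR p)^-1 + p^-1 = 1 by rewrite addrC conjR_inv.
have [c c0 hc] := young_eps q0 p0 qp ltr01.
apply: (L1_le _ (L1D (L1Z c (torus_Lp_powR (ltW p1) vp))
  (L1Z 1 (torus_Lp_powR (ltW q1) wp)))).
  by apply: measurable_funM; [exact: torus_Lp_measurable vp|exact: torus_Lp_measurable wp].
by move=> x; rewrite normrM; exact: hc.
Qed.

Lemma cvg_mollify_pairing p v w : 1 < p -> torus_Lp p%:E v -> torus_Lp (conjR p)%:E w ->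
  (\int[mu]_x (w x * mollify n v x)) @[n --> \oo] --> \int[mu]_x (w x * v x).
Proof.
move=> p1 vp wp; have q1 := conjR_gt1 p1.
apply: (mollify_pairing (p := p) (p' := conjR p)).
- exact: lt_trans p1.
- exact: lt_trans q1.
- exact: conjR_inv.
- exact: torus_Lp_L1 (ltW q1) wp.
- exact: torus_Lp_L1 (ltW p1) vp.
- exact: torus_Lp_powR (ltW q1) wp.
- exact: torus_Lp_powR (ltW p1) vp.
Qed.

Lemma conjRK p : 1 < p -> conjR (conjR p) = p.
Proof.
move=> p1; have p10 : p - 1 != 0 by rewrite gt_eqF// subr_gt0.
rewrite /conjR (_ : p / (p - 1) - 1 = (p - 1)^-1); first by rewrite invrK divfK.
by field.
Qed.

Lemma norm_pairing_le p v w : 1 < p -> torus_Lp p%:E v -> torus_Lp (conjR p)%:E w ->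
  (`|\int[mu]_x (v x * w x)|%:E <= torus_norm p%:E v * torus_norm (conjR p)%:E w)%E.
Proof.
move=> p1 vp wp; have q1 := conjR_gt1 p1.
have lvw := torus_Lp_pairing p1 vp wp.
have := @hoelder _ _ _ mu v w p (conjR p) (torus_Lp_measurable vp)
  (torus_Lp_measurable wp) (lt_trans ltr01 p1) (lt_trans ltr01 q1) (conjR_inv p1).
apply: le_trans; rewrite Lnorm1.
have := norm_Rint lvw; rewrite -lee_fin => /le_trans; apply.
rewrite /Rintegral fineK//; exact: (integrable_fin_num _ (L1_norm lvw)).
Qed.

End lebesgue_spaces.

(** * Sobolev spaces on the torus *)

Section sums.
Context d (T : measurableType d) (R : realType) (mu : probability T R).
Local Notation L1 := (summable_fun mu).

Lemma L1_sum (I : Type) (r : seq I) (f : I -> T -> R) : (forall i, L1 (f i)) ->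
  L1 (fun x => \sum_(i <- r) f i x).
Proof.
move=> lf; elim: r => [|i r IH].
  by under eq_fun do rewrite big_nil; exact: L1_cst.
by under eq_fun do rewrite big_cons; exact: L1D.
Qed.

Lemma Rint_sum (I : Type) (r : seq I) (f : I -> T -> R) : (forall i, L1 (f i)) ->
  \int[mu]_x (\sum_(i <- r) f i x) = \sum_(i <- r) \int[mu]_x f i x.
Proof.
move=> lf; elim: r => [|i r IH].
  by rewrite big_nil; under eq_Rintegral do rewrite big_nil; exact: Rint_cst1.
rewrite big_cons -IH -(RintegralD measurableT (lf i) (L1_sum r lf)).
by apply: eq_Rintegral => x _; rewrite big_cons.
Qed.

Lemma cvg_fsum (I : Type) (r : seq I) (a : I -> nat -> R) (l : I -> R) :
  (forall i, a i @ \oo --> l i) ->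
  (\sum_(i <- r) a i n) @[n --> \oo] --> \sum_(i <- r) l i.
Proof.
move=> al; elim: r => [|i r IH].
  rewrite big_nil (_ : (fun _ => _) = fun=> 0); first exact: cvg_cst.
  by apply/funext => n; rewrite big_nil.
rewrite big_cons (_ : (fun _ => _) = fun n => a i n + \sum_(j <- r) a j n).
  exact: cvgD.
by apply/funext => n; rewrite big_cons.
Qed.

End sums.

Section sobolev_space.
Context (R : realType) (d : nat) (s : R).
Local Notation V := 'rV[R]_d.
Local Notation mu := (torus_measure R d).
Local Notation L1 := (summable_fun mu).
Implicit Types (x y : V) (u v w z g : V -> R) (n : nat) (i : 'I_d).
Hypothesis s1 : 1 < s.
Let s1' : 1 <= s := ltW s1.

Lemma sobolev_L1 u : sobolev s u -> L1 u.
Proof. by move=> [lu _]; exact: torus_Lp_L1 lu. Qed.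

Lemma weak_partialP i u v : is_weak_partial i u v ->
  is_weak_partial i u (weak_partial i u).
Proof. by move=> h; exact: (@xgetPex _ (cst 0) [set v | is_weak_partial i u v] (ex_intro _ v h)). Qed.

(** The chosen representative is a weak derivative, and weak derivatives are unique
    up to a null set. *)
Lemma weak_partial_ae i u v : is_weak_partial i u v ->
  {ae mu, forall x, weak_partial i u x = v x}.
Proof. by move=> h; exact: is_weak_partial_unique (weak_partialP h) h. Qed.

Lemma sobolev_weak_partial i u : sobolev s u -> is_weak_partial i u (weak_partial i u).
Proof. by move=> [_ /(_ i)[v h _]]; exact: weak_partialP h. Qed.

Lemma sobolev_weak_partial_Lp i u : sobolev s u -> torus_Lp s%:E (weak_partial i u).
Proof.
move=> us; have wu := sobolev_weak_partial i us.
have [_ /(_ i)[v hv lv]] := us.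
apply: (torus_Lp_ae s1' lv); first by case: wu => -[].
  exact: torus_Lp_measurable wu.1.
exact: weak_partial_ae.
Qed.

Lemma sobolev_weak_partial_L1 i u : sobolev s u -> L1 (weak_partial i u).
Proof. by move=> us; exact: torus_Lp_L1 s1' (sobolev_weak_partial_Lp i us). Qed.

Lemma is_weak_partialL i u v u' v' (a b : R) : L1 u -> L1 u' ->
  is_weak_partial i u v -> is_weak_partial i u' v' ->
  is_weak_partial i (fun x => a * u x + b * u' x) (fun x => a * v x + b * v' x).
Proof.
move=> lu lu' [v1 hv] [v'1 hv']; split; first exact: torus_LpL.
have lv := torus_Lp1_L1 v1; have lv' := torus_Lp1_L1 v'1.
move=> phi tphi.
have lin f g psi : L1 f -> L1 g -> test_function psi ->
    \int[mu]_x ((a * f x + b * g x) * psi x) =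
    a * \int[mu]_x (f x * psi x) + b * \int[mu]_x (g x * psi x).
  move=> lf lg tpsi; have h1 := L1_test lf tpsi; have h2 := L1_test lg tpsi.
  rewrite -(RintegralZl a measurableT h1) -(RintegralZl b measurableT h2).
  rewrite -(RintegralD measurableT (L1Z a h1) (L1Z b h2)).
  by apply: eq_Rintegral => x _; ring.
have tg : test_function (fun x => grad phi x ord0 i).
  rewrite (_ : (fun _ => _) = 'D_(delta_mx ord0 i) phi); first exact: test_derive.
  by apply/funext => x; rewrite gradE.
by rewrite (lin u u' _ lu lu' tg) hv// hv'// (lin v v')//; ring.
Qed.

Lemma is_weak_partial_cst i (c : R) : is_weak_partial i (cst c : V -> R) (cst 0).
Proof.
split; first exact: torus_Lp_cst.
move=> phi tphi; have tg := test_derive (delta_mx ord0 i) tphi.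
under [in RHS]eq_Rintegral do rewrite mul0r.
rewrite Rint_cst1 oppr0 (RintegralZl c measurableT) /=; last first.
  under eq_fun do rewrite gradE; exact: test_L1.
under eq_Rintegral do rewrite gradE.
rewrite torus_int_derive ?mulr0//; first exact: tphi.1.
- by move=> x; exact: test_differentiable.
- exact: test_continuous.
Qed.

Lemma sobolevL u v (a b : R) : sobolev s u -> sobolev s v ->
  sobolev s (fun x => a * u x + b * v x).
Proof.
move=> us vs; split; first exact: (torus_LpL a b s1' us.1 vs.1).
move=> i; exists (fun x => a * weak_partial i u x + b * weak_partial i v x).
  apply: is_weak_partialL; [exact: sobolev_L1|exact: sobolev_L1| |];
  exact: sobolev_weak_partial.
by apply: torus_LpL => //; exact: sobolev_weak_partial_Lp.
Qed.

Lemma sobolev_cst (c : R) : sobolev s (cst c : V -> R).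
Proof.
split; first exact: torus_Lp_cst.
by move=> i; exists (cst 0); [exact: is_weak_partial_cst|exact: torus_Lp_cst].
Qed.

Lemma weak_partialL_ae i u v (a b : R) : sobolev s u -> sobolev s v ->
  {ae mu, forall x, weak_partial i (fun x => a * u x + b * v x) x =
    a * weak_partial i u x + b * weak_partial i v x}.
Proof.
move=> us vs; apply: weak_partial_ae.
by apply: is_weak_partialL; [exact: sobolev_L1|exact: sobolev_L1| |];
  exact: sobolev_weak_partial.
Qed.

(** Both G(z) and G'(z) Dz are dominated by affine images of functions in L^s. *)
Lemma sobolev_comp z (G G' : R -> R) (L K : R) : sobolev s z ->
  (forall t, is_derive t (1 : R) G (G' t)) ->
  (forall t, `|G' t| <= L) -> (forall a b, `|G' a - G' b| <= K * `|a - b|) ->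
  sobolev s (G \o z) /\
  forall i, is_weak_partial i (G \o z) (fun x => G' (z x) * weak_partial i z x).
Proof.
move=> zs dG G'L G'K.
have wz i : is_weak_partial i (G \o z) (fun x => G' (z x) * weak_partial i z x).
  apply: chain_rule G'L G'K => //; first exact: sobolev_L1.
    exact: sobolev_weak_partial.
  by case: zs.1.
have L0 : 0 <= L by exact: le_trans (G'L 0).
have [pz _] := zs.1; have mz := torus_Lp_measurable zs.1.
have mG : measurable_fun setT G.
  apply: continuous_measurable_fun => t; apply: differentiable_continuous.
  by apply/derivable1_diffP; case: (dG t).
have lipG := lipschitz_derive dG G'L.
split; last exact: wz.
split.
  have absz : torus_Lp s%:E (fun x => `|z x|).
    apply: (torus_Lp_dominated s1' zs.1).
    - by move=> i x; rewrite pz.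
    - exact: measurableT_comp.
    - by move=> x; rewrite normr_id.
  have dom := torus_LpL L 1 s1' absz (torus_Lp_cst d s `|G 0|).
  apply: (torus_Lp_dominated s1' dom).
  - by move=> i x /=; rewrite pz.
  - exact: measurableT_comp.
  - move=> x /=; rewrite mul1r [leRHS]ger0_norm ?addr_ge0 ?mulr_ge0//.
    rewrite -[G (z x)](subrK (G 0)); apply: le_trans (ler_normD _ _) _.
    by rewrite lerD2r; have := lipG (z x) 0; rewrite subr0.
move=> i; exists (fun x => G' (z x) * weak_partial i z x) => //.
have wLp := sobolev_weak_partial_Lp i zs.
have dom := torus_LpL L 0 s1' wLp wLp.
apply: (torus_Lp_dominated s1' dom).
- by case: (wz i) => -[].
- exact: torus_Lp_measurable (wz i).1.
- move=> x; rewrite mul0r addr0 !normrM [`|L|]ger0_norm//.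
  exact: ler_wpM2r.
Qed.

Lemma grad_mollify n u x i : sobolev s u ->
  grad (mollify n u) x ord0 i = mollify n (weak_partial i u) x.
Proof.
move=> us; rewrite gradE; apply: mollify_weak_partial; first exact: sobolev_L1.
exact: sobolev_weak_partial.
Qed.

Lemma L1_dotv_grad (F : V -> V) u : sobolev s u ->
  (forall i, torus_Lp (conjR s)%:E (fun x => F x ord0 i)) ->
  L1 (fun x => dotv (F x) (weak_grad u x)).
Proof.
move=> us hF; apply: L1_sum => i.
under eq_fun do rewrite mxE mulrC.
exact: torus_Lp_pairing s1 (sobolev_weak_partial_Lp i us) (hF i).
Qed.

(** The equation holds for the mollifications of u, which are test functions; they
    and their gradients converge to u and Du in every duality pairing. *)
Lemma weak_eq_sobolev (q a b : R) g (F : V -> V) u : 1 < q ->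
  torus_Lp q%:E g -> (forall i, torus_Lp (conjR s)%:E (fun x => F x ord0 i)) ->
  sobolev s u -> torus_Lp (conjR q)%:E u ->
  (forall phi, test_function phi ->
     a * \int[mu]_x (g x * phi x) + \int[mu]_x dotv (F x) (grad phi x) =
     b * \int[mu]_x phi x) ->
  a * \int[mu]_x (g x * u x) + \int[mu]_x dotv (F x) (weak_grad u x) =
  b * \int[mu]_x u x.
Proof.
move=> q1 gq hF us uq h.
have lu := sobolev_L1 us.
have s'1 := conjR_gt1 s1; have q'1 := conjR_gt1 q1.
have c1 : (\int[mu]_x (g x * mollify n u x)) @[n --> \oo] --> \int[mu]_x (g x * u x).
  by apply: (cvg_mollify_pairing q'1 uq); rewrite conjRK.
have lFT n i : L1 (fun x => F x ord0 i * mollify n (weak_partial i u) x).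
  apply: L1_test; first exact: torus_Lp_L1 (ltW s'1) (hF i).
  exact: mollify_test (sobolev_weak_partial_L1 i us).
have lFu i : L1 (fun x => F x ord0 i * weak_partial i u x).
  under eq_fun do rewrite mulrC.
  exact: torus_Lp_pairing s1 (sobolev_weak_partial_Lp i us) (hF i).
have c2 : (\int[mu]_x dotv (F x) (grad (mollify n u) x)) @[n --> \oo] -->
    \int[mu]_x dotv (F x) (weak_grad u x).
  rewrite (_ : (fun n => _) = fun n =>
    \sum_i \int[mu]_x (F x ord0 i * mollify n (weak_partial i u) x)); last first.
    apply/funext => n; rewrite -(Rint_sum _ (lFT n)); apply: eq_Rintegral => x _.
    by apply: eq_bigr => i _; rewrite grad_mollify.
  rewrite (_ : \int[mu]_x _ = \sum_i \int[mu]_x (F x ord0 i * weak_partial i u x)); last first.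
    rewrite -(Rint_sum _ lFu); apply: eq_Rintegral => x _.
    by apply: eq_bigr => i _; rewrite mxE.
  apply: cvg_fsum => i.
  exact: (cvg_mollify_pairing s1 (sobolev_weak_partial_Lp i us) (hF i)).
have c3 : (fun n => a * \int[mu]_x (g x * mollify n u x) +
    \int[mu]_x dotv (F x) (grad (mollify n u) x)) @ \oo -->
    (a * \int[mu]_x (g x * u x) + \int[mu]_x dotv (F x) (weak_grad u x) : R).
  by apply: cvgD => //; exact: cvgMl_tmp.
move: c3; rewrite (_ : (fun n => _ + _) = fun=> b * \int[mu]_x u x); last first.
  by apply/funext => n; rewrite h ?int_mollify//; exact: mollify_test.
by move=> c3; exact: (cvg_unique (@norm_hausdorff _ R) c3 (cvg_cst _)).
Qed.

End sobolev_space.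

(** * The Hamiltonian *)

Section hamiltonian.
Context (R : realType) (d : nat).
Local Notation V := 'rV[R]_d.
Variable H : V -> V -> R.
Hypothesis HC1 : class_C 1 (fun z : V * V => H z.1 z.2).
Hypothesis Hcvx : forall x, strictly_convex (H x).
Hypothesis Hmin : forall x p, H x 0 <= H x p.

Lemma hamiltonian_differentiable x p : differentiable (H x) p.
Proof.
have dp : differentiable (fun q : V => (x, q)) p.
  by apply: differentiable_pair; [exact: differentiable_cst|exact: ex_diff].
exact: (differentiable_comp dp (HC1.1 (x, p))).
Qed.

(** Seeing D_p H as a directional derivative of the C^1 function (x, p) |-> H x p
    shows its joint continuity. *)
Lemma hamiltonian_gradE x p i :
  grad (H x) p ord0 i = 'D_(0, delta_mx ord0 i) (fun z : V * V => H z.1 z.2) (x, p).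
Proof.
rewrite gradE /derive; set Q := (fun h : R => h^-1 *: ((_ \o shift (x, p)) _ - _)).
rewrite (_ : (fun h => _) = Q)//; apply/funext => h.
by rewrite /Q /= scaler0 add0r.
Qed.

Lemma measurable_grad_hamiltonian (w : V -> V) i :
  (forall j, measurable_fun setT (fun x => w x ord0 j)) ->
  measurable_fun setT (fun x => grad (H x) (w x) ord0 i).
Proof.
move=> mw; under eq_fun do rewrite hamiltonian_gradE.
apply: (@measurable_comp_continuous2 _ _ _
  ('D_(0, delta_mx ord0 i) (fun z : V * V => H z.1 z.2))) => //.
exact: HC1.2.
Qed.

Lemma hamiltonian_continuous0 : continuous (fun x => H x 0).
Proof.
move=> x; have cp : {for x, continuous (fun y : V => (y, 0 : V))}.
  apply: differentiable_continuous.
  by apply: differentiable_pair; [exact: ex_diff|exact: differentiable_cst].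
exact: (continuous_comp cp (class_C_continuous HC1 (x := (x, 0)))).
Qed.

Lemma dotv_grad x p v : dotv (grad (H x) p) v = 'D_v (H x) p.
Proof.
rewrite (derive_sum_coord v (hamiltonian_differentiable x p)).
by apply: eq_bigr => i _; rewrite gradE mulrC.
Qed.

Lemma hamiltonian_convex x p p' (t : R) : 0 <= t <= 1 ->
  H x (t *: p + (1 - t) *: p') <= t * H x p + (1 - t) * H x p'.
Proof.
move=> /andP[]; rewrite le_eqVlt => /predU1P[<- _|t0].
  by rewrite scale0r mul0r !add0r subr0 scale1r mul1r.
rewrite le_eqVlt => /predU1P[->|t1].
  by rewrite subrr scale0r scale1r mul0r mul1r !addr0.
have [->|pp'] := eqVneq p p'.
  by rewrite -scalerDl -mulrDl addrC subrK scale1r mul1r.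
by apply: ltW; apply: Hcvx => //; rewrite t0 t1.
Qed.

(** Convexity bounds the difference quotients of H x at p in the direction p' - p
    by H x p' - H x p. *)
Lemma hamiltonian_first_order x p p' :
  H x p + dotv (grad (H x) p) (p' - p) <= H x p'.
Proof.
rewrite dotv_grad -lerBrDl leNgt; apply/negP => lt.
pose v := p' - p.
pose Q (h : R) := h^-1 *: ((H x \o shift p) (h *: v) - H x p).
have cQ : Q @ 0^' --> ('D_v (H x) p : R).
  by have := diff_derivable (v := v) (hamiltonian_differentiable x p).
have : \forall h \near (0 : R)^'+, [/\ 0 < h, h < 1 & H x p' - H x p < Q h].
  near=> h; split.
  - by near: h; exact: nbhs_right_gt.
  - by near: h; exact: nbhs_right_lt.
  - near: h; apply: cvgr_gt lt.
    exact: cvg_dnbhs_at_right.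
move=> /filter_ex[h [h0 h1]]; rewrite ltNge => /negP; apply.
rewrite /Q /GRing.scale/= ler_pdivrMl//.
rewrite (_ : h *: v + p = h *: p' + (1 - h) *: p); last first.
  by rewrite /v scalerBr scalerBl scale1r -addrA [- _ + _]addrC.
have := @hamiltonian_convex x p' p h; rewrite (ltW h0) (ltW h1) => /(_ isT).
lra.
Unshelve. all: by end_near. Qed.

Lemma hamiltonian_grad_min x : grad (H x) 0 = 0.
Proof.
apply/rowP => i; rewrite gradE mxE.
pose e : V := delta_mx ord0 i; pose f (t : R) := H x (0 + t *: e).
have df t : is_derive t (1 : R) f ('D_e (H x) (0 + t *: e)).
  exact: is_derive_line (hamiltonian_differentiable x _).
have : is_derive (0 : R) (1 : R) f 0.
  apply: (@derive1_at_min R f (-1) 1 0).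
  - lra.
  - by move=> t _; case: (df t).
  - by rewrite in_itv/= ltrN10 ltr01.
  - by move=> t _; rewrite /f scale0r addr0; exact: Hmin.
move=> /@derive_val <-; have [_ ->] := df 0.
by rewrite scale0r addr0.
Qed.

(** Strict convexity leaves room for only one minimiser; the midpoint of p and 0
    would otherwise lie below the minimum. *)
Lemma hamiltonian_argmin x p : H x p <= H x 0 -> p = 0.
Proof.
move=> Hp; apply/eqP/negPn/negP => p0.
have h2 : 0 < (2^-1 : R) < 1 by apply/andP; split; lra.
have := Hcvx x p0 h2; have := Hmin x (2^-1 *: p + (1 - 2^-1) *: 0).
lra.
Qed.

End hamiltonian.

(** * Level sets of a function with a weak derivative *)

Section spike.
Context (R : realType).
Implicit Types (t a k : R).

(** The derivative of the arctangent. Rescaled around a, it tends to the indicator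
    of {a} while its primitive tends uniformly to 0. *)
Definition cauchy t : R := (1 + t ^+ 2)^-1.
Definition dcauchy t : R := - (2 * t * cauchy t ^+ 2).

Lemma cauchy_den t : 0 < 1 + t ^+ 2.
Proof. by rewrite ltr_pwDl// sqr_ge0. Qed.

Lemma cauchy_gt0 t : 0 < cauchy t.
Proof. by rewrite invr_gt0 cauchy_den. Qed.

Lemma cauchy_le1 t : cauchy t <= 1.
Proof. by rewrite invf_le1 ?cauchy_den// lerDl sqr_ge0. Qed.

Lemma is_derive_cauchy t : is_derive t (1 : R) cauchy (dcauchy t).
Proof.
have d1 : is_derive t (1 : R) (fun t : R => 1 + t ^+ 2) (2 * t).
  by apply: is_derive_eq; rewrite /GRing.scale/=; ring.
have [e1 e2] := d1; have n0 := lt0r_neq0 (cauchy_den t).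
pose f (t : R) := 1 + t ^+ 2.
have h : 'D_1 (fun y => (f y)^-1) t = - (f t) ^- 2 *: 'D_1 f t by exact: deriveV.
rewrite [X in _ *: X]e2 in h.
have -> : dcauchy t = - (1 + t ^+ 2) ^- 2 * (2 * t).
  rewrite /dcauchy /cauchy; move: (1 + t ^+ 2) => D.
  rewrite exprVn.
  ring.
apply: DeriveDef h; exact: (@derivableV _ _ f).
Qed.

Lemma double_cauchy_le1 t : `|2 * t * cauchy t| <= 1.
Proof.
rewrite normrM [`|cauchy t|]gtr0_norm ?cauchy_gt0// /cauchy.
rewrite ler_pdivrMr ?cauchy_den// mul1r normrM [`|2|]ger0_norm//.
rewrite -[t ^+ 2]real_normK ?num_real//.
by rewrite -subr_ge0 (_ : _ - _ = (1 - `|t|) ^+ 2) ?sqr_ge0//; ring.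
Qed.

Lemma dcauchy_le1 t : `|dcauchy t| <= 1.
Proof.
rewrite /dcauchy normrN expr2 mulrA normrM -[leRHS]mulr1; apply: ler_pM => //.
  exact: double_cauchy_le1.
by rewrite ger0_norm ?cauchy_le1// ltW// cauchy_gt0.
Qed.

Lemma dcauchy_lipschitz a b : `|dcauchy a - dcauchy b| <= 4 * `|a - b|.
Proof.
pose D t : R := - (2 * cauchy t ^+ 2 + 2 * (2 * t * cauchy t) * dcauchy t).
apply: (lipschitz_derive (G' := D)) => t.
  have d0 := is_derive_cauchy t.
  by rewrite /dcauchy; apply: is_derive_eq; rewrite /D /GRing.scale/=; ring.
rewrite /D normrN; apply: le_trans (ler_normD _ _) _.
have c0 := cauchy_gt0 t; have c1 := cauchy_le1 t.
have h1 : `|2 * cauchy t ^+ 2| <= 2.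
  rewrite normrM [`|2|]ger0_norm// -[leRHS]mulr1 ler_wpM2l//.
  rewrite ger0_norm; last by apply: exprn_ge0; exact: ltW.
  by apply: exprn_ile1 => //; exact: ltW.
have h2 : `|2 * (2 * t * cauchy t) * dcauchy t| <= 2.
  rewrite -mulrA normrM [`|2|]ger0_norm// -[leRHS]mulr1 ler_wpM2l// normrM.
  by rewrite -[leRHS]mulr1; apply: ler_pM => //; [exact: double_cauchy_le1|exact: dcauchy_le1].
lra.
Qed.

Definition spike k a t : R := cauchy (k * (t - a)).
Definition dspike k a t : R := k * dcauchy (k * (t - a)).
Definition ramp k a t : R := k^-1 * atan (k * (t - a)).

Lemma is_derive_affine k a t : is_derive t (1 : R) (fun t => k * (t - a)) k.
Proof. by apply: is_derive_eq; rewrite /GRing.scale/=; ring. Qed.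

Lemma is_derive_spike k a t : is_derive t (1 : R) (spike k a) (dspike k a t).
Proof.
have d1 := is_derive_affine k a t.
have d2 := is_derive_cauchy (k * (t - a)).
by rewrite /dspike mulrC; exact: (@is_derive1_comp _ cauchy (fun t => k * (t - a))).
Qed.

Lemma is_derive_ramp k a t : k != 0 -> is_derive t (1 : R) (ramp k a) (spike k a t).
Proof.
move=> k0; have d1 := is_derive_affine k a t.
have d2 := is_derive1_atan (k * (t - a)).
have d3 := @is_derive1_comp _ (@atan R) (fun t => k * (t - a)) t _ _ d2 d1.
rewrite /ramp; apply: (@is_derive_eq _ _ _ (k^-1 \*: (@atan R \o (fun t => k * (t - a))))).
rewrite /GRing.scale/= /spike /cauchy.
by rewrite mulrCA mulVf// mulr1.
Qed.

Lemma spike_bound k a t : 0 <= spike k a t <= 1.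
Proof. by rewrite ltW ?cauchy_gt0 ?cauchy_le1. Qed.

Lemma dspike_bound k a t : 0 < k -> `|dspike k a t| <= k.
Proof.
move=> k0; rewrite /dspike normrM [`|k|]gtr0_norm// -[leRHS]mulr1.
by rewrite ler_pM2l// dcauchy_le1.
Qed.

Lemma dspike_lipschitz k a t t' : 0 < k ->
  `|dspike k a t - dspike k a t'| <= 4 * k ^+ 2 * `|t - t'|.
Proof.
move=> k0; rewrite /dspike -mulrBr normrM [`|k|]gtr0_norm//.
apply: le_trans (ler_wpM2l (ltW k0) (dcauchy_lipschitz _ _)) _.
rewrite (_ : _ - _ = k * (t - t')); last by ring.
rewrite normrM [`|k|]gtr0_norm// le_eqVlt; apply/orP; left; apply/eqP; ring.
Qed.

Lemma spike_lipschitz k a t t' : 0 < k -> `|spike k a t - spike k a t'| <= k * `|t - t'|.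
Proof.
move=> k0; apply: (lipschitz_derive (G' := dspike k a)); first exact: is_derive_spike.
by move=> r; exact: dspike_bound.
Qed.

Lemma ramp_bound k a t : 0 < k -> `|ramp k a t| <= k^-1 * (pi / 2).
Proof.
move=> k0; rewrite /ramp normrM [`|k^-1|]gtr0_norm ?invr_gt0//.
rewrite ler_pM2l ?invr_gt0// ler_norml.
by rewrite ltW ?atan_gtNpi2//= ltW// atan_ltpi2.
Qed.

Lemma spike_cvg a t : spike k.+1%:R a t @[k --> \oo] --> ((t == a)%:R : R).
Proof.
have [->|ta] := eqVneq t a.
  rewrite (_ : (fun k : nat => spike k.+1%:R a a) = fun=> 1); first exact: cvg_cst.
  by apply/funext => k; rewrite /spike subrr mulr0 /cauchy expr0n addr0 invr1.
have ta0 : 0 < (t - a) ^+ 2 by rewrite exprn_even_gt0//= subr_eq0.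
rewrite mulr0n.
apply: (@squeeze_cvgr _ _ _ _ (fun=> 0) (fun k : nat => ((t - a) ^+ 2)^-1 * k.+1%:R^-1)).
- apply: nearW => k; have /andP[-> _] /= := spike_bound k.+1%:R a t.
  have p0 : 0 < (t - a) ^+ 2 * k.+1%:R by rewrite mulr_gt0.
  rewrite /spike /cauchy -invfM lef_pV2 ?posrE ?cauchy_den//.
  rewrite exprMn mulrC; apply: le_trans (_ : k.+1%:R ^+ 2 * (t - a) ^+ 2 <= _).
    by apply: ler_wpM2r; [exact: ltW|rewrite expr2 ler_peMl// ler1n].
  by rewrite lerDr.
- exact: cvg_cst.
- rewrite -[X in _ --> X](mulr0 ((t - a) ^+ 2)^-1).
  by apply: (cvgMl_tmp (g := @harmonic R)); exact: cvg_harmonic.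
Qed.

End spike.

Section level_sets.
Context (R : realType) (d : nat).
Local Notation V := 'rV[R]_d.
Local Notation mu := (torus_measure R d).
Local Notation L1 := (summable_fun mu).
Implicit Types (x y : V) (z w g : V -> R) (a : R).

Lemma measurable_level z a : measurable_fun setT z ->
  measurable_fun setT (fun x => ((z x == a)%:R : R)).
Proof.
move=> mz; rewrite (_ : (fun _ => _) = \1_(z @^-1` [set a])).
  apply: measurable_indic; rewrite -[X in measurable X]setTI.
  by apply: mz => //; exact: measurable_set1.
apply/funext => x; rewrite indicE; congr (_%:R); congr nat_of_bool.
by apply/eqP/idP => [za|]; rewrite inE.
Qed.

Lemma int_spike_cvg z g a : measurable_fun setT z -> L1 g ->
  (\int[mu]_x (spike k.+1%:R a (z x) * g x)) @[k --> \oo] -->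
  \int[mu]_x ((z x == a)%:R * g x).
Proof.
move=> mz lg; have mg := L1_measurable lg.
have mspike k : measurable_fun setT (fun x => spike k.+1%:R a (z x)).
  apply: (measurableT_comp (f := spike k.+1%:R a)) => //.
  apply: continuous_measurable_fun => t; apply: differentiable_continuous.
  by apply/derivable1_diffP; case: (is_derive_spike k.+1%:R a t).
apply: (Rint_dct _ _ (L1_norm lg)).
- by move=> k; exact: measurable_funM.
- by apply: measurable_funM => //; exact: measurable_level.
- move=> k x; have /andP[h0 h1] := spike_bound k.+1%:R a (z x).
  by rewrite normrM ger0_norm// ler_piMl.
- by apply: aeW => x; apply: cvgMr_tmp; exact: spike_cvg.
Qed.

(** By the chain rule, the spike at a of z, times w, is the weak derivative of the
    ramp of z, which is O(1/k). In the limit, w restricted to the level set is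
    orthogonal to all test functions. *)
Lemma weak_partial_level_set i z w a : L1 z -> torus_periodic z ->
  is_weak_partial i z w -> {ae mu, forall x, z x = a -> w x = 0}.
Proof.
move=> lz pz zw; have lw := torus_Lp1_L1 zw.1; have mz := L1_measurable lz.
have lzw : L1 (fun x => (z x == a)%:R * w x).
  apply: (L1_le _ (L1_norm lw)).
    by apply: measurable_funM; [exact: measurable_level|exact: L1_measurable lw].
  by move=> x; case: eqP => _; rewrite ?mul1r ?mul0r ?normr0.
suff : {ae mu, forall x, (z x == a)%:R * w x = 0}.
  by apply: filterS => x + /eqP za; rewrite za mul1r.
apply: test_orthogonal_ae0 => // phi tphi.
have k0 (k : nat) : 0 < k.+1%:R :> R by [].
have tphi' : test_function (fun x => grad phi x ord0 i).
  rewrite (_ : (fun _ => _) = 'D_(delta_mx ord0 i) phi); first exact: test_derive.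
  by apply/funext => x; rewrite gradE.
have [M M0 phiM] := test_bounded tphi'.
have ibp k : \int[mu]_x (spike k.+1%:R a (z x) * (w x * phi x)) =
    - \int[mu]_x (ramp k.+1%:R a (z x) * grad phi x ord0 i).
  have dr t := is_derive_ramp a t (lt0r_neq0 (k0 k)).
  have b1 t : `|spike k.+1%:R a t| <= 1.
    by have /andP[h0 h1] := spike_bound k.+1%:R a t; rewrite ger0_norm.
  have lip t t' := spike_lipschitz a t t' (k0 k).
  have [_ /(_ _ tphi) ->] := chain_rule lz zw pz dr b1 lip.
  by rewrite opprK; apply: eq_Rintegral => x _; rewrite mulrA.
have c1 := @int_spike_cvg z (fun x => w x * phi x) a mz (L1_test lw tphi).
have c2 : (\int[mu]_x (spike k.+1%:R a (z x) * (w x * phi x))) @[k --> \oo] --> (0 : R).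
  rewrite (_ : (fun k => _) = fun k =>
    - \int[mu]_x (ramp k.+1%:R a (z x) * grad phi x ord0 i)); last exact/funext.
  rewrite -[X in _ --> X]oppr0; apply: cvgN.
  apply/norm_cvg0P.
  apply: (@squeeze_cvgr _ _ _ _ (fun=> 0) (fun k => (pi / 2 * M) * k.+1%:R^-1)).
  - apply: nearW => k; rewrite normr_ge0/=.
    have lr : L1 (fun x => ramp k.+1%:R a (z x) * grad phi x ord0 i).
      apply: (L1_test _ tphi'); apply: (@L1_bounded _ _ _ mu _ (k.+1%:R^-1 * (pi / 2))).
        apply: (measurableT_comp (f := ramp k.+1%:R a)) => //.
        apply: continuous_measurable_fun => t; apply: differentiable_continuous.
        by apply/derivable1_diffP; case: (is_derive_ramp a t (lt0r_neq0 (k0 k))).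
      by move=> x; exact: ramp_bound.
    apply: le_trans (norm_Rint lr) _.
    rewrite -[leRHS](Rint_cst1 mu); apply: (le_Rintegral measurableT (L1_norm lr)).
      exact: L1_cst.
    move=> x _; rewrite normrM [leRHS]mulrC mulrA; apply: ler_pM => //.
    exact: ramp_bound.
  - exact: cvg_cst.
  - rewrite -[X in _ --> X](mulr0 (pi / 2 * M)).
    by apply: (cvgMl_tmp (g := @harmonic R)); exact: cvg_harmonic.
rewrite -(cvg_unique (@norm_hausdorff _ R) c1 c2).
by apply: eq_Rintegral => x _; rewrite mulrA.
Qed.

End level_sets.

(** * The structure of ergodic solutions *)

Section dot_product.
Context (R : realType) (d : nat).
Implicit Types a b c : 'rV[R]_d.

Lemma dotvZl (t : R) a b : dotv (t *: a) b = t * dotv a b.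
Proof. by rewrite /dotv mulr_sumr; apply: eq_bigr => i _; rewrite mxE mulrA. Qed.

Lemma dotv0l a : dotv 0 a = 0.
Proof. by rewrite /dotv big1// => i _; rewrite mxE mul0r. Qed.

Lemma dotvBr a b c : dotv a (b - c) = dotv a b - dotv a c.
Proof.
rewrite /dotv -sumrN -big_split/=; apply: eq_bigr => i _.
by rewrite !mxE mulrDr mulrN.
Qed.

Lemma dotvNr a b : dotv a (- b) = - dotv a b.
Proof. by rewrite /dotv -sumrN; apply: eq_bigr => i _; rewrite mxE mulrN. Qed.

End dot_product.

Section ergodic.
Context (R : realType) (d : nat) (s q : R).
Local Notation V := 'rV[R]_d.
Local Notation mu := (torus_measure R d).
Local Notation L1 := (summable_fun mu).
Variables (H : V -> V -> R) (f : V -> R -> R).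
Hypothesis s1 : 1 < s.
Hypothesis q1 : 1 < q.
Hypothesis embedding : @sobolev_embedding R d s (hoelder_conjugate q%:E).
Hypothesis Hper : torus_periodic H.
Hypothesis HC1 : class_C 1 (fun z : V * V => H z.1 z.2).
Hypothesis Hcvx : forall x, strictly_convex (H x).
Hypothesis Hmin : forall x p, H x 0 <= H x p.
Hypothesis fmono : forall x r1 r2, 0 <= r1 -> r1 < r2 -> f x r1 < f x r2.
Implicit Types (u v w z m : V -> R) (x : V) (lam : R).

Lemma sobolev_Lq u : sobolev s u -> torus_Lp (conjR q)%:E u.
Proof. by have [C hC] := embedding => /hC[]; rewrite conjugateE. Qed.

Lemma flux_Lp u m : admissible s q H u m ->
  forall i, torus_Lp (conjR s)%:E (fun x => flux H u m x ord0 i).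
Proof. by case=> _ _ _ _ h i; rewrite -conjugateE. Qed.

(** Testing the stationary transport equation with u itself gives that the integral
    of m D_p H(x, Du) . Du vanishes. By convexity, and since 0 minimises H x, the
    integrand is at least m (H(x, Du) - H(x, 0)) >= 0. So Du minimises H x where
    m > 0, and the minimiser is unique. *)
Lemma weak_grad_flat u m lam : ergodic_solution s q H f u m lam ->
  {ae mu, forall x, 0 < m x -> weak_grad u x = 0}.
Proof.
move=> [adm _ _ div]; have [us mq m0 _ _] := adm.
have lF := flux_Lp adm.
have weq phi : test_function phi ->
    0 * \int[mu]_x (m x * phi x) + \int[mu]_x dotv (flux H u m x) (grad phi x) =
    0 * \int[mu]_x phi x.
  by move=> /div; rewrite /divergence opprK !mul0r add0r.
have := weak_eq_sobolev s1 q1 mq lF us (sobolev_Lq us) weq.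
rewrite !mul0r add0r => int0.
have pos x : H x (weak_grad u x) - H x 0 <=
    dotv (grad (H x) (weak_grad u x)) (weak_grad u x).
  have := hamiltonian_first_order HC1 Hcvx x (weak_grad u x) 0.
  by rewrite sub0r dotvNr => h; rewrite lerBlDl -lerBlDr.
have := Rint_ge0_eq0_ae (L1_dotv_grad s1 us lF) _ int0.
move=> /(_ _)/wrap[].
  apply: filterS m0 => x mx0; rewrite dotvZl mulr_ge0//.
  by apply: le_trans (pos x); rewrite subr_ge0.
apply: filterS => x + mx0; rewrite dotvZl => /eqP.
rewrite mulf_eq0 gt_eqF//= => /eqP g0.
apply: (hamiltonian_argmin Hcvx Hmin (x := x)).
by rewrite -subr_le0 -g0.
Qed.

(** What an ergodic solution imposes on (m, lam) alone, the gradient of u being 0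
    where m > 0. *)
Definition ergodic_density m lam := [/\ torus_Lp q%:E m,
  {ae mu, forall x, 0 <= m x}, \int[mu]_x m x = 1,
  {ae mu, forall x, H x 0 <= f x (m x) + lam} &
  {ae mu, forall x, 0 < m x -> H x 0 = f x (m x) + lam}].

(** Where m > 0 the gradient is 0, and elsewhere the flux is 0 anyway; hence the
    transport equation is automatic and only an inequality constrains u. This is
    where the convexity of the set of solutions comes from. *)
Lemma ergodic_solutionP u m lam : ergodic_solution s q H f u m lam <->
  [/\ sobolev s u, ergodic_density m lam &
      {ae mu, forall x, H x (weak_grad u x) <= f x (m x) + lam}].
Proof.
split=> [sol|[us [mq m0 m1 _ eq0] le]].
  have [[us mq m0 m1 _] le eq _] := sol; split=> //; split=> //.
    by apply: filterS le => x; apply: le_trans.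
  by apply: filterS2 (weak_grad_flat sol) eq => x + + mx => /(_ mx) -> /(_ mx).
have flat : {ae mu, forall x, 0 < m x -> weak_grad u x = 0}.
  apply: filterS2 le eq0 => x + h mx; rewrite -(h mx).
  exact: hamiltonian_argmin.
have flux0 : {ae mu, forall x, flux H u m x = 0}.
  apply: filterS2 m0 flat => x; rewrite le_eqVlt => /predU1P[mx0 _|mx /(_ mx) h].
    by rewrite /flux -mx0 scale0r.
  by rewrite /flux h (hamiltonian_grad_min HC1 Hmin) scaler0.
have mDu j : measurable_fun setT (fun x => weak_grad u x ord0 j).
  under eq_fun do rewrite mxE.
  exact: torus_Lp_measurable (sobolev_weak_partial_Lp s1 j us).
have pDu : torus_periodic (weak_grad u).
  move=> i x; apply/rowP => j; rewrite !mxE.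
  exact: (sobolev_weak_partial_Lp s1 j us).1.
have mflux i : measurable_fun setT (fun x => flux H u m x ord0 i).
  under eq_fun do rewrite mxE.
  apply: measurable_funM; first exact: torus_Lp_measurable mq.
  exact: measurable_grad_hamiltonian.
split=> //.
- split=> // i; rewrite conjugateE//.
  apply: (torus_Lp_ae (v := cst 0)) => //.
  + exact/ltW/conjR_gt1.
  + exact: torus_Lp_cst.
  + by move=> j x; rewrite /flux mq.1 Hper pDu.
  + by apply: filterS flux0 => x ->; rewrite mxE.
- by apply: filterS2 flat eq0 => x + + mx => /(_ mx) -> /(_ mx).
- move=> phi tphi; rewrite /divergence opprK.
  rewrite -[RHS](Rint_cst1 mu); apply: Rint_ae_eq.
  + apply: measurable_sum => i; apply: measurable_funM => //.
    under eq_fun do rewrite gradE.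
    exact: test_measurable (test_derive _ tphi).
  + exact: measurable_cst.
  + by apply: filterS flux0 => x ->; rewrite dotv0l.
Qed.

(** Where m2 > 0, the conditions give f x (m2 x) + l2 <= f x (m1 x) + l1. So if
    l1 <= l2, then m2 <= m1 almost everywhere because f is increasing; both
    densities have mass 1, hence agree, and then l1 < l2 is impossible. *)
Lemma ergodic_density_le m1 m2 l1 l2 : ergodic_density m1 l1 -> ergodic_density m2 l2 ->
  l1 <= l2 -> {ae mu, forall x, m1 x = m2 x} /\ l1 = l2.
Proof.
move=> [m1q m10 m11 le1 eq1] [m2q m20 m21 le2 eq2] l12.
have lm1 := torus_Lp_L1 (ltW q1) m1q; have lm2 := torus_Lp_L1 (ltW q1) m2q.
have fle x : 0 <= m1 x -> 0 < m2 x -> f x (m2 x) <= f x (m1 x) -> m2 x <= m1 x.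
  move=> m1x m2x h; rewrite leNgt; apply/negP => /(fmono x m1x).
  by rewrite ltNge h.
have m21le : {ae mu, forall x, 0 <= m1 x - m2 x}.
  apply: filterS2 (filterI m10 m20) (filterI le1 eq2) => x [m1x m2x] [h1 h2].
  rewrite subr_ge0; move: m2x; rewrite le_eqVlt => /predU1P[<-//|m2x].
  by apply: fle => //; have := h2 m2x; lra.
have : {ae mu, forall x, m1 x - m2 x = 0}.
  apply: Rint_ge0_eq0_ae => //; first exact: L1B.
  by rewrite (RintegralB measurableT lm1 lm2) m11 m21 subrr.
move=> m12; split; first by apply: filterS m12 => x /eqP; rewrite subr_eq0 => /eqP.
apply/eqP; rewrite eq_le l12/= leNgt; apply/negP => lt12.
have m2e0 : {ae mu, forall x, m2 x = 0}.
  apply: filterS2 (filterI m12 m20) (filterI le1 eq2) => x [m1x m2x] [h1 h2].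
  apply/eqP; rewrite eq_le m2x andbT leNgt; apply/negP => m2x0.
  have := h2 m2x0; move: h1; rewrite (_ : m1 x = m2 x); last by apply/eqP; rewrite -subr_eq0 m1x.
  lra.
have := Rint_ae_eq (L1_measurable lm2) (measurable_cst _) m2e0.
by rewrite m21 Rint_cst1 => /eqP; rewrite oner_eq0.
Qed.

Lemma ergodic_density_uniq m1 m2 l1 l2 : ergodic_density m1 l1 -> ergodic_density m2 l2 ->
  {ae mu, forall x, m1 x = m2 x} /\ l1 = l2.
Proof.
move=> h1 h2; have [/(ergodic_density_le h1 h2)//|/ltW] := leP l1 l2.
by move=> /(ergodic_density_le h2 h1)[h ->]; split=> //; apply: filterS h => x ->.
Qed.

End ergodic.

(** * First variation of the selection functional *)

Section selection.
Context (R : realType) (d : nat) (s q : R).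
Local Notation V := 'rV[R]_d.
Local Notation mu := (torus_measure R d).
Local Notation L1 := (summable_fun mu).
Variables (H : V -> V -> R) (f : V -> R -> R).
Hypothesis s1 : 1 < s.
Hypothesis q1 : 1 < q.
Hypothesis embedding : @sobolev_embedding R d s (hoelder_conjugate q%:E).
Hypothesis Hper : torus_periodic H.
Hypothesis HC1 : class_C 1 (fun z : V * V => H z.1 z.2).
Hypothesis Hcvx : forall x, strictly_convex (H x).
Hypothesis Hmin : forall x p, H x 0 <= H x p.
Implicit Types (u v w z m : V -> R) (x : V) (lam : R).

(** The selection functional when m has integral 1, in a form that is linear in w
    and visibly blind to constants. *)
Definition excess m w : R := \int[mu]_x ((m x - 1) * w x).

Lemma L1_excess m w : torus_Lp q%:E m -> sobolev s w -> L1 (fun x => (m x - 1) * w x).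
Proof.
move=> mq ws; apply: (torus_Lp_pairing q1); last exact: (sobolev_Lq q1 embedding).
have := torus_LpL 1 (-1) (ltW q1) mq (torus_Lp_cst d q 1).
by under eq_fun do rewrite mul1r mulN1r.
Qed.

Lemma excessL m w w' (a b : R) : torus_Lp q%:E m -> sobolev s w -> sobolev s w' ->
  excess m (fun x => a * w x + b * w' x) = a * excess m w + b * excess m w'.
Proof.
move=> mq ws ws'; have lw := L1_excess mq ws; have lw' := L1_excess mq ws'.
rewrite /excess -(RintegralZl a measurableT lw) -(RintegralZl b measurableT lw').
rewrite -(RintegralD measurableT (L1Z a lw) (L1Z b lw')).
by apply: eq_Rintegral => x _; ring.
Qed.

Lemma selection_excess m w : torus_Lp q%:E m -> \int[mu]_x m x = 1 -> sobolev s w ->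
  selection m w = excess m w.
Proof.
move=> mq m1 ws; have lm := torus_Lp_L1 (ltW q1) mq.
have lmw := L1_excess mq ws; have lw := sobolev_L1 s1 ws.
have e1 : \int[mu]_x (w x - mean w * m x) = 0.
  rewrite (RintegralB measurableT lw (L1Z _ lm)) (RintegralZl _ measurableT lm) m1.
  by rewrite mulr1 subrr.
rewrite -[RHS]addr0 -e1 -(RintegralD measurableT lmw (L1B lw (L1Z _ lm))).
by apply: eq_Rintegral => x _; rewrite /recenter; ring.
Qed.

(** The formal coefficients 1 and -1 keep all functions in the shape a u + b v, for
    which linearity is stated. *)
Lemma weak_grad_interpolate u1 u2 (G G' : R -> R) (K : R) :
  sobolev s u1 -> sobolev s u2 ->
  (forall t, is_derive t (1 : R) G (G' t)) ->
  (forall t, 0 <= G' t <= 1) -> (forall a b, `|G' a - G' b| <= K * `|a - b|) ->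
  let z := fun x => -1 * u1 x + 1 * u2 x in
  let v := fun x => 1 * u1 x + 1 * G (z x) in
  sobolev s v /\ {ae mu, forall x, weak_grad v x =
    G' (z x) *: weak_grad u2 x + (1 - G' (z x)) *: weak_grad u1 x}.
Proof.
move=> us1 us2 dG G01 GK z v.
have zs : sobolev s z by exact: sobolevL.
have G1 t : `|G' t| <= 1 by have /andP[h1 h2] := G01 t; rewrite ger0_norm.
have [Gs Gw] := sobolev_comp s1 zs dG G1 GK.
have vs : sobolev s v by exact: sobolevL.
split=> //.
suff : forall i, {ae mu, forall x, weak_partial i v x = G' (z x) * weak_partial i u2 x +
    (1 - G' (z x)) * weak_partial i u1 x}.
  move=> /filter_forall; apply: filterS => x hx.
  by apply/rowP => i; rewrite !mxE.
move=> i.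
apply: filterS2 (filterI (weak_partialL_ae s1 i (-1) 1 us1 us2) (weak_partial_ae (Gw i)))
  (weak_partialL_ae s1 i 1 1 us1 Gs) => x [e1 e2] e3.
rewrite [LHS]e3 e2 [weak_partial i z x]e1.
by ring.
Qed.

(** The gradient is pointwise a convex combination, with variable weight, of the
    gradients of two solutions. *)
Lemma ergodic_set_interpolate m lam u1 u2 (G G' : R -> R) (K : R) :
  ergodic_set s q H f m lam u1 -> ergodic_set s q H f m lam u2 ->
  (forall t, is_derive t (1 : R) G (G' t)) ->
  (forall t, 0 <= G' t <= 1) -> (forall a b, `|G' a - G' b| <= K * `|a - b|) ->
  ergodic_set s q H f m lam (fun x => 1 * u1 x + 1 * G (-1 * u1 x + 1 * u2 x)).
Proof.
pose P := ergodic_solutionP f s1 q1 embedding Hper HC1 Hcvx Hmin.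
move=> /P[us1 dens le1] /P[us2 _ le2] dG G01 GK; apply/P.
have [vs Dv] := weak_grad_interpolate us1 us2 dG G01 GK.
split=> //; apply: filterS2 Dv (filterI le1 le2) => x -> [h1 h2].
have t01 := G01 (-1 * u1 x + 1 * u2 x); have /andP[t0 t1] := t01.
apply: le_trans (hamiltonian_convex Hcvx _ _ _ t01) _.
move: t0 t1; set t := G' _ => t0 t1.
have t1' : 0 <= 1 - t by rewrite subr_ge0.
have := ler_wpM2l t0 h2; have := ler_wpM2l t1' h1; lra.
Qed.

(** The functions t/2 + e G(t) / (2 L) with e = 1 and e = -1 have derivatives in
    [0, 1], so they give competitors. Both minimality inequalities hold, and
    z = u2 - u1 has itself excess 0, whence the excess of G(z) is 0. *)
Lemma argmin_excess0 m lam u1 u2 (G G' : R -> R) (L K : R) :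
  argmin_selection s q H f m lam u1 -> argmin_selection s q H f m lam u2 ->
  (forall t, is_derive t (1 : R) G (G' t)) -> 0 < L ->
  (forall t, `|G' t| <= L) -> (forall a b, `|G' a - G' b| <= K * `|a - b|) ->
  excess m (fun x => G (-1 * u1 x + 1 * u2 x)) = 0.
Proof.
move=> [e1 min1] [e2 min2] dG L0 GL GK.
pose P := ergodic_solutionP f s1 q1 embedding Hper HC1 Hcvx Hmin.
have [us1 [mq _ m1 _ _] _] := (P _ _ _).1 e1.
have [us2 _ _] := (P _ _ _).1 e2.
pose z := fun x => -1 * u1 x + 1 * u2 x.
have zs : sobolev s z by exact: sobolevL.
have [Gs _] := sobolev_comp s1 zs dG GL GK.
have z0 : excess m z = 0.
  rewrite excessL// -!(selection_excess mq m1)//.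
  rewrite (_ : selection m u1 = selection m u2); first by ring.
  by apply/eqP; rewrite eq_le min1// min2.
have L'0 : 0 < L^-1 by rewrite invr_gt0.
have key (e : R) : `|e| <= 1 -> 0 <= e * excess m (G \o z).
  move=> e1'; pose A := fun t => 2^-1 * t + (2^-1 * L^-1 * e) * G t.
  pose A' := fun t => 2^-1 + (2^-1 * L^-1 * e) * G' t.
  have dA t : is_derive t (1 : R) A (A' t).
    have dGt := dG t.
    rewrite /A; apply: is_derive_eq; rewrite /A' /GRing.scale/=; ring.
  have lip a b : `|A' a - A' b| <= `|2^-1 * L^-1 * e| * K * `|a - b|.
    rewrite /A' (_ : _ - _ = 2^-1 * L^-1 * e * (G' a - G' b)); last by ring.
    by rewrite normrM -[leRHS]mulrA; apply: ler_wpM2l.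
  have A01 t : 0 <= A' t <= 1.
    have : `|L^-1 * e * G' t| <= 1.
      rewrite 2!normrM (gtr0_norm L'0) mulrAC -[leRHS]mulr1; apply: ler_pM => //.
        by rewrite mulr_ge0// ltW.
      by rewrite mulrC ler_pdivrMr// mul1r.
    by rewrite ler_norml /A' -!mulrA => /andP[h1 h2]; apply/andP; split; lra.
  have As := min1 _ (ergodic_set_interpolate e1 e2 dA A01 lip).
  have Azs : sobolev s (fun x => 2^-1 * z x + (2^-1 * L^-1 * e) * (G \o z) x).
    exact: sobolevL.
  have vs : sobolev s (fun x => 1 * u1 x + 1 * A (-1 * u1 x + 1 * u2 x)).
    exact: sobolevL.
  have eA : excess m (fun x => A (-1 * u1 x + 1 * u2 x)) =
      2^-1 * excess m z + (2^-1 * L^-1 * e) * excess m (G \o z).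
    exact: (excessL _ _ mq zs Gs).
  have ev : excess m (fun x => 1 * u1 x + 1 * A (-1 * u1 x + 1 * u2 x)) =
      1 * excess m u1 + 1 * excess m (fun x => A (-1 * u1 x + 1 * u2 x)).
    exact: (excessL _ _ mq us1 Azs).
  move: As; rewrite !selection_excess// ev eA z0 !mul1r mulr0 add0r lerDl -!mulrA pmulr_rge0// pmulr_rge0//.
have := key 1; have := key (-1); rewrite normrN1 normr1 mulN1r mul1r lexx.
move=> /(_ isT) h1 /(_ isT) h2; apply/eqP; rewrite eq_le h2 andbT.
by rewrite -oppr_ge0.
Qed.

(** Take for G the spikes at a: a level set of u2 - u1 has the same volume as
    m-mass. *)
Lemma argmin_level0 m lam u1 u2 a :
  argmin_selection s q H f m lam u1 -> argmin_selection s q H f m lam u2 ->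
  \int[mu]_x (((-1 * u1 x + 1 * u2 x) == a)%:R * (m x - 1)) = 0.
Proof.
move=> a1 a2.
pose P := ergodic_solutionP f s1 q1 embedding Hper HC1 Hcvx Hmin.
have [us1 [mq _ m1 _ _] _] := (P _ _ _).1 a1.1.
have [us2 _ _] := (P _ _ _).1 a2.1.
pose z := fun x => -1 * u1 x + 1 * u2 x.
have zs : sobolev s z by exact: sobolevL.
have lm : L1 (fun x => m x - 1) by exact: L1B (torus_Lp_L1 (ltW q1) mq) (L1_cst mu 1).
have := @int_spike_cvg R d z (fun x => m x - 1) a (L1_measurable (sobolev_L1 s1 zs)) lm.
rewrite (_ : (fun k : nat => _) = fun=> 0) => [c|].
  exact: (cvg_unique (@norm_hausdorff _ R) c (cvg_cst _)).
apply/funext => k; have k0 : 0 < k.+1%:R :> R by [].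
have bd t : `|dspike k.+1%:R a t| <= k.+1%:R by exact: dspike_bound.
have lip t t' := dspike_lipschitz a t t' k0.
rewrite -[RHS](argmin_excess0 a1 a2 (is_derive_spike k.+1%:R a) k0 bd lip).
by apply: eq_Rintegral => x _; rewrite mulrC.
Qed.

Lemma measurable_levels z (l : seq R) : measurable_fun setT z ->
  measurable_fun setT (fun x => (z x \in l)%:R : R).
Proof.
move=> mz; rewrite (_ : (fun _ => _) = fun x => \big[Num.max/0]_(a <- l) (z x == a)%:R).
  elim: l => [|a l IH]; first by under eq_fun do rewrite big_nil; exact: measurable_cst.
  under eq_fun do rewrite big_cons.
  by apply: measurable_maxr => //; exact: measurable_level.
apply/funext => x; elim: l => [|a l IH]; first by rewrite big_nil.
rewrite big_cons inE -IH; case: eqP => _ /=; last by rewrite max_r.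
by rewrite max_l// lern1; case: (_ \in _).
Qed.

(** The level sets of distinct values are disjoint, so that their excesses add up. *)
Lemma argmin_levels0 m lam u1 u2 (l : seq R) :
  argmin_selection s q H f m lam u1 -> argmin_selection s q H f m lam u2 ->
  \int[mu]_x (((-1 * u1 x + 1 * u2 x) \in l)%:R * (m x - 1)) = 0.
Proof.
move=> a1 a2.
pose P := ergodic_solutionP f s1 q1 embedding Hper HC1 Hcvx Hmin.
have [us1 [mq _ m1 _ _] _] := (P _ _ _).1 a1.1.
have [us2 _ _] := (P _ _ _).1 a2.1.
pose z := fun x => -1 * u1 x + 1 * u2 x.
have mz : measurable_fun setT z by apply/L1_measurable/(sobolev_L1 s1)/sobolevL.
have lm : L1 (fun x => m x - 1) by exact: L1B (torus_Lp_L1 (ltW q1) mq) (L1_cst mu 1).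
have lN (g : V -> bool) : measurable_fun setT (fun x => (g x)%:R : R) ->
    L1 (fun x => (g x)%:R * (m x - 1)).
  move=> mg; under eq_fun do rewrite mulrC.
  by apply: (L1M (M := 1)) => // x; case: (g x); rewrite ?normr1 ?normr0.
elim: l => [|a l IH].
  by rewrite -[RHS](Rint_cst1 mu); apply: eq_Rintegral => x _; rewrite mul0r.
have [al|al] := boolP (a \in l).
  have e x : (z x \in a :: l) = (z x \in l) by rewrite inE; case: eqP => [->|].
  by under eq_Rintegral do rewrite e.
have e x : (z x \in a :: l)%:R = (z x == a)%:R + (z x \in l)%:R :> R.
  by rewrite inE; case: eqP => [->|_]; rewrite ?(negbTE al) ?addr0 ?add0r.
under eq_Rintegral do rewrite e mulrDl.
rewrite (RintegralD measurableT (lN _ (measurable_level a mz)) (lN _ (measurable_levels l mz))).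
by rewrite IH addr0 (argmin_level0 a a1 a2).
Qed.

End selection.

(** * Uniqueness of the selected solution *)

Section selection_unique.
Context (R : realType) (d : nat) (s q : R).
Local Notation V := 'rV[R]_d.
Local Notation mu := (torus_measure R d).
Local Notation L1 := (summable_fun mu).
Variables (H : V -> V -> R) (f : V -> R -> R).
Hypothesis s1 : 1 < s.
Hypothesis q1 : 1 < q.
Hypothesis embedding : @sobolev_embedding R d s (hoelder_conjugate q%:E).
Hypothesis Hper : torus_periodic H.
Hypothesis HC1 : class_C 1 (fun z : V * V => H z.1 z.2).
Hypothesis Hcvx : forall x, strictly_convex (H x).
Hypothesis Hmin : forall x p, H x 0 <= H x p.
Hypothesis fcont : {within [set z : V * R | 0 <= z.2],
  continuous (fun z : V * R => f z.1 z.2)}.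
Hypothesis fmono : forall x r1 r2, 0 <= r1 -> r1 < r2 -> f x r1 < f x r2.
Implicit Types (u v w z m : V -> R) (x : V) (lam : R).


(** Continuity of f is only given on the closed half-space r >= 0, which contains
    the line r = 0. *)
Lemma coupling_continuous0 : continuous (fun x => f x 0).
Proof.
move=> x; have c := (subspace_continuousP _ _).1 fcont (x, 0) (lexx 0).
have cp : {for x, continuous (fun y : V => (y, 0 : R))}.
  apply: differentiable_continuous.
  by apply: differentiable_pair; [exact: ex_diff|exact: differentiable_cst].
move=> B /c hB; have hx : \forall y \near x, (0 <= (0 : R) -> B (f y 0)).
  exact: (cp _ hB).
change (nbhs x ((fun x => f x 0) @^-1` B)).
by apply: filterS hx => y; apply.
Qed.

Lemma open_positive lam : open [set x | f x 0 + lam < H x 0].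
Proof.
rewrite (_ : mkset _ = (fun x => f x 0 + lam - H x 0) @^-1` [set t | t < 0]).
  apply: open_comp; last exact: open_lt.
  move=> x _.
  have c1 := coupling_continuous0 (x := x); have c2 := hamiltonian_continuous0 HC1 (x := x).
  exact: (cvgB (cvgD c1 (cvg_cst lam)) c2).
by apply/seteqP; split => x /=; rewrite subr_lt0.
Qed.

(** The open set U where f(x, 0) + lam < H(x, 0) is {m > 0} up to a null set:
    there both gradients are 0, so that z takes countably many values c_0, c_1, ...
    on U. The level sets of the c_k thus carry the whole mass of m, and therefore,
    by equality of volume and m-mass on level sets, have full volume. As Dz = 0 on
    every level set, z is constant. *)
Lemma argmin_diff_cst m lam u1 u2 :
  argmin_selection s q H f m lam u1 -> argmin_selection s q H f m lam u2 ->
  let z := fun x => -1 * u1 x + 1 * u2 x in {ae mu, forall x, z x = mean z}.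
Proof.
move=> a1 a2 z.
pose P := ergodic_solutionP f s1 q1 embedding Hper HC1 Hcvx Hmin.
pose flat := weak_grad_flat s1 q1 embedding HC1 Hcvx Hmin.
have [us1 [mq m0 m1 le0 eq0] _] := (P _ _ _).1 a1.1.
have [us2 _ _] := (P _ _ _).1 a2.1.
have zs : sobolev s z by exact: sobolevL.
have lz := sobolev_L1 s1 zs; have mz := L1_measurable lz.
have lm := torus_Lp_L1 (ltW q1) mq.
pose U := [set x | f x 0 + lam < H x 0].
have mU : {ae mu, forall x, 0 < m x -> U x}.
  by apply: filterS eq0 => x h mx; rewrite /U/= (h mx) ltrD2r; exact: fmono.
have Dz0 : {ae mu, forall x, U x -> forall i, weak_partial i z x = 0}.
  have h : {ae mu, forall x, forall i, weak_partial i z x =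
      -1 * weak_partial i u1 x + 1 * weak_partial i u2 x}.
    by apply: filter_forall => i; exact: (weak_partialL_ae s1 i (-1) 1 us1 us2).
  have f1' := flat _ _ _ _ a1.1; have f2' := flat _ _ _ _ a2.1.
  apply: filterS2 (filterI h (filterI m0 le0)) (filterI f1' f2').
  move=> x [zx [mx lex]] [f1 f2] Ux i.
  have mx0 : 0 < m x.
    rewrite lt0r mx andbT; apply/negP => /eqP mx0.
    by move: lex; rewrite mx0 leNgt => /negP; exact.
  have e1 := f1 mx0; have e2 := f2 mx0.
  have := congr1 (fun v : V => v ord0 i) e1; have := congr1 (fun v : V => v ord0 i) e2.
  by rewrite !mxE zx => -> ->; rewrite !mulr0 addr0.
have wz i := sobolev_weak_partial i zs.
have [c zc] := countable_values (open_positive (lam := lam)) lz wz Dz0.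
apply: (weak_partial0_cst lz wz) => i.
(* The indicator of the first n level sets, and a bounded gauge of Dz that
   vanishes on them. *)
pose g n x : R := (z x \in [seq c k | k <- iota 0 n])%:R.
have g01 n x : 0 <= g n x <= 1 by rewrite /g; case: (_ \in _); rewrite ?lexx ?ler01.
have mg n : measurable_fun setT (g n) by exact: measurable_levels.
have lg n : L1 (g n).
  by apply: (@L1_bounded _ _ _ mu _ 1 (mg n)) => x; have /andP[h1 h2] := g01 n x; rewrite ger0_norm.
have lgm n : L1 (fun x => g n x * m x).
  under eq_fun do rewrite mulrC.
  by apply: (L1M (M := 1)) => // x; have /andP[h1 h2] := g01 n x; rewrite ger0_norm.
have intg n : \int[mu]_x g n x = \int[mu]_x (g n x * m x).
  apply/eqP; rewrite -subr_eq0 -oppr_eq0 opprB -(RintegralB measurableT (lgm n) (lg n)).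
  rewrite -[X in _ == X](argmin_levels0 s1 q1 embedding Hper HC1 Hcvx Hmin [seq c k | k <- iota 0 n] a1 a2).
  by apply/eqP; apply: eq_Rintegral => x _; rewrite mulrBr mulr1.
have cg : (\int[mu]_x (g n x * m x)) @[n --> \oo] --> (1 : R).
  rewrite -m1; apply: (Rint_dct _ _ (L1_norm lm)).
  - by move=> n; exact: L1_measurable (lgm n).
  - exact: (L1_measurable lm).
  - move=> n x; have /andP[h1 h2] := g01 n x.
    by rewrite normrM ger0_norm// ler_piMl.
  - apply: filterS2 m0 (filterI mU zc) => x mx [mUx zcx].
    move: mx; rewrite le_eqVlt => /predU1P[<-|/mUx/zcx[N zN]].
      by under eq_fun do rewrite mulr0; exact: cvg_cst.
    apply: cvg_near_cst; exists N.+1 => // n /= Nn.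
    rewrite /g zN map_f ?mul1r// mem_iota add0n//.
have gw n : {ae mu, forall x, g n x = 1 -> weak_partial i z x = 0}.
  have : {ae mu, forall x k, z x = c k -> weak_partial i z x = 0}.
    by apply: ae_foralln => k; exact: (weak_partial_level_set (c k) lz zs.1.1 (wz i)).
  apply: filterS => x h; rewrite /g; case: mapP => [[k _ /h//]|_ /eqP].
  by rewrite eq_sym oner_eq0.
pose h x := Num.min `|weak_partial i z x| 1.
have mw := L1_measurable (sobolev_weak_partial_L1 s1 i zs).
have h0 x : 0 <= h x by rewrite /h le_min normr_ge0 ler01.
have lh : L1 h.
  apply: (@L1_bounded _ _ _ mu _ 1) => [|x]; last by rewrite ger0_norm// /h ge_min lexx orbT.
  by apply: measurable_minr => //; exact: measurableT_comp.
have hle n : \int[mu]_x h x <= 1 - \int[mu]_x (g n x * m x).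
  rewrite -intg -[X in X - _](Rint_cst1 mu) -(RintegralB measurableT (L1_cst mu 1) (lg n)).
  apply: (Rint_ae_le lh (L1B (L1_cst mu 1) (lg n))).
  apply: filterS (gw n) => x; rewrite /g; case: (_ \in _) => /= [/(_ erefl) w0|_].
    by rewrite /h w0 normr0 subrr ge_min lexx.
  by rewrite subr0 /h ge_min lexx orbT.
have hint0 : \int[mu]_x h x = 0.
  apply/eqP; rewrite eq_le; apply/andP; split; last exact: Rintegral_ge0.
  have c1 : (1 - \int[mu]_x (g n x * m x)) @[n --> \oo] --> (1 - 1 : R).
    by apply: cvgB => //; exact: cvg_cst.
  rewrite subrr in c1; rewrite -(cvg_lim (@norm_hausdorff _ R) c1).
  apply: limr_ge; first by apply/cvg_ex; exists 0.
  by apply: nearW => n; exact: hle.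
have := Rint_ge0_eq0_ae lh (aeW _ h0) hint0.
apply: filterS => x; rewrite /h; case: leP => _; first by move=> /eqP; rewrite normr_eq0 => /eqP.
by move=> /eqP; rewrite oner_eq0.
Qed.

Lemma argmin_uniq m lam u1 u2 :
  argmin_selection s q H f m lam u1 -> argmin_selection s q H f m lam u2 ->
  mean u1 = mean u2 -> {ae mu, forall x, u1 x = u2 x}.
Proof.
move=> a1 a2 m12.
pose P := ergodic_solutionP f s1 q1 embedding Hper HC1 Hcvx Hmin.
have [us1 _ _] := (P _ _ _).1 a1.1; have [us2 _ _] := (P _ _ _).1 a2.1.
have l1 := sobolev_L1 s1 us1; have l2 := sobolev_L1 s1 us2.
have := argmin_diff_cst a1 a2; rewrite /mean.
rewrite (RintegralD measurableT (L1Z (-1) l1) (L1Z 1 l2)).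
rewrite (RintegralZl _ measurableT l1) (RintegralZl _ measurableT l2).
rewrite -!/(mean _) m12 mulN1r mul1r addNr; apply: filterS => x.
by rewrite mulN1r mul1r => /eqP; rewrite addrC subr_eq0 => /eqP.
Qed.

End selection_unique.

(** * Bounded functionals *)

Section sobolev_functionals.
Context (R : realType) (d : nat) (s q : R).
Local Notation V := 'rV[R]_d.
Local Notation mu := (torus_measure R d).
Local Notation L1 := (summable_fun mu).
Implicit Types (u v w g : V -> R).
Hypothesis s1 : 1 < s.
Hypothesis q1 : 1 < q.
Hypothesis embedding : @sobolev_embedding R d s (hoelder_conjugate q%:E).

Lemma torus_norm_fin_num p v : torus_Lp p%:E v -> torus_norm p%:E v \is a fin_num.
Proof.
move=> [_]; rewrite inE => /andP[_]; rewrite inE /finite_norm => h.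
by rewrite ge0_fin_numE ?Lnorm_ge0.
Qed.

Lemma bounded_pairing_Lp p v : 1 < p -> torus_Lp (conjR p)%:E v ->
  bounded_functional (torus_Lp p%:E) (torus_norm p%:E)
    (fun w => \int[mu]_x (w x * v x)).
Proof.
move=> p1 vp; split=> [a w w' wp wp'|].
  have lw := torus_Lp_pairing p1 wp vp; have lw' := torus_Lp_pairing p1 wp' vp.
  rewrite -(RintegralZl a measurableT lw) -(RintegralD measurableT (L1Z a lw) lw').
  by apply: eq_Rintegral => x _; rewrite mulrDl mulrA.
exists (fine (torus_norm (conjR p)%:E v)) => w wp.
rewrite fineK ?torus_norm_fin_num// muleC.
exact: norm_pairing_le.
Qed.

Lemma bounded_pairing_sobolev g : torus_Lp q%:E g ->
  bounded_functional (sobolev s) (sobolev_norm s) (fun u => \int[mu]_x (g x * u x)).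
Proof.
move=> gq; have lgu u (us : sobolev s u) := torus_Lp_pairing q1 gq (sobolev_Lq q1 embedding us).
split=> [a u v us vs|].
  rewrite -(RintegralZl a measurableT (lgu _ us)).
  rewrite -(RintegralD measurableT (L1Z a (lgu _ us)) (lgu _ vs)).
  by apply: eq_Rintegral => x _; rewrite mulrDr mulrCA.
have [C hC] := embedding.
exists (fine (torus_norm q%:E g) * C) => u us.
have [uq nu] := hC _ us; rewrite conjugateE// in uq nu.
apply: le_trans (norm_pairing_le q1 gq uq) _.
rewrite (EFinM _ C) fineK ?torus_norm_fin_num// -muleA.
by apply: lee_wpmul2l => //; exact: Lnorm_ge0.
Qed.

Lemma torus_norm_ae0 p v : 1 <= p -> measurable_fun setT v ->
  {ae mu, forall x, v x = 0} -> torus_norm p%:E v = 0%E.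
Proof.
move=> p1 mv v0; have p0 : p != 0 by rewrite gt_eqF// (lt_le_trans ltr01).
rewrite /torus_norm unlock (@ae_eq_integral _ _ _ mu setT (cst 0%E)) ?integral0//.
- by rewrite poweR0r// invr_eq0.
- apply/measurable_EFinP; exact: (measurable_abs_powR p mv).
- by apply: filterS v0 => x /= -> _; rewrite normr0 powR0.
Qed.

Lemma sobolev_norm_ae0 u : sobolev s u -> {ae mu, forall x, u x = 0} ->
  sobolev_norm s u = 0%E.
Proof.
move=> us u0; have lu := sobolev_L1 s1 us.
rewrite /sobolev_norm torus_norm_ae0 ?(ltW s1)//; last exact: L1_measurable lu.
rewrite add0e big1// => i _; apply: torus_norm_ae0; first exact: ltW.
  exact: L1_measurable (sobolev_weak_partial_L1 s1 i us).
apply: (weak_partial_ae (v := cst 0)); split; first exact: torus_Lp_cst.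
move=> phi tphi.
rewrite (_ : \int[mu]_x _ = \int[mu]_x (cst 0 x : R)); last first.
  apply: Rint_ae_eq => //.
    apply: measurable_funM; first exact: L1_measurable lu.
    under eq_fun do rewrite gradE.
    exact: test_measurable (test_derive _ tphi).
  by apply: filterS u0 => x ->; rewrite mul0r.
under [in RHS]eq_Rintegral do rewrite mul0r.
by rewrite !Rint_cst1 oppr0.
Qed.

(** Limits are characterised through functionals only, and the Sobolev norm of a
    function that vanishes almost everywhere is 0. *)
Lemma bounded_functional_ae_eq l u v :
  bounded_functional (sobolev s) (sobolev_norm s) l -> sobolev s u -> sobolev s v ->
  {ae mu, forall x, u x = v x} -> l u = l v.
Proof.
move=> [lL [C lC]] us vs uv.
pose z := fun x => -1 * v x + u x.
have zs : sobolev s z.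
  rewrite (_ : z = fun x => -1 * v x + 1 * u x); first exact: sobolevL.
  by apply/funext => x; rewrite mul1r.
have z0 : {ae mu, forall x, z x = 0} by apply: filterS uv => x; rewrite /z => ->; ring.
have := lC _ zs; rewrite sobolev_norm_ae0// mule0 lee_fin normr_le0 lL// => /eqP h.
lra.
Qed.

End sobolev_functionals.

(** * The vanishing discount limit *)

Section vanishing_discount.
Context (R : realType) (d : nat) (s q : R).
Local Notation V := 'rV[R]_d.
Local Notation mu := (torus_measure R d).
Local Notation L1 := (summable_fun mu).
Variables (H : V -> V -> R) (f : V -> R -> R).
Hypothesis s1 : 1 < s.
Hypothesis q1 : 1 < q.
Hypothesis embedding : @sobolev_embedding R d s (hoelder_conjugate q%:E).
Hypothesis Hper : torus_periodic H.
Hypothesis HC1 : class_C 1 (fun z : V * V => H z.1 z.2).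
Hypothesis Hcvx : forall x, strictly_convex (H x).
Hypothesis Hmin : forall x p, H x 0 <= H x p.
Hypothesis fcont : {within [set z : V * R | 0 <= z.2],
  continuous (fun z : V * R => f z.1 z.2)}.
Hypothesis fmono : forall x r1 r2, 0 <= r1 -> r1 < r2 -> f x r1 < f x r2.
Implicit Types (u v w z m : V -> R) (x : V) (lam : R).


Lemma excessE m w : torus_Lp q%:E m -> sobolev s w ->
  excess m w = \int[mu]_x (m x * w x) - mean w.
Proof.
move=> mq ws; have lmw := torus_Lp_pairing q1 mq (sobolev_Lq q1 embedding ws).
rewrite /mean -(RintegralB measurableT lmw (sobolev_L1 s1 ws)).
by apply: eq_Rintegral => x _; rewrite mulrBl mul1r.
Qed.

(** With p = Du, p' = Dv, first order convexity bounds the left-hand side by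
    mm (H(x, p') - H(x, p)). Both Hamiltonians are controlled by the two equations,
    and what remains is m (lam + eps u) <= mm (f(x, mm) - f(x, m)). Where m > 0,
    one has p' = 0 and eps u + H(x, 0) <= f(x, mm), so this is the monotonicity of
    f. *)
Lemma discounted_duality eps u mm v m lam : 0 < eps ->
  discounted_solution s q H f eps u mm -> ergodic_set s q H f m lam v ->
  {ae mu, forall x, mm x * dotv (grad (H x) (weak_grad u x)) (weak_grad v x - weak_grad u x)
    <= (lam + eps * u x) * (mm x - m x)}.
Proof.
move=> eps0 [[us mq mm0 mm1 _] dle deq _] ev.
have [[vs _ m0 _ _] ele eeq _] := ev.
have flat := weak_grad_flat s1 q1 embedding HC1 Hcvx Hmin ev.
apply: filterS2 (filterI mm0 (filterI dle deq)) (filterI (filterI m0 flat) (filterI ele eeq)).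
move=> x [M0 [dlex deqx]] [[m0x flatx] [elex eeqx]].
set p := weak_grad u x in dlex deqx *; set p' := weak_grad v x in flatx elex eeqx *.
set M := mm x in M0 dlex deqx *; set N := m x in m0x flatx elex eeqx *.
have first : dotv (grad (H x) p) (p' - p) <= H x p' - H x p.
  by rewrite lerBrDl; exact: (hamiltonian_first_order HC1 Hcvx).
have mono : 0 <= (M - N) * (f x M - f x N).
  have [NM|MN|->] := ltgtP N M; last by rewrite !subrr mul0r.
    by apply: mulr_ge0; rewrite subr_ge0 ltW//; exact: fmono.
  by rewrite -mulrNN; apply: mulr_ge0; rewrite opprB subr_ge0 ltW//; exact: fmono.
have hN : N * (lam + eps * u x) <= N * (f x M - f x N).
  move: m0x; rewrite le_eqVlt => /predU1P[<-|N0]; first by rewrite !mul0r.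
  rewrite ler_pM2l//; have := eeqx N0; rewrite (flatx N0) => e0.
  by have := Hmin x p; lra.
move: M0; rewrite le_eqVlt => /predU1P[M0|M0].
  by move: mono hN; rewrite -M0 mul0r !sub0r => mono hN; lra.
apply: le_trans (ler_wpM2l (ltW M0) first) _.
have := ler_wpM2l (ltW M0) elex; have := deqx M0 => e.
have -> : H x p = f x M - eps * u x by lra.
by lra.
Qed.

(** Integrate the pointwise inequality; the discounted transport equation, tested
    with v and with u, evaluates the left-hand side. *)
Lemma discounted_excess eps u mm v m lam : 0 < eps ->
  discounted_solution s q H f eps u mm -> ergodic_set s q H f m lam v ->
  torus_Lp q%:E m -> \int[mu]_x m x = 1 -> excess m u <= excess mm v.
Proof.
move=> eps0 sol ev mq m1; have [adm _ _ deq] := sol.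
have [us mmq _ mm1 _] := adm; have lF := flux_Lp s1 adm.
have vs : sobolev s v by case: ev => -[].
have test w : sobolev s w -> eps * \int[mu]_x (mm x * w x) +
    \int[mu]_x dotv (flux H u mm x) (weak_grad w x) = eps * mean w.
  move=> ws; apply: (weak_eq_sobolev s1 q1 mmq lF ws (sobolev_Lq q1 embedding ws)).
  by move=> phi /deq; rewrite /divergence opprK.
have lD w (ws : sobolev s w) := L1_dotv_grad s1 ws lF.
have uq := sobolev_Lq q1 embedding us; have vq := sobolev_Lq q1 embedding vs.
have lm := torus_Lp_L1 (ltW q1) mq; have lmm := torus_Lp_L1 (ltW q1) mmq.
have lmu := torus_Lp_pairing q1 mq uq; have lmmu := torus_Lp_pairing q1 mmq uq.
have dual : \int[mu]_x (dotv (flux H u mm x) (weak_grad v x) -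
      dotv (flux H u mm x) (weak_grad u x)) <=
    \int[mu]_x (lam * (mm x - m x) + eps * (mm x * u x - m x * u x)).
  apply: Rint_ae_le; first exact: L1B (lD _ vs) (lD _ us).
    exact: L1D (L1Z lam (L1B lmm lm)) (L1Z eps (L1B lmmu lmu)).
  apply: filterS (discounted_duality eps0 sol ev) => x.
  rewrite /flux !dotvZl dotvBr; lra.
have arith (a b c dv du mu mv : R) : eps * a + du = eps * mu -> eps * b + dv = eps * mv ->
    dv - du <= eps * (a - c) -> c - mu <= b - mv.
  by move=> h1 h2 h3; rewrite -(ler_pM2l eps0); lra.
move: dual; rewrite (RintegralB measurableT (lD _ vs) (lD _ us)).
rewrite (RintegralD measurableT (L1Z lam (L1B lmm lm)) (L1Z eps (L1B lmmu lmu))).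
rewrite (RintegralZl lam measurableT (L1B lmm lm)) (RintegralB measurableT lmm lm).
rewrite (RintegralZl eps measurableT (L1B lmmu lmu)) (RintegralB measurableT lmmu lmu).
rewrite m1 mm1 subrr mulr0 add0r; have := test _ vs; have := test _ us.
rewrite !excessE// => h1 h2 h3; exact: arith h1 h2 h3.
Qed.

Lemma excess_recenter m u : torus_Lp q%:E m -> \int[mu]_x m x = 1 -> sobolev s u ->
  excess m (recenter u) = excess m u.
Proof.
move=> mq m1 us; have cs : sobolev s (cst (mean u) : V -> R) by exact: sobolev_cst.
have -> : recenter u = fun x => 1 * u x + -1 * (cst (mean u) : V -> R) x.
  by apply/funext => x; rewrite mul1r mulN1r.
rewrite (excessL q1 embedding 1 (-1) mq us cs) mul1r mulN1r.
rewrite [X in _ - X](_ : _ = 0) ?subr0// /excess /=.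
have lm := torus_Lp_L1 (ltW q1) mq.
under eq_Rintegral do rewrite mulrC.
rewrite (RintegralZl _ measurableT (L1B lm (L1_cst mu 1))).
by rewrite (RintegralB measurableT lm (L1_cst mu 1)) m1 Rint_cst1 subrr mulr0.
Qed.

Lemma mean_recenter u : sobolev s u -> mean (recenter u) = 0.
Proof.
move=> us; rewrite {1}/mean /recenter.
rewrite (RintegralB measurableT (sobolev_L1 s1 us) (L1_cst mu (mean u))).
by rewrite Rint_cst1 subrr.
Qed.

Variables (m : V -> R) (lam : R) (ue me : R -> V -> R).
Hypothesis erg_pair : ergodic_pair s q H f m lam.
Hypothesis disc : forall eps, 0 < eps -> discounted_solution s q H f eps (ue eps) (me eps).
Hypothesis stable : compact_stable s q H f ue me.

(** The stability property provides a limit, whose density and constant are m and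
    lam by uniqueness. The inequality excess m u^eps <= excess m^eps v is linear in
    the two weakly converging sequences, so it survives in the limit. *)
Lemma vanishing_discount_subsequence (e : R^nat) : (forall n, 0 < e n) -> e @ \oo --> 0 ->
  exists (k : nat -> nat) ub, [/\ argmin_selection s q H f m lam ub, mean ub = 0 &
    weak_cvg_sobolev s \oo (fun n => recenter (ue (e (k n)))) ub].
Proof.
move=> e0 ecvg; have [k [ub [mb [lb [_ [solb ucvg mcvg _]]]]]] := stable e0 ecvg.
exists k, ub.
pose P := ergodic_solutionP f s1 q1 embedding Hper HC1 Hcvx Hmin.
have [mq [u0 sol0]] := erg_pair.
have [_ dens _] := (P _ _ _).1 sol0; have [_ m0 m1 _ _] := dens.
have [ubs densb leb] := (P _ _ _).1 solb; have [mbq _ _ _ _] := densb.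
have [mmb lamlb] := ergodic_density_uniq q1 fmono dens densb.
have us n : sobolev s (ue (e n)) by have [[]] := disc (e0 n).
have eub : ergodic_set s q H f m lam ub.
  by apply/P; split=> //; apply: filterS2 mmb leb => x -> ; rewrite lamlb.
have cmean : mean ub = 0.
  have := ucvg _ (bounded_pairing_sobolev q1 embedding (torus_Lp_cst d q 1)).
  rewrite (_ : (fun n : nat => _) = fun=> 0).
    move=> c; have := cvg_unique (@norm_hausdorff _ R) c (cvg_cst _).
    by rewrite /mean => <-; apply: eq_Rintegral => x _; rewrite mul1r.
  apply/funext => n; rewrite -[RHS](mean_recenter (us (k n))).
  by apply: eq_Rintegral => x _; rewrite mul1r.
split=> //; split; first exact: eub.
move=> v ev.
have vs : sobolev s v by case: ev => -[].
have m1q : torus_Lp q%:E (fun x => m x - 1).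
  have := torus_LpL 1 (-1) (ltW q1) mq (torus_Lp_cst d q 1).
  by under eq_fun do rewrite mul1r mulN1r.
rewrite !(selection_excess s1 q1 embedding)//.
have c1 : excess m (ue (e (k n))) @[n --> \oo] --> excess m ub.
  have := ucvg _ (bounded_pairing_sobolev q1 embedding m1q).
  rewrite (_ : (fun n : nat => _) = fun n => excess m (ue (e (k n))))//.
  by apply/funext => n; exact: (excess_recenter mq m1 (us (k n))).
have c2 : excess (me (e (k n))) v @[n --> \oo] --> excess m v.
  have c := mcvg _ (bounded_pairing_Lp q1 (sobolev_Lq q1 embedding vs)).
  have mvs w : torus_Lp q%:E w -> measurable_fun setT (fun x => w x * v x).
    by move=> wq; exact: L1_measurable (torus_Lp_pairing q1 wq (sobolev_Lq q1 embedding vs)).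
  have mm n : torus_Lp q%:E (me (e n)) by have [[]] := disc (e0 n).
  rewrite excessE// (_ : (fun n : nat => _) = fun n =>
    \int[mu]_x (me (e (k n)) x * v x) - mean v); last first.
    by apply/funext => n; exact: excessE.
  rewrite (_ : \int[mu]_x (m x * v x) = \int[mu]_x (mb x * v x)).
    by apply: cvgB => //; exact: cvg_cst.
  apply: Rint_ae_eq; [exact: mvs|exact: mvs|].
  by apply: filterS mmb => x ->.
apply: (ler_cvg_to c1 c2); apply: nearW => n.
exact: (discounted_excess (e0 _) (disc (e0 _)) ev).
Qed.

(** Every sequence of discounts tending to 0 has a subsequence along which the limit
    is a minimiser of mean 0, and there is only one. *)
Lemma vanishing_discount : exists us, [/\ argmin_selection s q H f m lam us, mean us = 0,
  (forall v, argmin_selection s q H f m lam v -> mean v = 0 ->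
     {ae mu, forall x, v x = us x}) &
  weak_cvg_sobolev s 0^'+ (fun eps => recenter (ue eps)) us].
Proof.
have h0 n : 0 < (harmonic n : R) by exact: harmonic_gt0.
have [_ [us [aus mus _]]] := vanishing_discount_subsequence h0 cvg_harmonic.
have uniq v : argmin_selection s q H f m lam v -> mean v = 0 -> {ae mu, forall x, v x = us x}.
  move=> av mv.
  by apply: (argmin_uniq s1 q1 embedding Hper HC1 Hcvx Hmin fcont fmono av aus); rewrite mv.
exists us; split=> // l bl; apply: contrapT => ncvg.
(* Without convergence, l stays at distance e from l us along some t_n -> 0. *)
have [e e0 far] : exists2 e, 0 < e & forall n : nat, exists2 t : R,
    0 < t < n.+1%:R^-1 & e <= `|l us - l (recenter (ue t))|.
  have [e e0 ne] : exists2 e, 0 < e &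
      ~ \forall t \near 0^'+, `|l us - l (recenter (ue t))| < e.
    apply: contrapT => h; apply: ncvg; apply/cvgrPdist_lt => e e0.
    by apply: contrapT => h'; apply: h; exists e.
  exists e => // n; apply: contrapT => h; apply: ne.
  have n0 : (0 : R) < n.+1%:R^-1 by rewrite invr_gt0.
  apply: filterS2 (nbhs_right_gt (0 : R)) (nbhs_right_lt n0) => t t0 tn.
  by rewrite ltNge; apply/negP => et; apply: h; exists t => //; rewrite t0.
have /choice[t th] : forall n : nat, exists t : R, 0 < t < n.+1%:R^-1 /\
    e <= `|l us - l (recenter (ue t))|.
  by move=> n; have [t t1 t2] := far n; exists t.
have t0 n : 0 < t n by have [/andP[]] := th n.
have tcvg : t @ \oo --> (0 : R).
  apply: (@squeeze_cvgr _ _ _ _ (fun=> 0) (@harmonic R)).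
  - by apply: nearW => n; have [/andP[/ltW -> /ltW]] := th n.
  - exact: cvg_cst.
  - exact: cvg_harmonic.
have [k [ub [aub mub /(_ _ bl) cub]]] := vanishing_discount_subsequence t0 tcvg.
have sob v : argmin_selection s q H f m lam v -> sobolev s v by move=> [[[]]].
have lu := bounded_functional_ae_eq s1 bl (sob _ aub) (sob _ aus) (uniq _ aub mub).
rewrite lu in cub; have [N _ /(_ N (leqnn N))] := (cvgrPdist_lt _ _).1 cub _ e0.
by have [_] := th (k N); rewrite /= leNgt => /negP.
Qed.

End vanishing_discount.

Theorem corollary4p7 (R : realType) (d : nat) (s q : R)
    (H : 'rV[R]_d -> 'rV[R]_d -> R) (f : 'rV[R]_d -> R -> R)
    (m : 'rV[R]_d -> R) (lam : R) (ue me : R -> 'rV[R]_d -> R) :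
  (0 < d)%N -> 1 < s -> 1 < q ->
  @sobolev_embedding R d s (hoelder_conjugate q%:E) ->
  torus_periodic H ->
  class_C 1 (fun z : 'rV[R]_d * 'rV[R]_d => H z.1 z.2) ->
  (forall x, strictly_convex (H x)) ->
  (forall A : R, exists K : R, forall p : 'rV[R]_d, K < `|p| ->
    (A%:E <= ereal_inf [set (H x p)%:E | x in [set: 'rV[R]_d]])%E) ->
  (forall r, 0 <= r -> torus_periodic (f ^~ r)) ->
  {within [set z : 'rV[R]_d * R | 0 <= z.2],
    continuous (fun z : 'rV[R]_d * R => f z.1 z.2)} ->
  (forall x r1 r2, 0 <= r1 -> r1 < r2 -> f x r1 < f x r2) ->
  (exists2 C : R, 0 < C &
    forall x r, 0 <= r -> `|f x r| <= C * (1 + r `^ (q - 1))) ->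
  (forall x p, H x 0 <= H x p) ->
  ergodic_pair s q H f m lam ->
  (forall eps, 0 < eps ->
    discounted_solution s q H f eps (ue eps) (me eps)) ->
  compact_stable s q H f ue me ->
  exists us : 'rV[R]_d -> R,
    [/\ argmin_selection s q H f m lam us,
        mean us = 0,
        (forall v, argmin_selection s q H f m lam v -> mean v = 0 ->
          {ae torus_measure R d, forall x, v x = us x}) &
        weak_cvg_sobolev s 0^'+ (fun eps => recenter (ue eps)) us].
Proof.
move=> _ s1 q1 emb Hper HC1 Hcvx _ _ fcont fmono _ Hmin erg disc comp.
exact: (vanishing_discount s1 q1 emb Hper HC1 Hcvx Hmin fcont fmono erg disc comp).
Qed.
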